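(* Let $G$ be a discrete group and let $f\in \mathrm{B}(G)$ be positive (i.e. positive definite), GNS faithful and such that for every $n\in\mathbb{N}$ ($n\geq 1$), $f^{n}$ is singular. Then $f\perp \mathrm{B}_{0}(G)\cap \mathrm{NS}(G)$, i.e. $f\perp g$ for every $g\in \mathrm{B}_{0}(G)\cap \mathrm{NS}(G)$.
   Context: For a discrete group $G$, $\mathrm{B}(G)$ is the Fourier--Stieltjes algebra (linear span of positive definite functions), a commutative unital Banach algebra under pointwise multiplication, identified with the dual of the full group $C^*$-algebra $C^*(G)$ via $\langle f,x\rangle=\sum_g f(g)x(g)$, $x\in\mathbb{C}[G]$; positive functionals correspond to positive definite functions. $W^{\ast}(G):=C^*(G)^{**}=\mathrm{B}(G)^*$. $\mathrm{B}_{0}(G):=\mathrm{B}(G)\cap c_{0}(G)$. $\sigma(f)$ is the spectrum of $f$ in $\mathrm{B}(G)$, and $\mathrm{NS}(G)=\{f\in\mathrm{B}(G):\sigma(f)=\overline{f(G)}\}$. For $\varphi\in\mathrm{B}(G)$, the central support $\mathrm{zs}(\varphi)$ is the smallest central projection $z\in W^*(G)$ such that $\varphi$ vanishes on $(1-z)W^*(G)$; $\varphi\perp\psi$ means $\mathrm{zs}(\varphi)\mathrm{zs}(\psi)=0$. $f$ is singular if $f\perp\delta_e$, with $e$ the identity of $G$. For positive $\varphi$, the support $\mathrm{s}(\varphi)$ is the smallest projection $p\in W^*(G)$ such that $\varphi=p\varphi=\varphi p$, where $(x\varphi)(y)=\varphi(yx)$, $(\varphi x)(y)=\varphi(xy)$.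 A positive $\varphi$ is GNS faithful if the positive functional it induces on the von Neumann algebra generated by the image of its GNS representation is faithful; equivalently, $\mathrm{s}(\varphi)=\mathrm{zs}(\varphi)$. *)

(* Defs.v *)
(* The complex field is R[i], over an arbitrary realType R. *)
From HB Require Import structures.
From mathcomp Require Import all_boot all_order all_algebra.
From mathcomp Require Import finmap sesquilinear complex.
From mathcomp Require Import all_classical all_reals all_analysis.

Set Implicit Arguments.
Unset Strict Implicit.
Unset Printing Implicit Defensive.

Import Order.TTheory GRing.Theory Num.Theory.
Import numFieldNormedType.Exports.

Local Open Scope classical_set_scope.
Local Open Scope ring_scope.
Local Open Scope complex_scope.

(* MathComp norms with values in R[i] are nonnegative reals; this reads them
   in R. *)
Definition rnorm (R : realType) (V : normedModType R[i]) (v : V) : R :=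
  complex.Re `|v|.

Definition modulus (R : realType) (z : R[i]) : R := complex.Re `|z|.

(* A unitary representation of the discrete group G on a complex Hilbert space:
   the inner product urep_dot is linear in its first argument. *)
Record unitary_rep (R : realType) (G : groupType) := UnitaryRep {
  urep_space : completeNormedModType R[i];
  urep_dot : {dot urep_space for (@Num.conj R[i])};
  urep_normE : forall v, `|v| ^+ 2 = urep_dot v v;
  urep_act : G -> {linear urep_space -> urep_space};
  urep_act1 : forall v, urep_act 1%g v = v;
  urep_actM : forall g h v, urep_act (g * h)%g v = urep_act g (urep_act h v);
  urep_unitary : forall g v w,
    urep_dot (urep_act g v) (urep_act g w) = urep_dot v w
}.

Section FourierStieltjes.
Variables (R : realType) (G : groupType).
Local Notation C := (R[i]).
Local Notation CG := {fsfun G -> C with 0}.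

Definition rep_ext (U : unitary_rep R G) (a : CG) (v : urep_space U) :
    urep_space U :=
  \sum_(g <- finsupp a) a g *: urep_act U g v.

(* ||a|| = sup { ||pi(a)|| : pi a unitary representation of G }; C*(G) is the
   completion of C[G] for this norm. *)
Definition cstar_norm (a : CG) : R :=
  sup [set r : R | exists (U : unitary_rep R G) (v : urep_space U),
         rnorm v <= 1 /\ r = rnorm (rep_ext a v)].

Definition positive_definite (phi : G -> C) : Prop :=
  forall (n : nat) (g : 'I_n -> G) (c : 'I_n -> C),
    0 <= \sum_(i < n) \sum_(j < n) (c i)^* * c j * phi ((g i)^-1 * g j)%g.

Definition BG : set (G -> C) :=
  [set phi | exists (n : nat) (c : 'I_n -> C) (u : 'I_n -> G -> C),
     (forall i, positive_definite (u i)) /\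
     phi = (fun g => \sum_(i < n) c i * u i g)].

Definition pairing (phi : G -> C) (a : CG) : C :=
  \sum_(g <- finsupp a) phi g * a g.

(* The norm of C*(G)^*, computed on the dense subalgebra C[G]. *)
Definition BG_norm (phi : G -> C) : R :=
  sup [set r : R | exists a : CG,
         cstar_norm a <= 1 /\ r = modulus (pairing phi a)].

Definition spectrum (f : G -> C) : set C :=
  [set l | ~ exists2 h, BG h & forall g, (f g - l) * h g = 1].

Definition NSG : set (G -> C) :=
  [set f | BG f /\
     spectrum f = closure (range (f : G -> R[i]^o)) :> set C].

Definition c0G : set (G -> C) :=
  [set f | forall eps : R, 0 < eps ->
     finite_set [set g | eps <= modulus (f g)]].

Definition B0G : set (G -> C) := BG `&` c0G.

(* W*(G) = C*(G)^** = B(G)^*, the bounded linear functionals on B(G).  They are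
   encoded as functions on G -> C that vanish outside B(G), so that Leibniz
   equality is equality of functionals on B(G). *)
Definition Wstar : set ((G -> C) -> C) :=
  [set x | [/\ forall (c : C) (phi psi : G -> C), BG phi -> BG psi ->
                 x (fun g => c * phi g + psi g) = c * x phi + x psi,
               exists M : R, forall phi, BG phi ->
                 modulus (x phi) <= M * BG_norm phi
             & forall phi, ~ BG phi -> x phi = 0]].

(* The C*-algebra structure of the bidual: wmul is the Arens product
   (x y)(phi) = x (y phi), with (y phi)(g) = y (h |-> phi (g h)); wadj is
   x^*(phi) = conj (x (phi^* )), with phi^*(g) = conj (phi (g^-1)). *)
Definition wmul (x y : (G -> C) -> C) : (G -> C) -> C := fun phi =>
  if `[< BG phi >] then x (fun g => y (fun h => phi (g * h)%g)) else 0.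

Definition wone : (G -> C) -> C := fun phi =>
  if `[< BG phi >] then phi 1%g else 0.

Definition wsub (x y : (G -> C) -> C) : (G -> C) -> C :=
  fun phi => x phi - y phi.

Definition wadj (x : (G -> C) -> C) : (G -> C) -> C :=
  fun phi => (x (fun g => (phi (g^-1)%g)^*))^*.

Definition central_projection (z : (G -> C) -> C) : Prop :=
  [/\ Wstar z, wadj z = z, wmul z z = z
    & forall x, Wstar x -> wmul z x = wmul x z].

Definition carries (z : (G -> C) -> C) (phi : G -> C) : Prop :=
  forall x, Wstar x -> wmul (wsub wone z) x phi = 0.

(* z = zs(phi); the order of projections is z <= w iff z w = z. *)
Definition is_central_support (phi : G -> C) (z : (G -> C) -> C) : Prop :=
  [/\ central_projection z, carries z phi
    & forall w, central_projection w -> carries w phi -> wmul z w = z].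

Definition orthogonal_BG (phi psi : G -> C) : Prop :=
  exists z w, [/\ is_central_support phi z, is_central_support psi w
                & wmul z w = (fun=> 0)].

Definition delta_e : G -> C := fun g => (g == 1%g)%:R.

Definition singular (f : G -> C) : Prop := orthogonal_BG f delta_e.

Definition is_GNS (phi : G -> C) (U : unitary_rep R G) (xi : urep_space U) :
    Prop :=
  (forall g, phi g = urep_dot U (urep_act U g xi) xi) /\
  closure (range (fun a : CG => rep_ext a xi)) = setT.

Definition bounded_operator (H : normedModType C) : set (H -> H) :=
  [set T | linear T /\ continuous T].

Definition commutant (H : normedModType C) (S : set (H -> H)) : set (H -> H) :=
  [set T | bounded_operator T /\ forall A, S A -> T \o A = A \o T].

(* The von Neumann algebra generated by the image of the representation, as a
   double commutant. *)
Definition rep_vN (U : unitary_rep R G) : set (urep_space U -> urep_space U) :=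
  commutant (commutant (range (fun a : CG => rep_ext (U := U) a))).

Definition positive_operator (U : unitary_rep R G)
    (T : urep_space U -> urep_space U) : Prop :=
  forall v, 0 <= urep_dot U (T v) v.

(* The induced functional T |-> <T xi, xi> is faithful on the von Neumann
   algebra of the GNS representation; the GNS triple is unique up to unitary
   equivalence, so it does not matter which one is taken. *)
Definition GNS_faithful (phi : G -> C) : Prop :=
  exists (U : unitary_rep R G) (xi : urep_space U), is_GNS phi xi /\
    forall T, rep_vN T -> positive_operator T ->
      urep_dot U (T xi) xi = 0 -> T = (fun=> 0).

End FourierStieltjes.

(* Main.v *)
(* Every function of B(G) lies in the reproducing kernel Hilbert space H_u of some
   positive definite u, on which G acts by right translations and W*(G) acts by
   (x.phi)(g) = x (phi (g _)); the unit ball of B(G) is described by these spaces,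
   is multiplicative by Schur's theorem and closed under pointwise limits.

   Call phi radical if the spectral radius of phi modulo the finitely supported
   functions is 0; radical functions form a closed bi-invariant subspace.  If g is
   in c_0(G) with natural spectrum, then its resolvent is bounded on circles that
   avoid |g(G)|, and the Cauchy integral of l^n against it over the circle of
   radius r is g^n cut down to {|g| < r}, a cofinite set when r > 0.  Hence g is
   radical.

   Let z be the central support of f and psi radical.  Then h = z.psi is radical,
   and since f is GNS faithful h is in the closure of H_f.  Powers of functions of
   H_f lie in H_{f^n}, so the central support z_n of f^n fixes h^n, whereas z_n
   kills finitely supported functions because f^n is singular.  Therefore
   |h(1)|^n = |z_n (h^n - k)| for every finitely supported k, which forces
   z(psi) = h(1) = 0.  Finally, a closed bi-invariant subspace S has an orthogonal
   complement independent of the space H_u, which gives a central projection; for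
   the subspace generated by g it is the central support of g. *)
Require Import Defs.
From HB Require Import structures.
From mathcomp Require Import all_boot all_order all_algebra.
From mathcomp Require Import finmap sesquilinear complex.
From mathcomp Require Import all_classical all_reals all_analysis.
From mathcomp Require Import cyclic separable cyclotomic.
From mathcomp Require Import ring lra zify.

Set Implicit Arguments.
Unset Strict Implicit.
Unset Printing Implicit Defensive.

Import Order.TTheory GRing.Theory Num.Theory.
Import numFieldNormedType.Exports.

Local Open Scope classical_set_scope.
Local Open Scope ring_scope.
Local Open Scope complex_scope.

(* The notation of the same name in ring_scope is the convertible Num.conj. *)
Local Notation "z ^*" := (conjc z) : ring_scope.

(** * Complex numbers and positive kernels *)

(** Faithfulness serves to control left translations. In general the central support of [f] fixes
    the closed span of all left translates of functions of H_f; powers of sums of such translates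
    contain mixed products of different translates, about which the hypothesis on f^n says nothing.
    Faithfulness makes the GNS vector separating for the von Neumann algebra, hence cyclic for its
    commutant, and operators of the commutant can be moved from one side of a coefficient to the
    other. So the closure of H_f is already left invariant and contains everything that the central
    support of [f] fixes. The projections z_n change with n, so the estimate of z_n (h^n - k) needs
    a constant that does not: central projections have to be contractions, not merely bounded. Norms
    in B(G) are handled through [ball_B] because membership in a ball carries a positive definite
    witness; witnesses can be added, multiplied, translated and passed to the limit along
    ultrafilters. Only the comparison with [BG_norm] requires a separation argument. *)

Section ComplexNumbers.
Variable R : realType.
Implicit Types (z w : R[i]) (a b : R).
Local Notation Re := complex.Re.
Local Notation Im := complex.Im.

Lemma modC z : `|z| = (modulus z)%:C.
Proof. by rewrite /modulus normc_def. Qed.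

Lemma mod_ge0 z : 0 <= modulus z.
Proof. by rewrite -ler0c -modC. Qed.

Lemma modM z w : modulus (z * w) = modulus z * modulus w.
Proof. by apply: complexI; rewrite rmorphM /= -!modC normrM. Qed.

Lemma modD z w : modulus (z + w) <= modulus z + modulus w.
Proof. by rewrite -lecR rmorphD /= -!modC ler_normD. Qed.

Lemma modN z : modulus (- z) = modulus z.
Proof. by apply: complexI; rewrite -!modC normrN. Qed.

Lemma mod_dist z w : modulus (z - w) = modulus (w - z).
Proof. by rewrite -modN opprB. Qed.

Lemma mod_triangle w z t : modulus (z - t) <= modulus (z - w) + modulus (w - t).
Proof. by apply: le_trans (modD _ _); rewrite addrA subrK. Qed.

Lemma modX z n : modulus (z ^+ n) = modulus z ^+ n.
Proof. by apply: complexI; rewrite rmorphXn /= -!modC normrX. Qed.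

Lemma modV z : modulus z^-1 = (modulus z)^-1.
Proof. by apply: complexI; rewrite fmorphV /= -!modC normfV. Qed.

Lemma modJ z : modulus z^* = modulus z.
Proof. by apply: complexI; rewrite -!modC normcJ. Qed.

Lemma mod0 : modulus (0 : R[i]) = 0.
Proof. by apply: complexI; rewrite -modC normr0. Qed.

Lemma mod1 : modulus (1 : R[i]) = 1.
Proof. by apply: complexI; rewrite -modC normr1. Qed.

Lemma mod_eq0 z : modulus z = 0 -> z = 0.
Proof. by move=> z0; apply/eqP; rewrite -normr_eq0 modC z0. Qed.

Lemma mod_gt0 z : z != 0 -> 0 < modulus z.
Proof. by move=> z0; rewrite -ltcR -modC normr_gt0. Qed.

Lemma mod_real a : modulus a%:C = `|a|.
Proof. by rewrite /modulus normc_def /= expr0n /= addr0 sqrtr_sqr. Qed.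

Lemma mod_pos a : 0 <= a -> modulus a%:C = a.
Proof. by move=> a0; rewrite mod_real ger0_norm. Qed.

Lemma modiC : modulus ('i%C : R[i]) = 1.
Proof. by rewrite /modulus normc_def /= expr0n /= expr1n add0r sqrtr1. Qed.

Lemma mod_sqrC z : (modulus z ^+ 2)%:C = z * z^*.
Proof. by rewrite rmorphXn /= -modC sqr_normc. Qed.

Lemma mod_sqr z : modulus z ^+ 2 = Re z ^+ 2 + Im z ^+ 2.
Proof. by apply: complexI; rewrite add_Re2_Im2 modC -rmorphXn. Qed.

Lemma cReD z w : Re (z + w) = Re z + Re w. Proof. by case: z; case: w. Qed.
Lemma cImD z w : Im (z + w) = Im z + Im w. Proof. by case: z; case: w. Qed.
Lemma cReN z : Re (- z) = - Re z. Proof. by case: z. Qed.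
Lemma cReB z w : Re (z - w) = Re z - Re w. Proof. by rewrite cReD cReN. Qed.
Lemma cImN z : Im (- z) = - Im z. Proof. by case: z. Qed.
Lemma cImB z w : Im (z - w) = Im z - Im w. Proof. by rewrite cImD cImN. Qed.
Lemma cReM z w : Re (z * w) = Re z * Re w - Im z * Im w.
Proof. by case: z; case: w. Qed.
Lemma cImM z w : Im (z * w) = Re z * Im w + Im z * Re w.
Proof. by case: z => ? ?; case: w => ? ? /=. Qed.
Lemma cReJ z : Re z^* = Re z. Proof. by case: z. Qed.
Lemma cImJ z : Im z^* = - Im z. Proof. by case: z. Qed.

Lemma conjcN z : (- z)^* = - z^*. Proof. exact: rmorphN. Qed.
Lemma conjcD z w : (z + w)^* = z^* + w^*. Proof. exact: rmorphD. Qed.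
Lemma conjcM z w : (z * w)^* = z^* * w^*. Proof. exact: rmorphM. Qed.
Lemma conjci : ('i%C : R[i])^* = - 'i%C.
Proof. by apply/eqP; rewrite eq_complex /= oppr0 !eqxx. Qed.

Lemma Re_real z : Im z = 0 -> z = (Re z)%:C.
Proof. by case: z => x y /= ->. Qed.

Lemma complexP z w : Re z = Re w -> Im z = Im w -> z = w.
Proof. by case: z => ? ?; case: w => ? ? /= -> ->. Qed.

Lemma Re_le_mod z : Re z <= modulus z.
Proof.
apply: le_trans (ler_norm _) _.
by rewrite -lecR -modC; apply: normc_ge_Re.
Qed.

Lemma normRe_le_mod z : `|Re z| <= modulus z.
Proof. by rewrite -lecR -modC; apply: normc_ge_Re. Qed.

Lemma normIm_le_mod z : `|Im z| <= modulus z.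
Proof.
have := normRe_le_mod (z * 'i%C).
by rewrite ReiNIm normrN modM modiC mulr1.
Qed.

Lemma mod_le_ReIm z : modulus z <= `|Re z| + `|Im z|.
Proof.
have -> : z = (Re z)%:C + 'i%C * (Im z)%:C by case: z => x y; simpc.
apply: le_trans (modD _ _) _.
rewrite modM modiC mul1r !mod_real.
by case: z => x y /=; rewrite !(mul0r, mul1r, subr0, addr0, add0r, mulr0, subrr).
Qed.

Lemma ge0_Re z : 0 <= z -> z = (Re z)%:C.
Proof. by move=> z0; apply: Re_real; apply: ger0_Im. Qed.

Lemma ge0C z : 0 <= Re z -> Im z = 0 -> 0 <= z.
Proof. by move=> r0 i0; rewrite (Re_real i0) ler0c. Qed.

Lemma Re_ge0 z : 0 <= z -> 0 <= Re z.
Proof. by move=> z0; rewrite -ler0c -ge0_Re. Qed.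

Lemma cReZ a z : Re (a%:C * z) = a * Re z.
Proof. by case: z => x y /=; rewrite mul0r subr0. Qed.

Lemma cRe_sum (I : Type) (r : seq I) (P : pred I) (F : I -> R[i]) :
  Re (\sum_(i <- r | P i) F i) = \sum_(i <- r | P i) Re (F i).
Proof. by elim/big_rec2: _ => // i x y _ <-; rewrite cReD. Qed.

Lemma sqr_le_pos a b : 0 <= b -> a ^+ 2 <= b ^+ 2 -> a <= b.
Proof.
move=> b0 ab; have [//|ba] := leP a b.
suff : b ^+ 2 < a ^+ 2 by rewrite ltNge ab.
by rewrite ltr_pXn2r // nnegrE // ltW // (le_lt_trans b0).
Qed.

Lemma exists_phase z : exists2 c : R[i], modulus c = 1 & c * z = (modulus z)%:C.
Proof.
have [->|z0] := eqVneq z 0; first by exists 1; rewrite ?mod1 ?mod0 ?mulr0.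
have m0 : (modulus z)%:C != 0 :> R[i] by rewrite -modC normr_eq0.
exists (z^* / (modulus z)%:C).
  rewrite modM modJ modV mod_pos ?mod_ge0 // mulfV //.
  by apply/eqP => h; rewrite h eqxx in m0.
rewrite mulrAC [z^* * z]mulrC -mod_sqrC rmorphXn /= expr2 mulfK //.
Qed.

(** The common source of the Cauchy-Schwarz inequalities and of the orthogonality of nearest points:
    choosing the phase of [c] so that [c * z] is real turns the hypothesis into a real quadratic in
    [t]. *)
Lemma discriminant_le a b z : 0 <= b ->
  (forall c : R[i], 0 <= a + 2 * Re (c * z) + modulus c ^+ 2 * b) ->
  modulus z ^+ 2 <= a * b.
Proof.
move=> b0 H; have [p p1 pz] := exists_phase z.
have {}H (t : R) : 0 <= a - 2 * t * modulus z + t ^+ 2 * b.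
  have := H ((- t)%:C * p).
  rewrite -mulrA pz cReZ modM p1 mulr1 mod_real /= real_normK ?num_real // sqrrN; lra.
have m0 := mod_ge0 z.
have [b00|bN0] := eqVneq b 0.
  (* When [b = 0] the expression is affine in [t], and for [z] nonzero this [t] gives it the value
     [- a - 2], negative since [a >= 0]. *)
  rewrite b00 mulr0; have a0 := H 0; have := H ((a + 1) / (modulus z)).
  have [-> _|mN0] := eqVneq (modulus z) 0; first by rewrite expr0n.
  by rewrite b00 mulr0 addr0 -mulrA divfK //; lra.
have bp : 0 < b by rewrite lt_def bN0.
have := H (modulus z / b).
move=> h; rewrite -subr_ge0; apply: le_trans (mulr_ge0 (ltW bp) h) _.
rewrite le_eqVlt; apply/orP; left; apply/eqP.
by field; rewrite bN0.
Qed.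

End ComplexNumbers.

(** * Positive semidefinite kernels and Schur products *)

Section Kernels.
Variables (R : realType) (T : Type).
Local Notation C := (R[i]).
Local Notation Re := complex.Re.
Implicit Types (phi psi : T -> C) (K L : T -> T -> C) (s t : seq (C * T)).

(* A list s of pairs (c, x) stands for the formal combination of the kernel
   vectors k_x with coefficients c: ev phi s is the inner product of phi with
   it, kvec K s is the combination itself as a function on T. *)
Definition ev phi s : C := \sum_(p <- s) p.1^* * phi p.2.
Definition kvec K s : T -> C := fun x => \sum_(p <- s) p.1 * K x p.2.
Definition kform K s t : C := ev (kvec K s) t.
Definition psd K : Prop := forall s, 0 <= kform K s s.
Definition scs (c : C) s : seq (C * T) := [seq (c * p.1, p.2) | p <- s].
Definition qf K s : R := Re (kform K s s).
(** Membership in the reproducing kernel space of [K] with squared norm at most [a]. Each inequality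
    involves finitely many values of [phi], so the condition survives pointwise limits. *)
Definition dom K (a : R) phi : Prop :=
  forall s, modulus (ev phi s) ^+ 2 <= a * qf K s.

Lemma ev_nil phi : ev phi [::] = 0. Proof. exact: big_nil. Qed.

Lemma ev_cat phi s t : ev phi (s ++ t) = ev phi s + ev phi t.
Proof. exact: big_cat. Qed.

Lemma ev_scs phi c s : ev phi (scs c s) = c^* * ev phi s.
Proof.
rewrite /ev big_map mulr_sumr; apply: eq_bigr => p _ /=.
by rewrite rmorphM /= mulrA.
Qed.

Lemma ev1 phi x : ev phi [:: (1, x)] = phi x.
Proof. by rewrite /ev big_seq1 conjc1 mul1r. Qed.

Lemma ev_lin c phi psi s :
  ev (fun x => c * phi x + psi x) s = c * ev phi s + ev psi s.
Proof.
rewrite /ev mulr_sumr -big_split /=; apply: eq_bigr => p _.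
by rewrite mulrDr mulrCA.
Qed.

Lemma evD phi psi s : ev (fun x => phi x + psi x) s = ev phi s + ev psi s.
Proof. by rewrite /ev -big_split /=; apply: eq_bigr => p _; rewrite mulrDr. Qed.

Lemma evZ c phi s : ev (fun x => c * phi x) s = c * ev phi s.
Proof. by rewrite /ev mulr_sumr /=; apply: eq_bigr => p _; rewrite mulrCA. Qed.

Lemma kvec_cat K s t x : kvec K (s ++ t) x = kvec K s x + kvec K t x.
Proof. exact: big_cat. Qed.

Lemma kvec_scs K c s x : kvec K (scs c s) x = c * kvec K s x.
Proof.
rewrite /kvec big_map mulr_sumr; apply: eq_bigr => p _ /=.
by rewrite mulrA.
Qed.

Lemma kvec1 K x y : kvec K [:: (1, y)] x = K x y.
Proof. by rewrite /kvec big_seq1 mul1r. Qed.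

Lemma kform_catl K s s' t : kform K (s ++ s') t = kform K s t + kform K s' t.
Proof.
by rewrite /kform -evD; congr ev; apply/funext => x; rewrite kvec_cat.
Qed.

Lemma kform_scsl K c s t : kform K (scs c s) t = c * kform K s t.
Proof.
by rewrite /kform -evZ; congr ev; apply/funext => x; rewrite kvec_scs.
Qed.

Lemma kform_catr K s t t' : kform K s (t ++ t') = kform K s t + kform K s t'.
Proof. exact: ev_cat. Qed.

Lemma kform_scsr K c s t : kform K s (scs c t) = c^* * kform K s t.
Proof. exact: ev_scs. Qed.

Lemma kformE K s t :
  kform K s t = \sum_(q <- t) \sum_(p <- s) q.1^* * p.1 * K q.2 p.2.
Proof.
rewrite /kform /ev /kvec; apply: eq_bigr => q _.
by rewrite mulr_sumr; apply: eq_bigr => p _; rewrite mulrA.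
Qed.

Lemma kform11 K x y : kform K [:: (1, x)] [:: (1, y)] = K y x.
Proof. by rewrite /kform ev1 kvec1. Qed.

Lemma psd_im K s : psd K -> complex.Im (kform K s s) = 0.
Proof. by move=> /(_ s) /ger0_Im. Qed.

(** Polarization: the form is real at [s + c t], and the values 1 and i of [c] determine both parts
    of [kform K t s]. *)
Lemma kform_herm K s t : psd K -> kform K t s = (kform K s t)^*.
Proof.
move=> pK; set a := kform K s t; set b := kform K t s.
have E c : complex.Im (c^* * a + c * b) = 0.
  have := psd_im (s ++ scs c t) pK.
  rewrite kform_catl !kform_catr !kform_scsl !kform_scsr -/a -/b !cImD.
  rewrite (psd_im s pK).
  have -> : complex.Im (c * (c^* * kform K t t)) = 0.
    by rewrite mulrA -mod_sqrC cImM (psd_im t pK) /= mulr0 mul0r addr0.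
  by rewrite addr0 add0r => <-.
have := E 1; have := E 'i%C; rewrite conjc1 !mul1r.
case: a {E} => a1 a2; case: b => b1 b2 /=; rewrite !mul0r !mul1r => e1 e2.
by apply: complexP => /=; lra.
Qed.

Lemma psd_herm K x y : psd K -> K y x = (K x y)^*.
Proof. by move=> pK; have := kform_herm [:: (1, y)] [:: (1, x)] pK; rewrite !kform11. Qed.

Lemma qf_ge0 K s : psd K -> 0 <= qf K s.
Proof. by move=> pK; apply: Re_ge0; apply: pK. Qed.

Lemma kform_qf K s : psd K -> kform K s s = (qf K s)%:C.
Proof. by move=> pK; apply: ge0_Re; apply: pK. Qed.

Lemma qf_nil K : qf K [::] = 0.
Proof. by rewrite /qf /kform ev_nil. Qed.

Lemma qf_scs K c s : qf K (scs c s) = modulus c ^+ 2 * qf K s.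
Proof. by rewrite /qf kform_scsl kform_scsr mulrA -mod_sqrC cReZ. Qed.

Lemma qf_cat K s t : psd K ->
  qf K (s ++ t) = qf K s + 2 * Re (kform K s t) + qf K t.
Proof.
move=> pK; rewrite /qf kform_catl !kform_catr !cReD (kform_herm s t pK) cReJ.
by ring.
Qed.

Lemma qf1 K x : qf K [:: (1, x)] = Re (K x x).
Proof. by rewrite /qf kform11. Qed.

Lemma kform_CS K s t : psd K -> modulus (kform K s t) ^+ 2 <= qf K s * qf K t.
Proof.
move=> pK; apply: discriminant_le => [|c]; first exact: qf_ge0.
have := qf_ge0 (s ++ scs (c^*) t) pK.
by rewrite qf_cat // kform_scsr conjcK qf_scs modJ.
Qed.

Lemma psdD K L : psd K -> psd L -> psd (fun x y => K x y + L x y).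
Proof.
move=> pK pL s; rewrite kformE.
suff -> : \sum_(q <- s) \sum_(p <- s) q.1^* * p.1 * (K q.2 p.2 + L q.2 p.2) =
  kform K s s + kform L s s by rewrite addr_ge0.
rewrite !kformE -big_split /=; apply: eq_bigr => q _.
by rewrite -big_split /=; apply: eq_bigr => p _; rewrite mulrDr.
Qed.

Lemma kformZ a K s t : kform (fun x y => a * K x y) s t = a * kform K s t.
Proof.
rewrite !kformE mulr_sumr; apply: eq_bigr => q _; rewrite mulr_sumr.
by apply: eq_bigr => p _; rewrite mulrCA.
Qed.

Lemma psdZ (a : C) K : 0 <= a -> psd K -> psd (fun x y => a * K x y).
Proof. by move=> a0 pK s; rewrite kformZ mulr_ge0. Qed.

Lemma kform_rank1 phi s t :
  kform (fun x y => phi x * (phi y)^*) s t = (ev phi s)^* * ev phi t.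
Proof.
have -> : (ev phi s)^* = \sum_(p <- s) p.1 * (phi p.2)^*.
  rewrite /ev rmorph_sum /=; apply: eq_bigr => p _.
  by rewrite rmorphM /= conjcK.
rewrite /kform {1}/ev /ev mulr_sumr; apply: eq_bigr => q _.
rewrite /kvec mulrCA; congr (_ * _); rewrite mulr_suml.
by apply: eq_bigr => p _; rewrite mulrAC -mulrA mulrCA; ring.
Qed.

Lemma psd_rank1 phi : psd (fun x y => phi x * (phi y)^*).
Proof. by move=> s; rewrite kform_rank1 mulrC mulcJ_ge0. Qed.

Lemma kformB K L s t :
  kform (fun x y => K x y - L x y) s t = kform K s t - kform L s t.
Proof.
rewrite !kformE -sumrB; apply: eq_bigr => q _; rewrite -sumrB.
by apply: eq_bigr => p _; rewrite mulrBr.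
Qed.

Lemma kformD K L s t :
  kform (fun x y => K x y + L x y) s t = kform K s t + kform L s t.
Proof.
rewrite !kformE -big_split; apply: eq_bigr => q _; rewrite -big_split.
by apply: eq_bigr => p _; rewrite /= mulrDr.
Qed.

(** Turns a norm bound into the positivity of a kernel, a form in which bounds can be multiplied by
    Schur's theorem. *)
Lemma domP K a phi : psd K ->
  dom K a phi <-> psd (fun x y => a%:C * K x y - phi x * (phi y)^*).
Proof.
move=> pK; split => [H s|H s].
  rewrite kformB kformZ kform_rank1 mulrC [ _^* * _]mulrC -mod_sqrC.
  by rewrite kform_qf // mulrC -rmorphM /= subr_ge0 lecR.
have := H s; rewrite kformB kformZ kform_rank1 [ _^* * _]mulrC -mod_sqrC.
by rewrite kform_qf // -rmorphM /= subr_ge0 lecR.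
Qed.

Lemma psd_eq K L : (forall x y, K x y = L x y) -> psd K -> psd L.
Proof.
by move=> KL; have -> // : K = L by apply/funext => x; apply/funext => y.
Qed.

(** At [s] the new form is [qf K s] minus |<k, s>|^2 / ||k||^2, with k the kernel vector of [x0];
    Cauchy-Schwarz applies. *)
Lemma psd_schur_complement K x0 : psd K -> K x0 x0 != 0 ->
  psd (fun x y => K x y - K x x0 * K x0 y / K x0 x0).
Proof.
move=> pK K0 s; set k := K x0 x0.
have kp : 0 <= k by have := pK [:: (1, x0)]; rewrite kform11.
have -> : kform (fun x y => K x y - K x x0 * K x0 y / k) s s =
   kform K s s - k^-1 * ((ev (fun x => K x x0) s)^* * ev (fun x => K x x0) s).
  rewrite -kform_rank1 -kformZ -kformB; congr kform.
  apply/funext => x; apply/funext => y.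
  by rewrite (psd_herm y x0 pK); ring.
have -> : ev (fun x => K x x0) s = kform K [:: (1, x0)] s.
  by congr ev; apply/funext => x; rewrite kvec1.
rewrite [ _^* * _]mulrC -mod_sqrC kform_qf //.
rewrite (ge0_Re kp) -fmorphV -rmorphM /= subr_ge0 lecR.
have kR : 0 < Re k.
  rewrite lt_def Re_ge0 // andbT; apply: contraNneq K0 => k0.
  by rewrite -/k (ge0_Re kp) k0.
rewrite mulrC ler_pdivrMr // -[Re k]qf1 mulrC; exact: kform_CS.
Qed.

Lemma psd_zero_diag K x0 x : psd K -> K x0 x0 = 0 -> K x x0 = 0.
Proof.
move=> pK K0; have := kform_CS [:: (1, x0)] [:: (1, x)] pK.
rewrite kform11 !qf1 K0 mul0r => h; apply: mod_eq0.
by apply/eqP; rewrite -sqrf_eq0; apply/eqP/le_anti; rewrite h sqr_ge0.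
Qed.

(* The points of s are eliminated one at a time by Schur complements. *)
Lemma psdM K L : psd K -> psd L -> psd (fun x y => K x y * L x y).
Proof.
move=> pK pL s; elim: s => [|[c x0] s IH] in K pK *.
  by rewrite /kform ev_nil.
have red (M : T -> T -> C) : (forall x, M x x0 = 0) -> (forall x, M x0 x = 0) ->
    kform M ((c, x0) :: s) ((c, x0) :: s) = kform M s s.
  move=> M1 M2; rewrite !kformE !big_cons /= M2 mulr0 add0r big1 ?add0r.
    by apply: eq_bigr => q _; rewrite big_cons M1 mulr0 add0r.
  by move=> p _; rewrite M2 mulr0.
have [K0|K0] := eqVneq (K x0 x0) 0.
  have Kz x : K x x0 = 0 by apply: psd_zero_diag.
  have Kz' x : K x0 x = 0 by rewrite (psd_herm x x0 pK) Kz conjc0.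
  by rewrite red ?IH // => x; rewrite ?Kz ?Kz' mul0r.
have kp : 0 <= K x0 x0 by have := pK [:: (1, x0)]; rewrite kform11.
pose K' x y := K x y - K x x0 * K x0 y / K x0 x0.
have -> : (fun x y => K x y * L x y) = (fun x y => K' x y * L x y +
    (K x0 x0)^-1 * (K x x0 * (K y x0)^* * L x y)).
  apply/funext => x; apply/funext => y; rewrite /K' (psd_herm y x0 pK).
  by ring.
rewrite kformD addr_ge0 //.
  rewrite red; first by apply: IH; apply: psd_schur_complement.
    by move=> x; rewrite /K' mulfK // subrr mul0r.
  by move=> x; rewrite /K' mulrAC divff // mul1r subrr mul0r.
rewrite kformZ mulr_ge0 ?invr_ge0 //; set s' := _ :: s.
have -> : kform (fun x y => K x x0 * (K y x0)^* * L x y) s' s' =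
  kform L [seq (p.1 * (K p.2 x0)^*, p.2) | p <- s']
          [seq (p.1 * (K p.2 x0)^*, p.2) | p <- s'] by
  rewrite !kformE big_map; apply: eq_bigr => q _; rewrite big_map;
  apply: eq_bigr => p _ /=; rewrite rmorphM /= conjcK; ring.
exact: pL.
Qed.

(** With P and Q the rank one kernels of [phi] and [psi], abKL - PQ = (aK - P) bL + P (bL - Q), a
    sum of Schur products of positive kernels. *)
Lemma domM K L a b phi psi : psd K -> psd L -> dom K a phi -> dom L b psi ->
  0 <= a -> 0 <= b ->
  dom (fun x y => K x y * L x y) (a * b) (fun x => phi x * psi x).
Proof.
move=> pK pL /(domP _ _ pK) dK /(domP _ _ pL) dL a0 b0.
apply/domP; first exact: psdM.
have h1 := psdM dK (psdZ (a := b%:C) _ pL).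
have h2 := psdM (psd_rank1 phi) dL.
apply: psd_eq (psdD (h1 _) h2); last by rewrite ler0c.
by move=> x y; rewrite !rmorphM /=; ring.
Qed.

Lemma dom_lin K a b phi psi : 0 <= a -> 0 <= b -> psd K ->
  dom K (a ^+ 2) phi -> dom K (b ^+ 2) psi ->
  dom K ((a + b) ^+ 2) (fun x => phi x + psi x).
Proof.
move=> a0 b0 pK H1 H2 s; have q0 := qf_ge0 s pK.
have h (r : R) (f : T -> C) : 0 <= r -> dom K (r ^+ 2) f ->
    modulus (ev f s) <= r * Num.sqrt (qf K s).
  move=> r0 /(_ s) H; apply: sqr_le_pos; first by rewrite mulr_ge0 ?sqrtr_ge0.
  by rewrite exprMn sqr_sqrtr.
rewrite evD -[X in _ * X]sqr_sqrtr // -exprMn.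
rewrite ler_pXn2r ?nnegrE ?mod_ge0 ?mulr_ge0 ?addr_ge0 ?sqrtr_ge0 //.
by apply: le_trans (modD _ _) _; rewrite mulrDl lerD ?h.
Qed.

Lemma domZ K a c phi : dom K a phi ->
  dom K (modulus c ^+ 2 * a) (fun x => c * phi x).
Proof.
move=> H s; rewrite evZ modM exprMn -mulrA; apply: ler_wpM2l; last exact: H.
exact: sqr_ge0.
Qed.

Lemma dom_le K a b phi : psd K -> a <= b -> dom K a phi -> dom K b phi.
Proof.
by move=> pK ab H s; apply: le_trans (H s) _; apply: ler_wpM2r => //; apply: qf_ge0.
Qed.

Lemma dom_pt K a phi x : dom K a phi -> modulus (phi x) ^+ 2 <= a * Re (K x x).
Proof. by move=> /(_ [:: (1, x)]); rewrite ev1 qf1. Qed.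

Lemma dom_kvec K s : psd K -> dom K (qf K s) (kvec K s).
Proof. by move=> pK t; apply: kform_CS. Qed.

End Kernels.

(** * Limits along filters and ultrafilters *)

Section FilterLimits.
Variables (R : realType) (I : Type) (F : set_system I).
Context {FF : ProperFilter F}.
Local Notation C := (R[i]).
Implicit Types (x y : I -> C) (l m : C).

Definition fcvg x l : Prop :=
  forall e : R, 0 < e -> F [set i | modulus (x i - l) < e].

Lemma fcvg_cst l : fcvg (fun=> l) l.
Proof.
move=> e e0; apply: filterS filterT => i _ /=.
by rewrite subrr mod0.
Qed.

Lemma fcvgD x y l m : fcvg x l -> fcvg y m -> fcvg (fun i => x i + y i) (l + m).
Proof.
move=> xl ym e e0; have e2 : 0 < e / 2 by rewrite divr_gt0.
apply: filterS (filterI (xl _ e2) (ym _ e2)) => i /= [h1 h2].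
rewrite opprD addrACA; apply: le_lt_trans (modD _ _) _.
by rewrite [e]splitr ltrD.
Qed.

Lemma fcvgZ c x l : fcvg x l -> fcvg (fun i => c * x i) (c * l).
Proof.
move=> xl e e0; have m0 := mod_ge0 c.
have d0 : 0 < e / (modulus c + 1) by rewrite divr_gt0 // ltr_wpDl.
apply: filterS (xl _ d0) => i /= h.
rewrite -mulrBr modM.
apply: (@le_lt_trans _ _ ((modulus c + 1) * modulus (x i - l))).
  by rewrite ler_wpM2r ?mod_ge0 // lerDl.
by rewrite mulrC -ltr_pdivlMr // ltr_wpDl.
Qed.

Lemma fcvgJ x l : fcvg x l -> fcvg (fun i => (x i)^*) l^*.
Proof.
move=> xl e e0; apply: filterS (xl _ e0) => i /=.
by rewrite -rmorphB /= modJ.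
Qed.

Lemma fcvgM0 x y : fcvg x 0 -> fcvg y 0 -> fcvg (fun i => x i * y i) 0.
Proof.
move=> x0 y0 e e0.
apply: filterS (filterI (x0 _ e0) (y0 _ (@ltr01 _))) => i /= [].
rewrite !subr0 modM => h1 h2; apply: le_lt_trans h1.
by rewrite ler_piMr ?mod_ge0 // ltW.
Qed.

Lemma fcvgM x y l m : fcvg x l -> fcvg y m -> fcvg (fun i => x i * y i) (l * m).
Proof.
move=> xl ym.
have c0 (z : I -> C) k : fcvg z k -> fcvg (fun i => z i - k) 0.
  by move=> h e e0; apply: filterS (h _ e0) => i /=; rewrite subr0.
have := fcvgD (fcvgD (fcvgM0 (c0 _ _ xl) (c0 _ _ ym)) (fcvgZ l ym))
  (fcvgZ m (c0 _ _ xl)).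
rewrite add0r mulr0 addr0; congr fcvg; apply/funext => i.
by ring.
Qed.

Lemma fcvg_sum (J : Type) (r : seq J) (f : J -> I -> C) (L : J -> C) :
  (forall j, fcvg (f j) (L j)) ->
  fcvg (fun i => \sum_(j <- r) f j i) (\sum_(j <- r) L j).
Proof.
move=> H; elim: r => [|j r IH].
  by rewrite big_nil; under eq_fun do rewrite big_nil; exact: fcvg_cst.
by rewrite big_cons; under eq_fun do rewrite big_cons; exact: fcvgD.
Qed.

Lemma fcvg_ge0 x l : fcvg x l -> F [set i | 0 <= x i] -> 0 <= l.
Proof.
move=> xl x0; apply: ge0C.
  rewrite leNgt; apply/negP => l0.
  have e0 : 0 < - complex.Re l by rewrite oppr_gt0.
  have [i /= [h1 h2]] := filter_ex (filterI x0 (xl _ e0)).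
  have := Re_ge0 h1; have := le_lt_trans (normRe_le_mod _) h2.
  by rewrite cReB ltr_norml => /andP[_]; lra.
apply/eqP; apply: contraT => l0.
have e0 : 0 < `|complex.Im l| by rewrite normr_gt0.
have [i /= [h1 h2]] := filter_ex (filterI x0 (xl _ e0)).
have := le_lt_trans (normIm_le_mod _) h2.
by rewrite cImB (ger0_Im h1) sub0r normrN ltxx.
Qed.

Lemma fcvg_unique x l m : fcvg x l -> fcvg x m -> l = m.
Proof.
move=> xl xm; apply/eqP; rewrite -subr_eq0; apply: contraT => lm.
have e0 : 0 < modulus (l - m) / 2 by rewrite divr_gt0 // mod_gt0.
have [i /= [h1 h2]] := filter_ex (filterI (xl _ e0) (xm _ e0)).
have := mod_triangle (x i) l m; rewrite (mod_dist l (x i)).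
by lra.
Qed.

End FilterLimits.

Lemma ultra_limit_real (R : realType) (I : Type) (F : set_system I)
    (x : I -> R) (b : R) : UltraFilter F -> (forall i, `|x i| <= b) ->
  exists l, forall e, 0 < e -> F [set i | `|x i - l| < e].
Proof.
move=> UF xb; have PF : ProperFilter F by apply: ultra_proper.
have [|l [_ cl]] := @segment_compact R (- b) b (x @ F) _.

  apply: (@filterS _ F _ setT) => [i _|]; last exact: filterT.
  by rewrite /= in_itv /= -ler_norml.
exists l => e e0; have [//|nF] := in_ultra_setVsetC [set i | `|x i - l| < e] UF.
have /= [||y [/= h1 h2]] := cl (x @` ~` [set i | `|x i - l| < e]) (ball l e).
- by apply: filterS nF => i /= h; exists i.
- exact: nbhsx_ballx.
case: h1 => i /= h hy; exfalso; apply: h.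
by move: h2; rewrite -hy -ball_normE /= distrC.
Qed.

Lemma ultra_limit (R : realType) (I : Type) (F : set_system I)
    (x : I -> R[i]) (b : R) : UltraFilter F -> (forall i, modulus (x i) <= b) ->
  exists l, fcvg F x l.
Proof.
move=> UF xb.
have [i|l1 h1] := @ultra_limit_real _ _ _ (fun i => complex.Re (x i)) b UF.
  exact: le_trans (normRe_le_mod _) (xb i).
have [i|l2 h2] := @ultra_limit_real _ _ _ (fun i => complex.Im (x i)) b UF.
  exact: le_trans (normIm_le_mod _) (xb i).
have PF : ProperFilter F by apply: ultra_proper.
exists (l1 +i* l2) => e e0; have e2 : 0 < e / 2 by rewrite divr_gt0.
apply: filterS (filterI (h1 _ e2) (h2 _ e2)) => i /= [k1 k2].
apply: le_lt_trans (mod_le_ReIm _) _; rewrite cReB cImB /=.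
by rewrite [e]splitr ltrD.
Qed.

(** * The unit balls of B(G) *)

Section PositiveDefinite.
Variables (R : realType) (G : groupType).
Local Notation C := (R[i]).
Local Notation Re := complex.Re.
Implicit Types (phi psi : G -> C) (u v : G -> C) (s t : seq (C * G)) (a b r : R).

(** In this form the kernel is invariant under simultaneous right translation, and its kernel vector
    at [y] is the right translate of [u] by [y^-1]. *)
Definition gk u : G -> G -> C := fun x y => u (x * y^-1)%g.

Definition rtr (k : G) phi : G -> C := fun g => phi (g * k)%g.
Definition ltr (k : G) phi : G -> C := fun g => phi (k * g)%g.

(* The ball of radius r of the dual norm of B(G), in its reproducing kernel
   description: phi = <pi(.)xi, eta> with |xi|^2 <= r and eta a vector with
   coefficient u. *)
Definition ball_B r phi : Prop :=
  exists u, [/\ positive_definite u, Re (u 1%g) <= r & dom (gk u) r phi].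

Lemma pdP u : positive_definite u <-> psd (gk u).
Proof.
split=> [H s|H n g c].
  have := H (size s) (fun i => (tnth (in_tuple s) i).2^-1)%g
    (fun i => (tnth (in_tuple s) i).1).
  congr (0 <= _); rewrite kformE [RHS]big_tnth; apply: eq_bigr => i _.
  rewrite [RHS]big_tnth; apply: eq_bigr => j _.
  by rewrite /gk invgK.
have := H [seq (c i, (g i)^-1)%g | i <- index_enum 'I_n].
congr (0 <= _); rewrite kformE big_map; apply: eq_bigr => i _.
rewrite big_map; apply: eq_bigr => j _.
by rewrite /gk invgK.
Qed.

Section OnePd.
Variable u : G -> C.
Hypothesis pu : positive_definite u.

Lemma pd_psd : psd (gk u). Proof. exact/pdP. Qed.

Lemma pd1_ge0 : 0 <= u 1%g.
Proof. by have := pd_psd [:: (1, 1%g)]; rewrite kform11 /gk mulgV. Qed.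

Lemma pd1_Re : 0 <= Re (u 1%g). Proof. exact/Re_ge0/pd1_ge0. Qed.

Lemma pd1_real : u 1%g = (Re (u 1%g))%:C. Proof. exact/ge0_Re/pd1_ge0. Qed.

Lemma qf_gk1 k : qf (gk u) [:: (1, k)] = Re (u 1%g).
Proof. by rewrite qf1 /gk mulgV. Qed.

Lemma dom_pt_gk a phi g : dom (gk u) a phi ->
  modulus (phi g) ^+ 2 <= a * Re (u 1%g).
Proof. by move=> /(@dom_pt _ _ _ _ _ g); rewrite /gk mulgV. Qed.

Lemma kvec_gk k : kvec (gk u) [:: (1, k)] = rtr k^-1%g u.
Proof. by apply/funext => x; rewrite kvec1. Qed.

Lemma dom_rtr_self k : dom (gk u) (Re (u 1%g)) (rtr k u).
Proof.
by have := dom_kvec [:: (1, k^-1%g)] pd_psd; rewrite kvec_gk qf_gk1 invgK.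
Qed.

Lemma dom_self : dom (gk u) (Re (u 1%g)) u.
Proof.
have -> : dom (gk u) (Re (u 1%g)) u = dom (gk u) (Re (u 1%g)) (rtr 1%g u).
  by congr dom; apply/funext => x; rewrite /rtr mulg1.
exact: dom_rtr_self.
Qed.

Lemma pd_le1 g : modulus (u g) <= Re (u 1%g).
Proof.
apply: sqr_le_pos pd1_Re _; rewrite expr2.
exact: (dom_pt_gk g dom_self).
Qed.

End OnePd.

Definition lshift (k : G) s : seq (C * G) := [seq (p.1, k * p.2)%g | p <- s].
Definition rshift (k : G) s : seq (C * G) := [seq (p.1, p.2 * k)%g | p <- s].

Lemma ev_rtr k phi s : ev (rtr k phi) s = ev phi (rshift k s).
Proof. by rewrite /ev big_map. Qed.

Lemma ev_ltr k phi s : ev (ltr k phi) s = ev phi (lshift k s).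
Proof. by rewrite /ev big_map. Qed.

Lemma kform_rshift u k s t :
  kform (gk u) (rshift k s) (rshift k t) = kform (gk u) s t.
Proof.
rewrite !kformE big_map; apply: eq_bigr => q _; rewrite big_map.
by apply: eq_bigr => p _; rewrite /gk /= invgM mulgA mulgK.
Qed.

Definition conjpd (k : G) u : G -> C := fun g => u (k * g * k^-1)%g.

Lemma kform_lshift u k s t :
  kform (gk u) (lshift k s) (lshift k t) = kform (gk (conjpd k u)) s t.
Proof.
rewrite !kformE big_map; apply: eq_bigr => q _; rewrite big_map.
by apply: eq_bigr => p _; rewrite /gk /conjpd /= invgM !mulgA.
Qed.

Lemma pd_conj k u : positive_definite u -> positive_definite (conjpd k u).
Proof.
by move=> /pdP pu; apply/pdP => s; rewrite -kform_lshift; apply: pu.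
Qed.

Lemma dom_rtr u a k phi : dom (gk u) a phi -> dom (gk u) a (rtr k phi).
Proof. by move=> H s; rewrite ev_rtr /qf -(kform_rshift u k); apply: H. Qed.

Lemma dom_ltr u a k phi : dom (gk u) a phi -> dom (gk (conjpd k u)) a (ltr k phi).
Proof. by move=> H s; rewrite ev_ltr /qf -kform_lshift; apply: H. Qed.

Lemma pdD u v : positive_definite u -> positive_definite v ->
  positive_definite (fun g => u g + v g).
Proof. by move=> /pdP pu /pdP pv; apply/pdP; exact: psdD pu pv. Qed.

Lemma pdZ (c : C) u : 0 <= c -> positive_definite u ->
  positive_definite (fun g => c * u g).
Proof. by move=> c0 /pdP pu; apply/pdP; exact: psdZ c0 pu. Qed.

Lemma pdM u v : positive_definite u -> positive_definite v ->
  positive_definite (fun g => u g * v g).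
Proof. by move=> /pdP pu /pdP pv; apply/pdP; exact: psdM pu pv. Qed.

Lemma pd0 : positive_definite (fun _ : G => 0 : C).
Proof.
apply/pdP => s; rewrite kformE big1 // => q _; rewrite big1 // => p _.
by rewrite /gk mulr0.
Qed.

Lemma pd_cst1 : positive_definite (fun _ : G => 1 : C).
Proof.
apply/pdP; apply: psd_eq (psd_rank1 (fun _ : G => 1 : C)) => x y.
by rewrite /gk conjc1 mulr1.
Qed.

Lemma pdX u n : positive_definite u -> positive_definite (fun g => u g ^+ n).
Proof.
move=> pu; elim: n => [|n IH].
  by under eq_fun do rewrite expr0; exact: pd_cst1.
by under eq_fun do rewrite exprS; exact: (pdM pu IH).
Qed.

(** The kernel is the indicator of the diagonal; on the points of [s] it is a finite sum of rank one
    kernels. *)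
Lemma pd_delta : positive_definite (@delta_e R G).
Proof.
apply/pdP => s; pose E := undup [seq p.2 | p <- s].
have -> : kform (gk (@delta_e R G)) s s =
    \sum_(e <- E) kform (fun x y => (x == e)%:R * ((y == e)%:R)^*) s s.
  rewrite kformE; under [RHS]eq_bigr do rewrite kformE.
  rewrite [RHS]exchange_big /= big_seq [RHS]big_seq; apply: eq_bigr => q qs.
  rewrite [RHS]exchange_big; apply: eq_bigr => p _ /=.
  rewrite -mulr_sumr; congr (_ * _).
  rewrite (bigD1_seq q.2) ?undup_uniq ?mem_undup ?map_f //= big1 => [|e eq].
    by rewrite eqxx mul1r addr0 conjc_nat /gk /delta_e divg_eq1 eq_sym.
  by rewrite [q.2 == e]eq_sym (negbTE eq) mul0r.
apply: sumr_ge0 => e _; exact: (psd_rank1 (fun x => (x == e)%:R) s).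
Qed.

Lemma kform_gkD u v s t :
  kform (gk (fun g => u g + v g)) s t = kform (gk u) s t + kform (gk v) s t.
Proof. exact: kformD. Qed.

Lemma qf_gkD u v s : qf (gk (fun g => u g + v g)) s = qf (gk u) s + qf (gk v) s.
Proof. by rewrite /qf kform_gkD cReD. Qed.

Lemma qf_gkZ a u s : qf (gk (fun g => a%:C * u g)) s = a * qf (gk u) s.
Proof. by rewrite /qf [kform _ _ _](kformZ a%:C (gk u)) cReZ. Qed.

Lemma dom_zero u a phi : positive_definite u -> dom (gk u) a phi ->
  a * Re (u 1%g) <= 0 -> phi = (fun=> 0).
Proof.
move=> pu d a0; apply/funext => g; apply: mod_eq0; apply/eqP.
rewrite -sqrf_eq0; apply/eqP/le_anti; rewrite sqr_ge0 andbT.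
exact: le_trans (dom_pt_gk g d) a0.
Qed.

Lemma dom_fun0 u a : positive_definite u -> 0 <= a -> dom (gk u) a (fun=> 0).
Proof.
move=> pu a0 s; rewrite /ev big1 => [|p _]; last by rewrite mulr0.
by rewrite mod0 expr0n mulr_ge0 // qf_ge0 //; apply: pd_psd.
Qed.

Lemma ball_fun0 r : 0 <= r -> ball_B r (fun=> 0).
Proof.
move=> r0; exists (fun=> 0); split => //; first exact: pd0.
by apply: dom_fun0 => //; exact: pd0.
Qed.

(** Only the product of the two squared norms matters: multiplying [u] by [r / u(1)] balances them
    until each is at most [r]. *)
Lemma ball_dom u a r phi : positive_definite u -> 0 <= a -> 0 <= r ->
  dom (gk u) a phi -> a * Re (u 1%g) <= r ^+ 2 -> ball_B r phi.
Proof.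
move=> pu a0 r0 d aur; have u0 := pd1_Re pu.
have [ur|] := leP (a * Re (u 1%g)) 0.
  by rewrite (dom_zero pu d ur); exact: ball_fun0.
move=> aup; have up : 0 < Re (u 1%g).
  by rewrite lt_def u0 andbT; apply: contraTneq aup => ->; rewrite mulr0 ltxx.
have rp : 0 < r.
  rewrite lt_def r0 andbT; apply: contraTneq aur => ->.
  by rewrite expr0n /= -ltNge.
have rn0 : r != 0 by rewrite gt_eqF.
exists (fun g => (r / Re (u 1%g))%:C * u g); split.
- by apply: pdZ => //; rewrite ler0c divr_ge0.
- by rewrite cReZ divfK // gt_eqF.
move=> s; rewrite qf_gkZ; apply: le_trans (d s) _; rewrite mulrA.
apply: ler_wpM2r; first exact/qf_ge0/pd_psd.
by rewrite mulrA -expr2 ler_pdivlMr.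
Qed.

Lemma ball_ge0 r phi : ball_B r phi -> 0 <= r.
Proof. by case=> u [pu ur _]; apply: le_trans ur; exact: pd1_Re. Qed.

Lemma ball_pt r phi g : ball_B r phi -> modulus (phi g) <= r.
Proof.
move=> h; have r0 := ball_ge0 h; case: h => u [pu ur d].
apply: (sqr_le_pos r0); apply: le_trans (dom_pt_gk g d) _.
by rewrite expr2; apply: ler_wpM2l.
Qed.

Lemma ball_le r r' phi : r <= r' -> ball_B r phi -> ball_B r' phi.
Proof.
move=> rr' [u [pu ur d]]; exists u; split => //; first exact: le_trans rr'.
exact: dom_le (pd_psd pu) rr' d.
Qed.

Lemma ball_self u : positive_definite u -> ball_B (Re (u 1%g)) u.
Proof. by move=> pu; exists u; split => //; exact: dom_self. Qed.

Lemma ballZ c r phi : ball_B r phi -> ball_B (modulus c * r) (fun g => c * phi g).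
Proof.
move=> h; have r0 := ball_ge0 h; case: h => u [pu ur d].
apply: (ball_dom pu _ _ (domZ c d)); rewrite ?mulr_ge0 ?sqr_ge0 ?mod_ge0 //.
by rewrite exprMn -mulrA ler_wpM2l ?sqr_ge0 // expr2 ler_wpM2l.
Qed.

(** The witnesses are added, as for a direct sum of representations; what remains is Cauchy-Schwarz
    in the plane, through Lagrange's identity. *)
Lemma ballD r r' phi psi : ball_B r phi -> ball_B r' psi ->
  ball_B (r + r') (fun g => phi g + psi g).
Proof.
move=> h h'; have r0 := ball_ge0 h; have r0' := ball_ge0 h'.
case: h => u [pu ur d]; case: h' => v [pv vr d'].
exists (fun g => u g + v g); split; first exact: pdD.
  by rewrite cReD lerD.
move=> s; rewrite qf_gkD evD.
have qu := qf_ge0 s (pd_psd pu); have qv := qf_ge0 s (pd_psd pv).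
have h (w f : G -> C) (t : R) : 0 <= t -> positive_definite w ->
    dom (gk w) t f -> modulus (ev f s) <= Num.sqrt t * Num.sqrt (qf (gk w) s).
  move=> t0 pw df; apply: sqr_le_pos; first by rewrite mulr_ge0 ?sqrtr_ge0.
  by rewrite exprMn !sqr_sqrtr //; exact/qf_ge0/pd_psd.
have := h _ _ _ r0 pu d; have := h _ _ _ r0' pv d'; move=> {h}.
set m := modulus (ev phi s); set m' := modulus (ev psi s).
have m0 : 0 <= m := mod_ge0 _; have m0' : 0 <= m' := mod_ge0 _.
rewrite -{2}(sqr_sqrtr r0) -{2}(sqr_sqrtr r0') -{2}(sqr_sqrtr qu) -{2}(sqr_sqrtr qv).
move: (sqrtr_ge0 r) (sqrtr_ge0 r') (sqrtr_ge0 (qf (gk u) s)) (sqrtr_ge0 (qf (gk v) s)).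
set A := Num.sqrt r; set B := Num.sqrt r'; set X := Num.sqrt _; set Y := Num.sqrt _.
move=> A0 B0 X0 Y0 h' h.
have : modulus (ev phi s + ev psi s) <= A * X + B * Y.
  by apply: le_trans (modD _ _) _; rewrite lerD.
rewrite -(ler_pXn2r (n := 2)) ?nnegrE ?mod_ge0 ?addr_ge0 ?mulr_ge0 // => hh.
apply: le_trans hh _; rewrite -subr_ge0.
have -> : (A ^+ 2 + B ^+ 2) * (X ^+ 2 + Y ^+ 2) - (A * X + B * Y) ^+ 2 =
   (A * Y - B * X) ^+ 2 by ring.
exact: sqr_ge0.
Qed.

Lemma ballM r r' phi psi : ball_B r phi -> ball_B r' psi ->
  ball_B (r * r') (fun g => phi g * psi g).
Proof.
move=> h h'; have r0 := ball_ge0 h; have r0' := ball_ge0 h'.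
case: h => u [pu ur d]; case: h' => v [pv vr d'].
exists (fun g => u g * v g); split; first exact: pdM.
  rewrite (pd1_real pu) (pd1_real pv) cReZ /=.
  by apply: ler_pM => //; exact: pd1_Re.
exact: domM (pd_psd pu) (pd_psd pv) d d' r0 r0'.
Qed.

Lemma ballN r phi : ball_B r phi -> ball_B r (fun g => - phi g).
Proof.
move=> /(ballZ (-1)); rewrite modN mod1 mul1r.
by under eq_fun do rewrite mulN1r.
Qed.

Lemma ballB r r' phi psi : ball_B r phi -> ball_B r' psi ->
  ball_B (r + r') (fun g => phi g - psi g).
Proof. by move=> h /ballN; exact: ballD. Qed.

Lemma ball_sum (I : Type) (l : seq I) (r : I -> R) (F : I -> G -> C) :
  (forall i, ball_B (r i) (F i)) ->
  ball_B (\sum_(i <- l) r i) (fun g => \sum_(i <- l) F i g).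
Proof.
move=> H; elim: l => [|i l IH].
  by rewrite big_nil; under eq_fun do rewrite big_nil; exact: ball_fun0.
have -> : (fun g => \sum_(j <- i :: l) F j g) =
    (fun g => F i g + \sum_(j <- l) F j g).
  by apply/funext => g; rewrite big_cons.
by rewrite big_cons; exact: ballD.
Qed.

Lemma ball_cst1 : ball_B 1 (fun=> 1).
Proof. by have := ball_self pd_cst1. Qed.

Lemma ballX r phi n : ball_B r phi -> ball_B (r ^+ n) (fun g => phi g ^+ n).
Proof.
move=> h; elim: n => [|n IH].
  by under eq_fun do rewrite expr0; exact: ball_cst1.
by rewrite exprS; under eq_fun do rewrite exprS; exact: ballM.
Qed.

Lemma ball_rtr r k phi : ball_B r phi -> ball_B r (rtr k phi).
Proof. by move=> [u [pu ur d]]; exists u; split => //; exact: dom_rtr. Qed.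

Lemma ball_ltr r k phi : ball_B r phi -> ball_B r (ltr k phi).
Proof.
move=> [u [pu ur d]]; exists (conjpd k u); split; first exact: pd_conj.
  by rewrite /conjpd mulg1 mulgV.
exact: dom_ltr.
Qed.

Lemma BG_ball phi : BG phi -> exists r, ball_B r phi.
Proof.
move=> [n [c [u [pu ->]]]].
exists (\sum_(i <- index_enum 'I_n) modulus (c i) * Re (u i 1%g)).
apply: ball_sum => i; apply: ballZ; exact: ball_self.
Qed.

(* The positive definite functions u witnessing the approximations are bounded
   by r, so they converge pointwise along an ultrafilter. *)
Lemma ball_pointwise_closure r phi : (forall (l : seq G) e, 0 < e ->
    exists2 psi, ball_B r psi & forall g, g \in l -> modulus (psi g - phi g) < e) ->
  ball_B r phi.
Proof.
move=> H; pose I := (seq G * nat)%type.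
have /choice[w Hw] (i : I) : exists w : (G -> C) * (G -> C),
    [/\ positive_definite w.2, Re (w.2 1%g) <= r, dom (gk w.2) r w.1 &
      forall g, g \in i.1 -> modulus (w.1 g - phi g) < (i.2.+1%:R)^-1].
  have [|psi [u [pu ur d]] h] := H i.1 (i.2.+1%:R)^-1; first by rewrite invr_gt0.
  by exists (psi, u).
(* The filter of tails of the pairs (finite set, accuracy). *)
pose F0 : set_system I := [set A | exists j : I,
  forall i : I, {subset j.1 <= i.1} -> (j.2 <= i.2)%N -> A i].
have PF0 : ProperFilter F0.
  split; first by case=> j /(_ j); apply.
  split.
  - by exists ([::], 0%N).
  - move=> A B [j hA] [k hB]; exists (j.1 ++ k.1, maxn j.2 k.2) => i /= s m.
    split; [apply: hA|apply: hB].
    + by move=> x xj; apply: s; rewrite mem_cat xj.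
    + exact: leq_trans (leq_maxl _ _) m.
    + by move=> x xj; apply: s; rewrite mem_cat xj orbT.
    + exact: leq_trans (leq_maxr _ _) m.
  - by move=> A B AB [j hA]; exists j => i s m; apply: AB; apply: hA.
have [U [UF F0U]] := ultraFilterLemma PF0.
have PU : ProperFilter U by exact: ultra_proper.
have lphi g : fcvg U (fun i => (w i).1 g) (phi g).
  move=> e e0; apply: F0U; pose n := Num.truncn e^-1.
  exists ([:: g], n) => i /= s m; have [_ _ _ h] := Hw i.
  apply: lt_le_trans (h g _) _; first by apply: s; rewrite inE.
  rewrite -[e]invrK lef_pV2 ?posrE ?invr_gt0 //.
  apply: ltW; apply: lt_le_trans (truncnS_gt _) _.
  by rewrite ler_nat.
have /choice[u lu] g : exists l, fcvg U (fun i => (w i).2 g) l.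
  apply: (@ultra_limit _ _ _ _ r) => i; have [pu ur _ _] := Hw i.
  exact: le_trans (pd_le1 pu g) ur.
have lk s : fcvg U (fun i => kform (gk (w i).2) s s) (kform (gk u) s s).
  under eq_fun do rewrite kformE; rewrite kformE.
  by apply: fcvg_sum => q; apply: fcvg_sum => p; apply: fcvgZ; exact: lu.
have pu : psd (gk u).
  move=> s; apply: (fcvg_ge0 (lk s)); apply: filterS filterT => i _ /=.
  by have [/pdP + _ _ _] := Hw i; apply.
exists u; split; first exact/pdP.
  rewrite -subr_ge0 -ler0c rmorphB /= -pd1_real; last exact/pdP.
  apply: (@fcvg_ge0 _ _ U _ (fun i => r%:C - (w i).2 1%g)).
    apply: fcvgD; first exact: fcvg_cst.
    rewrite -mulN1r; under eq_fun do rewrite -mulN1r; apply: fcvgZ; exact: lu.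
  apply: filterS filterT => i _ /=; have [pui ur _ _] := Hw i.
  by rewrite (pd1_real pui) -rmorphB /= ler0c subr_ge0.
move=> s; rewrite -subr_ge0 -ler0c rmorphB /= rmorphM /= -kform_qf //.
rewrite mod_sqrC.
have le : fcvg U (fun i => ev (w i).1 s) (ev phi s).
  by apply: fcvg_sum => p; apply: fcvgZ; exact: lphi.
apply: (@fcvg_ge0 _ _ U _ (fun i => r%:C * kform (gk (w i).2) s s +
    - 1 * (ev (w i).1 s * (ev (w i).1 s)^*))).
  apply: fcvgD; first by apply: fcvgZ; exact: lk.
  rewrite -[- (ev phi s * _)]mulN1r; apply: fcvgZ; apply: (fcvgM le).
  by apply: fcvgJ; exact: le.
apply: filterS filterT => i _ /=; have [/pdP pui _ d _] := Hw i.
rewrite mulN1r -mod_sqrC kform_qf // -rmorphM -rmorphB /= ler0c subr_ge0.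
exact: d.
Qed.

Lemma ball_pointwise_limit r phi (f : nat -> G -> C) :
  (forall n, ball_B r (f n)) -> (forall g, fcvg \oo (f ^~ g) (phi g)) ->
  ball_B r phi.
Proof.
move=> bf lf; apply: ball_pointwise_closure => l e e0.
have [n hn] : exists n, forall g, g \in l -> modulus (f n g - phi g) < e.
  suff : \oo [set n | forall g, g \in l -> modulus (f n g - phi g) < e].
    by move=> /filter_ex.
  elim: l => [|h l IH]; first by apply: filterS filterT => n _ g.
  apply: filterS (filterI (lf h _ e0) IH) => n [h1 h2] g /=.
  by rewrite inE => /orP[/eqP->|]; [exact: h1|exact: h2].
by exists (f n).
Qed.

End PositiveDefinite.

(** * Reproducing kernel Hilbert spaces *)

Section KernelHilbertSpace.
Variables (R : realType) (T : Type) (K : T -> T -> R[i]).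
Hypothesis pK : psd K.
Local Notation C := (R[i]).
Local Notation Re := complex.Re.
Implicit Types (phi psi : T -> C) (s t : seq (C * T)) (a b : R).

Definition inH phi : Prop := exists2 a, 0 <= a & dom K a phi.

(** The squared norm: the term of [s] is ||phi||^2 - ||phi - k_s||^2, where k_s = [kvec K s]. An
    almost optimal [s] is thus an approximation of [phi], which is how density is proved. *)
Definition nsq phi : R := sup [set x | exists s, x = 2 * Re (ev phi s) - qf K s].
Definition hnorm phi : R := Num.sqrt (nsq phi).

Lemma nsq_ub a phi s : 0 <= a -> dom K a phi -> 2 * Re (ev phi s) - qf K s <= a.
Proof.
move=> a0 /(_ s) h; have q0 := qf_ge0 s pK.
rewrite lerBlDr; apply: (@le_trans _ _ (2 * modulus (ev phi s))).
  by rewrite ler_pM2l // Re_le_mod.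
apply: sqr_le_pos; first exact: addr_ge0.
rewrite exprMn; apply: (@le_trans _ _ (2 ^+ 2 * (a * qf K s))).
  by apply: ler_wpM2l => //; rewrite exprn_ge0.
by have := sqr_ge0 (a - qf K s); lra.
Qed.

Lemma nsq_has_sup phi : inH phi ->
  has_sup [set x | exists s, x = 2 * Re (ev phi s) - qf K s].
Proof.
move=> [a a0 d]; split; first by exists (2 * Re (ev phi [::]) - qf K [::]), [::].
by exists a => x [s ->]; exact: nsq_ub.
Qed.

Lemma nsq_upper phi s : inH phi -> 2 * Re (ev phi s) - qf K s <= nsq phi.
Proof. by move=> /nsq_has_sup h; apply: sup_upper_bound => //; exists s. Qed.

Lemma nsq_le a phi : 0 <= a -> dom K a phi -> nsq phi <= a.
Proof.
move=> a0 d; have h : inH phi by exists a.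
apply: ge_sup; first by case: (nsq_has_sup h).
by move=> x [s ->]; exact: nsq_ub.
Qed.

Lemma nsq_ge0 phi : inH phi -> 0 <= nsq phi.
Proof.
by move=> /(@nsq_upper _ [::]); rewrite ev_nil qf_nil mulr0 subr0.
Qed.

Lemma nsq_dom phi : inH phi -> dom K (nsq phi) phi.
Proof.
move=> h s; apply: discriminant_le => [|c]; first exact: qf_ge0.
have := nsq_upper (scs (- c^*) s) h.
rewrite ev_scs qf_scs modN modJ conjcN conjcK mulNr cReN.
by lra.
Qed.

Lemma hnorm_ge0 phi : 0 <= hnorm phi. Proof. exact: sqrtr_ge0. Qed.

Lemma hnorm_sqr phi : inH phi -> hnorm phi ^+ 2 = nsq phi.
Proof. by move=> h; rewrite sqr_sqrtr // nsq_ge0. Qed.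

Lemma hnorm_dom phi : inH phi -> dom K (hnorm phi ^+ 2) phi.
Proof. by move=> h; rewrite hnorm_sqr //; exact: nsq_dom. Qed.

Lemma hnorm_le a phi : 0 <= a -> dom K (a ^+ 2) phi -> hnorm phi <= a.
Proof.
move=> a0 d; apply: sqr_le_pos => //; rewrite hnorm_sqr; last first.
  by exists (a ^+ 2) => //; exact: sqr_ge0.
by apply: nsq_le => //; exact: sqr_ge0.
Qed.

Lemma inH0 : inH (fun=> 0).
Proof.
exists 0 => // s; rewrite /ev big1 => [|p _]; last by rewrite mulr0.
by rewrite mod0 expr0n mul0r.
Qed.

Lemma inHD phi psi : inH phi -> inH psi -> inH (fun x => phi x + psi x).
Proof.
move=> h h'; exists ((hnorm phi + hnorm psi) ^+ 2); first exact: sqr_ge0.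
by apply: dom_lin (hnorm_dom h) (hnorm_dom h') => //; exact: hnorm_ge0.
Qed.

Lemma inHZ c phi : inH phi -> inH (fun x => c * phi x).
Proof.
move=> [a a0 d]; exists (modulus c ^+ 2 * a); first by rewrite mulr_ge0 ?sqr_ge0.
exact: domZ.
Qed.

Lemma inHB phi psi : inH phi -> inH psi -> inH (fun x => phi x - psi x).
Proof.
move=> h /(inHZ (-1)) h'; have := inHD h h'.
by under eq_fun do rewrite mulN1r.
Qed.

Lemma inH_kvec t : inH (kvec K t).
Proof. by exists (qf K t); [exact: qf_ge0|exact: dom_kvec]. Qed.

Lemma hnormD phi psi : inH phi -> inH psi ->
  hnorm (fun x => phi x + psi x) <= hnorm phi + hnorm psi.
Proof.
move=> h h'; apply: hnorm_le; first by rewrite addr_ge0 ?hnorm_ge0.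
by apply: dom_lin (hnorm_dom h) (hnorm_dom h') => //; exact: hnorm_ge0.
Qed.

Lemma hnormZ c phi : inH phi -> hnorm (fun x => c * phi x) = modulus c * hnorm phi.
Proof.
have le d psi : inH psi -> hnorm (fun x => d * psi x) <= modulus d * hnorm psi.
  move=> h; apply: hnorm_le; first by rewrite mulr_ge0 ?mod_ge0 ?hnorm_ge0.
  by rewrite exprMn; apply: domZ; exact: hnorm_dom.
move=> h; apply/le_anti; rewrite le //=.
have [->|c0] := eqVneq c 0; first by rewrite mod0 mul0r hnorm_ge0.
have := le c^-1 _ (inHZ c h).
have -> : (fun x => c^-1 * (c * phi x)) = phi.
  by apply/funext => x; rewrite mulKf.
by rewrite modV mulrC ler_pdivlMr ?mod_gt0 // mulrC.
Qed.

Lemma hnorm_eq0 phi : inH phi -> hnorm phi = 0 -> phi = (fun=> 0).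
Proof.
move=> h h0; apply/funext => x; apply: mod_eq0; apply/eqP; rewrite -sqrf_eq0.
apply/eqP/le_anti; rewrite sqr_ge0 andbT.
by have := dom_pt x (hnorm_dom h); rewrite h0 expr0n mul0r.
Qed.

Lemma nsqZ c phi : inH phi -> nsq (fun x => c * phi x) = modulus c ^+ 2 * nsq phi.
Proof.
by move=> h; rewrite -!hnorm_sqr //; [rewrite hnormZ // exprMn|exact: inHZ].
Qed.

(** Moving the test list by [-t] gives one inequality; the other is the same inequality for the
    shifted function, shifted back. *)
Lemma nsq_shift phi t : inH phi ->
  nsq (fun x => phi x + kvec K t x) = nsq phi + 2 * Re (ev phi t) + qf K t.
Proof.
have le psi r : inH psi -> nsq (fun x => psi x + kvec K r x) <=
    nsq psi + 2 * Re (ev psi r) + qf K r.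
  move=> h; apply: ge_sup; first by case: (nsq_has_sup (inHD h (inH_kvec r))).
  move=> x [s ->]; rewrite evD cReD -/(kform K r s) (kform_herm s r pK) cReJ.
  have := nsq_upper (s ++ scs (-1) r) h.
  rewrite ev_cat ev_scs qf_cat // qf_scs kform_scsr modN mod1 expr1n mul1r.
  by rewrite conjcN conjc1 !mulN1r !cReD !cReN; lra.
move=> h; apply/le_anti; rewrite le //=.
have := le _ (scs (-1) t) (inHD h (inH_kvec t)).
rewrite ev_scs evD qf_scs modN mod1 expr1n mul1r conjcN conjc1 mulN1r.
rewrite -/(kform K t t) cReN cReD -/(qf K t).
have -> : (fun x => phi x + kvec K t x + kvec K (scs (-1) t) x) = phi.
  by apply/funext => x; rewrite kvec_scs mulN1r addrK.
by lra.
Qed.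

Lemma kvec_dense phi e : inH phi -> 0 < e ->
  exists t, nsq (fun x => phi x - kvec K t x) < e.
Proof.
move=> h e0; have [_ [t ->] ht] := sup_adherent e0 (nsq_has_sup h).
exists t.
have -> : (fun x => phi x - kvec K t x) = (fun x => phi x + kvec K (scs (-1) t) x).
  by apply/funext => x; rewrite kvec_scs mulN1r.
rewrite nsq_shift // ev_scs qf_scs modN mod1 expr1n mul1r conjcN conjc1 mulN1r.
by move: ht; rewrite -/(nsq phi) cReN; lra.
Qed.

Lemma hnorm_dist phi psi : inH phi -> inH psi ->
  `|hnorm phi - hnorm psi| <= hnorm (fun x => phi x - psi x).
Proof.
have le f g : inH f -> inH g -> hnorm f - hnorm g <= hnorm (fun x => f x - g x).
  move=> hf hg; rewrite lerBlDr; apply: le_trans (hnormD (inHB hf hg) hg).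
  by under [X in _ <= hnorm X]eq_fun do rewrite subrK.
move=> h h'; rewrite ler_norml le // andbT lerNl opprB.
apply: le_trans (le _ _ h' h) _.
have -> : (fun x => psi x - phi x) = (fun x => -1 * (phi x - psi x)).
  by apply/funext => x; rewrite mulN1r opprB.
by rewrite hnormZ ?modN ?mod1 ?mul1r //; exact: inHB.
Qed.

Definition nC phi : C := (nsq phi)%:C.
(** Polarization of [nsq]. Its linearity comes from density: against a kernel combination it equals
    [ev], which is visibly linear in the function, and the general case is a limit. *)
Definition ip phi psi : C :=
  4%:R^-1 * (nC (fun x => phi x + 1 * psi x) - nC (fun x => phi x + (-1) * psi x)
   + 'i%C * (nC (fun x => phi x + 'i%C * psi x)
             - nC (fun x => phi x + (- 'i%C) * psi x))).

Lemma nC_kvec phi c t : inH phi ->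
  nC (fun x => phi x + c * kvec K t x) =
  nC phi + (c^* * ev phi t + c * (ev phi t)^*) + (modulus c ^+ 2 * qf K t)%:C.
Proof.
move=> h; rewrite /nC.
have -> : (fun x => phi x + c * kvec K t x) = (fun x => phi x + kvec K (scs c t) x).
  by apply/funext => x; rewrite kvec_scs.
rewrite nsq_shift // ev_scs qf_scs !rmorphD /=; congr (_ + _ + _).
have -> : c * (ev phi t)^* = (c^* * ev phi t)^* by rewrite rmorphM /= conjcK.
by rewrite addcJ rmorphM rmorph_nat.
Qed.

Lemma ip_kvec phi t : inH phi -> ip phi (kvec K t) = ev phi t.
Proof.
move=> h; rewrite /ip !nC_kvec // !conjcN conjc1 conjci !modN mod1 modiC.
have ii : ('i%C : C) * 'i%C = -1 by rewrite -expr2 sqr_i.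
set q := (_)%:C; set z := ev phi t; set w := z^*; set n := nC phi.
have -> : n + (1 * z + 1 * w) + q - (n + (-1 * z + -1 * w) + q) +
  'i%C * (n + (- 'i%C * z + 'i%C * w) + q - (n + (- - 'i%C * z + - 'i%C * w) + q))
  = 2%:R * z + 2%:R * w + 2%:R * ('i%C * 'i%C) * (w - z) by ring.
rewrite ii; have -> : 2%:R * z + 2%:R * w + 2%:R * -1 * (w - z) = 4%:R * z by ring.
by rewrite mulKf // pnatr_eq0.
Qed.

Definition approx psi (t : nat -> seq (C * T)) : Prop :=
  forall n, hnorm (fun x => psi x - kvec K (t n) x) < n.+1%:R^-1.

Lemma approx_ex psi : inH psi -> exists ts, approx psi ts.
Proof.
move=> h; suff /choice[ts H] : forall n : nat, exists t,
    hnorm (fun x => psi x - kvec K t x) < n.+1%:R^-1 by exists ts.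
move=> n; have e0 : (0 : R) < n.+1%:R^-1 by rewrite invr_gt0.
have [t ht] := kvec_dense h (exprn_gt0 2 e0); exists t.
have hh : inH (fun x => psi x - kvec K t x) by apply: inHB => //; exact: inH_kvec.
rewrite ltNge; apply/negP => le; move: ht; rewrite ltNge -hnorm_sqr //.
move/negP; apply; rewrite ler_pXn2r ?nnegrE ?hnorm_ge0 ?(ltW e0) //.
Qed.

Lemma inv_small (e : R) : 0 < e -> \oo [set n : nat | (n.+1%:R)^-1 < e].
Proof.
move=> e0; exists (Num.truncn e^-1) => // n /= hn.
rewrite -[e]invrK ltf_pV2 ?posrE ?invr_gt0 //.
by apply: lt_le_trans (truncnS_gt _) _; rewrite ler_nat ltnS.
Qed.

Lemma nC_cvg phi c psi ts : inH phi -> inH psi -> approx psi ts ->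
  fcvg \oo (fun n => nC (fun x => phi x + c * kvec K (ts n) x))
    (nC (fun x => phi x + c * psi x)).
Proof.
move=> h h' ap.
have hk n : inH (fun x => phi x + c * kvec K (ts n) x).
  by apply: inHD => //; apply: inHZ; exact: inH_kvec.
have hp : inH (fun x => phi x + c * psi x) by apply: inHD => //; exact: inHZ.
suff H : fcvg \oo (fun n => (hnorm (fun x => phi x + c * kvec K (ts n) x))%:C)
    (hnorm (fun x => phi x + c * psi x))%:C.
  have := @fcvgM _ _ \oo _ _ _ _ _ H H; rewrite -rmorphM -expr2 hnorm_sqr //.
  under eq_fun => n do rewrite -rmorphM -expr2 (hnorm_sqr (hk n)).
  exact.
move=> e e0; have c0 : 0 < modulus c + 1 by rewrite ltr_wpDl ?mod_ge0.
apply: filterS (inv_small (divr_gt0 e0 c0)) => n /= hn.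
rewrite -rmorphB mod_real; apply: le_lt_trans (hnorm_dist (hk n) hp) _.
have -> : (fun x => phi x + c * kvec K (ts n) x - (phi x + c * psi x)) =
    (fun x => (- c) * (psi x - kvec K (ts n) x)).
  by apply/funext => x; ring.
rewrite hnormZ; last by apply: inHB => //; exact: inH_kvec.
rewrite modN; apply: (@le_lt_trans _ _ ((modulus c + 1) * n.+1%:R^-1)).
  by apply: ler_pM; rewrite ?mod_ge0 ?hnorm_ge0 ?lerDl ?ltW.
by rewrite mulrC -ltr_pdivlMr.
Qed.

Lemma fcvg_ip phi psi ts : inH phi -> inH psi -> approx psi ts ->
  fcvg \oo (fun n => ev phi (ts n)) (ip phi psi).
Proof.
move=> h h' ap; under eq_fun do rewrite -(ip_kvec _ h).
have H c := nC_cvg c h h' ap.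
have N (x y : nat -> C) l m : fcvg \oo x l -> fcvg \oo y m ->
    fcvg \oo (fun n => x n - y n) (l - m).
  move=> xl ym; have := @fcvgD _ _ \oo _ _ _ _ _ xl (fcvgZ (-1) ym); rewrite mulN1r.
  under eq_fun do rewrite mulN1r.
  exact.
apply: fcvgZ; apply: fcvgD; first exact: N.
by apply: fcvgZ; exact: N.
Qed.

Lemma ip_lin c phi phi' psi : inH phi -> inH phi' -> inH psi ->
  ip (fun x => c * phi x + phi' x) psi = c * ip phi psi + ip phi' psi.
Proof.
move=> h1 h2 h; have [ts ap] := approx_ex h.
have h12 : inH (fun x => c * phi x + phi' x) by apply: inHD => //; exact: inHZ.
apply: fcvg_unique (fcvg_ip h12 h ap) _.
under eq_fun do rewrite ev_lin.
by apply: fcvgD; [apply: fcvgZ|]; exact: fcvg_ip.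
Qed.

Lemma ip_nsq phi : inH phi -> ip phi phi = (nsq phi)%:C.
Proof.
move=> h; rewrite /ip /nC.
have E c : nsq (fun x => phi x + c * phi x) = modulus (1 + c) ^+ 2 * nsq phi.
  rewrite -nsqZ //; congr nsq; apply/funext => x; ring.
have e1 : modulus (1 + 1 : C) ^+ 2 = 4 by rewrite mod_sqr /=; ring.
have e2 : modulus (1 + -1 : C) ^+ 2 = 0 by rewrite mod_sqr /=; ring.
have e3 : modulus (1 + 'i%C : C) ^+ 2 = 2 by rewrite mod_sqr /=; ring.
have e4 : modulus (1 + (- 'i%C) : C) ^+ 2 = 2 by rewrite mod_sqr /=; ring.
rewrite !E e1 e2 e3 e4 mul0r subr0 subrr mulr0 addr0 rmorphM /= rmorph_nat.
by rewrite mulKf // pnatr_eq0.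
Qed.

Lemma ip_herm phi psi : inH phi -> inH psi -> ip psi phi = (ip phi psi)^*.
Proof.
move=> h h'; have J f : (nC f)^* = nC f by rewrite conjc_real.
(* Factoring out the unimodular [c] exchanges the two functions, and in the polarization formula [i]
   and [-i] trade places. *)
have E c d : c * d = 1 -> modulus c = 1 ->
    nC (fun x => psi x + c * phi x) = nC (fun x => phi x + d * psi x).
  move=> cd c1; rewrite /nC; congr (_%:C).
  have -> : (fun x => psi x + c * phi x) = (fun x => c * (phi x + d * psi x)).
    by apply/funext => x; rewrite mulrDr [c * (d * _)]mulrA cd mul1r addrC.
  by rewrite nsqZ ?c1 ?expr1n ?mul1r //; apply: inHD => //; exact: inHZ.
have ii : ('i%C : C) * 'i%C = -1 by rewrite -expr2 sqr_i.
rewrite /ip (E 1 1) ?mulr1 ?mod1 // (E (-1) (-1)) ?mulN1r ?opprK ?modN ?mod1 //.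
rewrite (E 'i%C (- 'i%C)) ?mulrN ?ii ?opprK ?modiC //.
rewrite (E (- 'i%C) 'i%C) ?mulNr ?ii ?opprK ?modN ?modiC //.
rewrite !(conjcM, conjcD, conjcN, conjci, J) conjc_inv conjc_nat.
by congr (_ * _); ring.
Qed.

End KernelHilbertSpace.

(** * The kernel space as a Hilbert space *)

Section KernelHilbertType.
Variables (R : realType) (T : Type) (K : T -> T -> R[i]).
Hypothesis pK : psd K.
Local Notation C := (R[i]).
Local Notation Re := complex.Re.

(* The proof of positivity is an argument, so that the structures built on the
   type hilb below can be inferred. *)
Definition inHb (_ : psd K) : {pred (T -> C)} :=
  fun phi : T -> C => `[< inH K phi >].

Lemma inHb_submod : submod_closed (inHb pK).
Proof.
split; first by apply/asboolP; exact: inH0.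
move=> c phi psi /asboolP h /asboolP h'; apply/asboolP.
by apply: (inHD pK) => //; exact: inHZ.
Qed.

HB.instance Definition _ := GRing.isSubmodClosed.Build C (T -> C) (inHb pK) inHb_submod.

Record hilb : Type := Hilb { hfun :> T -> C; hfunP : inHb pK hfun }.

HB.instance Definition _ := [isSub for hfun].
HB.instance Definition _ := [Choice of hilb by <:].
HB.instance Definition _ := [SubChoice_isSubLmodule of hilb by <:].

Lemma hilb_inH (v : hilb) : inH K v. Proof. exact/asboolP/hfunP. Qed.

Lemma hfunD (v w : hilb) : hfun (v + w) = (fun x => v x + w x).
Proof. by []. Qed.
Lemma hfunZ c (v : hilb) : hfun (c *: v) = (fun x => c * v x).
Proof. by []. Qed.
Lemma hfun0 : hfun 0 = (fun=> 0).
Proof. by []. Qed.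
Lemma hfunB (v w : hilb) : hfun (v - w) = (fun x => v x - w x).
Proof. by []. Qed.
Lemma hilb_eq (v w : hilb) : hfun v = hfun w -> v = w.
Proof. exact: val_inj. Qed.

Definition hilb_norm (v : hilb) : C := (hnorm K v)%:C.

Lemma hilb_ler_normD v w : hilb_norm (v + w) <= hilb_norm v + hilb_norm w.
Proof.
rewrite -rmorphD lecR hfunD.
by apply: hnormD => //; exact: hilb_inH.
Qed.

Lemma hilb_normrZ c v : hilb_norm (c *: v) = `|c| * hilb_norm v.
Proof. by rewrite modC -rmorphM /hilb_norm hfunZ hnormZ //; exact: hilb_inH. Qed.

Lemma hilb_normr0_eq0 v : hilb_norm v = 0 -> v = 0.
Proof.
move=> [h]; apply: hilb_eq; rewrite hfun0; apply: hnorm_eq0 => //.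
exact: hilb_inH.
Qed.

HB.instance Definition _ := Lmodule_isNormed.Build C hilb
  hilb_ler_normD hilb_normrZ hilb_normr0_eq0.

Lemma hilb_normE (v : hilb) : `|v| = (hnorm K v)%:C. Proof. by []. Qed.

Lemma cauchy_limit_real (F : set_system hilb) (FF : ProperFilter F) (f : hilb -> R) :
  (forall e, 0 < e -> exists y, F [set v | `|f v - y| < e]) ->
  exists l, forall e, 0 < e -> F [set v | `|f v - l| < e].
Proof.
move=> H; have /cvg_ex[l fl] : cvg (f @ F).
  apply: cauchy_cvg; apply: cauchy_exP => e e0; have [y hy] := H e e0; exists y.
  by apply: (@filterS _ F _ _ _ _ hy) => v /=; rewrite -ball_normE /= distrC.
exists l => e e0; move/cvgrPdist_lt: fl => /(_ e e0).
by apply: filterS => v; rewrite distrC.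
Qed.

(** Point evaluations are bounded, so a Cauchy filter has a pointwise limit; convergence holds in
    norm because [dom] passes to pointwise limits. *)
Lemma hilb_complete (F : set_system hilb) : ProperFilter F -> cauchy F -> cvg F.
Proof.
move=> FF /cauchyP cF.
have {}cF e : 0 < e -> exists y : hilb, F [set v | hnorm K (fun x => y x - v x) < e].
  move=> e0; have ec0 : 0 < e%:C :> C by rewrite ltcR.
  have [y hy] := cF (e%:C) ec0; exists y; apply: filterS hy => v.
  by rewrite -ball_normE /= hilb_normE ltcR.
have pt x e : 0 < e -> exists y, F [set v : hilb | modulus (v x - y) < e].
  (* Evaluation at [x] has norm at most [m]. The added 1 keeps the divisor positive, as in many
     later estimates. *)
  move=> e0; pose m := Num.sqrt (Re (K x x)).
  have m0 : 0 < m + 1 by rewrite ltr_wpDl ?sqrtr_ge0.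
  have [y hy] := cF (e / (m + 1)) (divr_gt0 e0 m0); exists (y x).
  apply: filterS hy => v /=; rewrite ltr_pdivlMr // => h; rewrite mod_dist.
  apply: le_lt_trans h; set f := fun x => y x - v x.
  have hf : inH K f by apply: inHB => //; exact: hilb_inH.
  apply: (@le_trans _ _ (hnorm K f * m)); last first.
    by rewrite ler_wpM2l ?hnorm_ge0 // lerDl.
  apply: sqr_le_pos; first by rewrite mulr_ge0 ?hnorm_ge0 ?sqrtr_ge0.
  rewrite exprMn [m ^+ 2]sqr_sqrtr; first exact: (dom_pt x (hnorm_dom pK hf)).
  by rewrite -qf1; exact: qf_ge0.
have /choice[l hl] x : exists l, fcvg F (fun v : hilb => v x) l.
  have [e e0|l1 h1] := @cauchy_limit_real F FF (fun v => Re (v x)).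
    have [y hy] := pt x e e0; exists (Re y); apply: filterS hy => v /=.
    by rewrite -cReB; apply: le_lt_trans; exact: normRe_le_mod.
  have [e e0|l2 h2] := @cauchy_limit_real F FF (fun v => complex.Im (v x)).
    have [y hy] := pt x e e0; exists (complex.Im y); apply: filterS hy => v /=.
    by rewrite -cImB; apply: le_lt_trans; exact: normIm_le_mod.
  exists (l1 +i* l2) => e e0; have e2 : 0 < e / 2 by rewrite divr_gt0.
  apply: filterS (filterI (h1 _ e2) (h2 _ e2)) => v /= [k1 k2].
  apply: le_lt_trans (mod_le_ReIm _) _; rewrite cReB cImB /=.
  by rewrite [e]splitr ltrD.
have dm e (y : hilb) : 0 < e -> F [set v : hilb | hnorm K (fun x => y x - v x) < e] ->
    dom K (e ^+ 2) (fun x => y x - l x).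
  move=> e0 hy s; rewrite -subr_ge0 -ler0c rmorphB /= mod_sqrC.
  have le : fcvg F (fun v : hilb => ev (fun x => y x - v x) s)
                   (ev (fun x => y x - l x) s).
    apply: fcvg_sum => p; apply: fcvgZ; apply: fcvgD; first exact: fcvg_cst.
    by rewrite -mulN1r; under eq_fun do rewrite -mulN1r; apply: fcvgZ; exact: hl.
  apply: (@fcvg_ge0 _ _ F _ (fun v : hilb => (e ^+ 2 * qf K s)%:C +
     - 1 * (ev (fun x => y x - v x) s * (ev (fun x => y x - v x) s)^*))).
    rewrite -[- (_ * _ ^*)]mulN1r; apply: fcvgD; first exact: fcvg_cst.
    by apply: fcvgZ; apply: fcvgM => //; exact: fcvgJ.
  apply: filterS hy => v /= hv; rewrite mulN1r -mod_sqrC -rmorphB ler0c subr_ge0.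
  have hf : inH K (fun x => y x - v x) by apply: inHB => //; exact: hilb_inH.
  apply: le_trans (hnorm_dom pK hf s) _; apply: ler_wpM2r; first exact: qf_ge0.
  by rewrite ler_pXn2r ?nnegrE ?hnorm_ge0 ?ltW.
have hlH : inH K l.
  have [y hy] := cF 1 ltr01; have /= d1 := dm 1 y ltr01 hy.
  have h1 : inH K (fun x => y x - l x) by exists (1 ^+ 2); [rewrite expr1n|].
  have -> : l = (fun x => y x - (y x - l x)) by apply/funext => x; rewrite subKr.
  by apply: (inHB pK) => //; exact: hilb_inH.
pose L := Hilb (asboolT hlH : inHb pK l).
apply/cvg_ex; exists L; apply/cvgrPdist_lt => e e0.
have re0 : 0 < Re e by have := e0; rewrite ltcE => /andP[].
have ee : e = (Re e)%:C by apply: ge0_Re; exact: ltW.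
have e2 : 0 < Re e / 2 by rewrite divr_gt0.
have [y hy] := cF _ e2; apply: filterS (hy) => v /= hv.
rewrite ee hilb_normE ltcR hfunB.
have -> : (fun x => L x - v x) = (fun x => (y x - v x) + (-1) * (y x - l x)).
  by apply/funext => x /=; ring.
have h1 : inH K (fun x => y x - l x) by apply: inHB => //; exact: hilb_inH.
have h2 : inH K (fun x => y x - v x) by apply: inHB => //; exact: hilb_inH.
apply: le_lt_trans (hnormD pK h2 (inHZ _ h1)) _.
rewrite hnormZ // modN mod1 mul1r [Re e]splitr ltr_leD //.
by apply: hnorm_le => //; [exact: ltW|exact: dm].
Qed.

HB.instance Definition _ := Uniform_isComplete.Build hilb hilb_complete.

Definition hdot (v w : hilb) : C := ip K v w.

Lemma hdot_bilinear : bilinear_for *%R (Num.conj \; *%R) hdot.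
Proof.
have lin w : linear_for *%R (hdot ^~ w).
  by move=> c v v'; apply: ip_lin => //; exact: hilb_inH.
have herm a b : hdot a b = (hdot b a)^*.
  by apply: ip_herm => //; exact: hilb_inH.
by split=> // v c w w'; rewrite herm lin conjcD conjcM -!herm.
Qed.

HB.instance Definition _ := bilinear_isBilinear.Build C hilb hilb C
  *%R (Num.conj \; *%R) hdot hdot_bilinear.

Lemma hdot_herm v w : hdot v w = (-1) ^+ false * Num.conj (hdot w v).
Proof. by rewrite mul1r /hdot ip_herm //; exact: hilb_inH. Qed.

HB.instance Definition _ := isHermitianSesquilinear.Build C hilb false
  (@Num.conj C) hdot hdot_herm.

Lemma hdot_norm v : `|v| ^+ 2 = hdot v v.
Proof.
rewrite hilb_normE -rmorphXn (hnorm_sqr pK (hilb_inH v)).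
by rewrite /hdot ip_nsq //; exact: hilb_inH.
Qed.

Lemma hdot_gt0 v : v != 0 -> 0 < hdot v v.
Proof. by move=> v0; rewrite -hdot_norm exprn_gt0 // normr_gt0. Qed.

HB.instance Definition _ := isDotProduct.Build C hilb hdot hdot_gt0.

End KernelHilbertType.

(** * Unitary representations *)

Section UnitaryRepresentations.
Variables (R : realType) (G : groupType) (U : unitary_rep R G).
Local Notation C := (R[i]).
Local Notation Re := complex.Re.
Local Notation H := (urep_space U).
Local Notation "''[' v , w ]" := (urep_dot U v w).
Implicit Types (v w x y : H) (c : C).

Lemma udotC v w : '[v, w] = '[w, v]^*.
Proof. by have := @hermitian_subproof _ _ _ _ (urep_dot U) v w; rewrite mul1r. Qed.

Lemma udotDl v v' w : '[v + v', w] = '[v, w] + '[v', w].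
Proof. exact: linearDl. Qed.

Lemma udotZl c v w : '[c *: v, w] = c * '[v, w].
Proof. exact: linearZl_LR. Qed.

Lemma udotDr v w w' : '[v, w + w'] = '[v, w] + '[v, w'].
Proof. by rewrite udotC udotDl conjcD -!udotC. Qed.

Lemma udotZr c v w : '[v, c *: w] = c^* * '[v, w].
Proof. by rewrite udotC udotZl conjcM -udotC. Qed.

Lemma udotNl v w : '[- v, w] = - '[v, w].
Proof. by rewrite -scaleN1r udotZl mulN1r. Qed.

Lemma udotNr v w : '[v, - w] = - '[v, w].
Proof. by rewrite udotC udotNl conjcN -udotC. Qed.

Lemma udotBl v v' w : '[v - v', w] = '[v, w] - '[v', w].
Proof. by rewrite udotDl udotNl. Qed.

Lemma udotBr v w w' : '[v, w - w'] = '[v, w] - '[v, w'].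
Proof. by rewrite udotDr udotNr. Qed.

Lemma udot0l w : '[0, w] = 0.
Proof. by rewrite -(scale0r 0) udotZl mul0r. Qed.

Lemma udot0r w : '[w, 0] = 0.
Proof. by rewrite udotC udot0l conjc0. Qed.

Lemma udot_suml (I : Type) (r : seq I) (F : I -> H) w :
  '[\sum_(i <- r) F i, w] = \sum_(i <- r) '[F i, w].
Proof.
by elim: r => [|i r IH]; rewrite ?big_nil ?udot0l // !big_cons udotDl IH.
Qed.

Lemma udot_sumr (I : Type) (r : seq I) (F : I -> H) w :
  '[w, \sum_(i <- r) F i] = \sum_(i <- r) '[w, F i].
Proof.
by elim: r => [|i r IH]; rewrite ?big_nil ?udot0r // !big_cons udotDr IH.
Qed.

Lemma rnormC v : `|v| = (rnorm v)%:C.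
Proof. by rewrite /rnorm {1}(ge0_Re (normr_ge0 v)). Qed.

Lemma rnorm_ge0 v : 0 <= rnorm v.
Proof. exact/Re_ge0/normr_ge0. Qed.

Lemma rnorm_sqr v : '[v, v] = (rnorm v ^+ 2)%:C.
Proof. by rewrite -urep_normE rnormC rmorphXn. Qed.

Lemma rnorm_sqrE v : rnorm v ^+ 2 = Re '[v, v].
Proof. by rewrite rnorm_sqr. Qed.

Lemma rnormD v w : rnorm (v + w) <= rnorm v + rnorm w.
Proof. by rewrite -lecR rmorphD /= -!rnormC ler_normD. Qed.

Lemma rnormZ c v : rnorm (c *: v) = modulus c * rnorm v.
Proof. by apply: complexI; rewrite rmorphM /= -!rnormC -modC normrZ. Qed.

Lemma rnormN v : rnorm (- v) = rnorm v.
Proof. by apply: complexI; rewrite -!rnormC normrN. Qed.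

Lemma rnorm0 : rnorm (0 : H) = 0.
Proof. by apply: complexI; rewrite -rnormC normr0. Qed.

Lemma rnorm_eq0 v : rnorm v = 0 -> v = 0.
Proof. by move=> v0; apply/eqP; rewrite -normr_eq0 rnormC v0. Qed.

Lemma rnormB v w : rnorm (v - w) = rnorm (w - v).
Proof. by rewrite -rnormN opprB. Qed.

Lemma rnorm_triangle w v x : rnorm (v - x) <= rnorm (v - w) + rnorm (w - x).
Proof. by apply: le_trans (rnormD _ _); rewrite addrA subrK. Qed.

Lemma rnorm_sqrD v w :
  rnorm (v + w) ^+ 2 = rnorm v ^+ 2 + 2 * Re '[v, w] + rnorm w ^+ 2.
Proof.
rewrite !rnorm_sqrE udotDl !udotDr !cReD (udotC w v) cReJ.
by ring.
Qed.

Lemma udot_CS v w : modulus '[v, w] <= rnorm v * rnorm w.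
Proof.
apply: sqr_le_pos; first by rewrite mulr_ge0 ?rnorm_ge0.
rewrite exprMn; apply: discriminant_le => [|c]; first exact: sqr_ge0.
have := sqr_ge0 (rnorm (v + c^* *: w)).
by rewrite rnorm_sqrD udotZr conjcK rnormZ modJ exprMn.
Qed.

Lemma ulimit (f : nat -> H) :
  (forall e, 0 < e -> exists N, forall m n, (N <= m)%N -> (N <= n)%N ->
     rnorm (f m - f n) < e) ->
  exists l, forall e, 0 < e -> exists N, forall n, (N <= n)%N -> rnorm (f n - l) < e.
Proof.
move=> Hf; have /cvg_ex[l fl] : cvg (f @ \oo).
  apply: cauchy_cvg; apply: cauchy_exP => e e0.
  have re0 : 0 < Re e by have := e0; rewrite ltcE => /andP[].
  have [N HN] := Hf _ re0; exists (f N).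
  exists N => // n /= Nn; rewrite -ball_normE /= (ge0_Re (ltW e0)) rnormC ltcR.
  exact: HN.
exists l => e e0; have ec0 : 0 < e%:C :> C by rewrite ltcR.
move/cvgrPdist_lt: fl => /(_ _ ec0)[N _ HN]; exists N => n Nn.
by have := HN n Nn; rewrite /= rnormC ltcR rnormB.
Qed.

Definition subspace (K : set H) : Prop :=
  [/\ K 0, forall c v w, K v -> K w -> K (c *: v + w)
    & forall v, (forall e, 0 < e -> exists2 w, K w & rnorm (v - w) < e) -> K v].

Lemma orthogonal_projection (K : set H) x : subspace K ->
  exists2 y, K y & forall k, K k -> '[x - y, k] = 0.
Proof.
move=> [K0 Klin Kc].
pose S := [set r | exists2 y, K y & r = rnorm (x - y) ^+ 2].
have hS : has_inf S.
  split; first by exists (rnorm (x - 0) ^+ 2), 0.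
  by exists 0 => _ [y _ ->]; exact: sqr_ge0.
pose d := inf S.
have dle y : K y -> d <= rnorm (x - y) ^+ 2.
  by move=> Ky; apply: inf_lbound; [case: hS|exists y].
have KZ c v : K v -> K (c *: v) by move=> Kv; rewrite -[_ *: _]addr0; exact: Klin.
have KD v w : K v -> K w -> K (v + w).
  by move=> Kv Kw; rewrite -[v]scale1r; exact: Klin.
have /choice[f Hf] (n : nat) : exists y, K y /\ rnorm (x - y) ^+ 2 < d + n.+1%:R^-1.
  have e0 : (0 : R) < n.+1%:R^-1 by rewrite invr_gt0.
  have [_ [y Ky ->] h] := inf_adherent e0 hS.
  by exists y.
(* Parallelogram law: the midpoint of [f m] and [f n] lies in [K], hence at squared distance at
   least [d] from [x]. *)
have par m n : rnorm (f m - f n) ^+ 2 <= 2 * m.+1%:R^-1 + 2 * n.+1%:R^-1.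
  have [Km hm] := Hf m; have [Kn hn] := Hf n.
  have := dle _ (KZ 2^-1 _ (KD _ _ Km Kn)).
  have e1 : f m - f n = (x - f n) + (- (x - f m)).
    by rewrite opprB [RHS]addrC addrA subrK.
  have e2 : x - 2^-1 *: (f m + f n) = 2^-1 *: ((x - f n) + (x - f m)).
    rewrite addrACA -opprD scalerBr [f n + _]addrC; congr (_ - _).
    by rewrite -mulr2n -[x *+ 2]scaler_nat scalerA mulVf ?scale1r // pnatr_eq0.
  rewrite e2 e1; move: hm hn; move: (x - f m) (x - f n) => P Q hm hn.
  rewrite rnormZ exprMn !rnorm_sqrD rnormN udotNr cReN.
  have -> : modulus (2^-1 : C) ^+ 2 = 4^-1.
    have -> : (2^-1 : C) = (2^-1)%:C by rewrite fmorphV rmorph_nat.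
    by rewrite mod_pos // exprVn; congr (_^-1); ring.
  move: hm hn; move: (rnorm P) (rnorm Q) (Re _) => A B z.
  move: (m.+1%:R^-1) (n.+1%:R^-1) => a b h1 h2 h3.
  by lra.
have [e e0|l hl] := ulimit (f := f).
  have e20 : 0 < e ^+ 2 / 4 by rewrite divr_gt0 // exprn_gt0.
  have [N _ HN] := inv_small e20; exists N => m n Nm Nn.
  rewrite -(ltr_pXn2r (n := 2)) ?nnegrE ?rnorm_ge0 ?ltW //.
  apply: le_lt_trans (par m n) _.
  move: (HN m Nm) (HN n Nn) => /=.
  by move: (m.+1%:R^-1) (n.+1%:R^-1) (e ^+ 2) => a b c; lra.
have Kl : K l.
  apply: Kc => e e0; have [N HN] := hl e e0; exists (f N); first by case: (Hf N).
  by rewrite rnormB; exact: HN.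
have ld : rnorm (x - l) ^+ 2 <= d.
  apply/ler_addgt0Pr => e e0.
  have m0 := rnorm_ge0 (x - l).
  (* From (||x - l|| - e')^2 <= d + e' follows ||x - l||^2 <= d + (2 ||x - l|| + 1) e', and the
     divisor makes the last term at most [e]. *)
  pose e' := Num.min 1 (e / (2 * (rnorm (x - l) + 1) + 2)).
  have p0 : 0 < 2 * (rnorm (x - l) + 1) + 2 by lra.
  have e'0 : 0 < e' by rewrite lt_min ltr01 divr_gt0.
  have [N HN] := hl e' e'0; have [M _ HM] := inv_small e'0.
  pose n := maxn N M; have [_ hn] := Hf n.
  have h1 : rnorm (f n - l) < e' by apply: HN; exact: leq_maxl.
  have h2 : n.+1%:R^-1 < e' by apply: HM; exact: leq_maxr.
  have h3 := rnorm_triangle (f n) x l.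
  have e1 : e' <= 1 by rewrite ge_min lexx.
  have e2 : e' * (2 * (rnorm (x - l) + 1) + 2) <= e.
    by rewrite -ler_pdivlMr // ge_min lexx orbT.
  have h4 : rnorm (x - l) - e' <= rnorm (x - f n) by lra.
  have [hs|hs] := leP (rnorm (x - l)) e'.
    have : rnorm (x - l) ^+ 2 <= e' * 1.
      by rewrite expr2; apply: ler_pM => //; exact: le_trans hs _.
    have d0 : 0 <= d by apply: lb_le_inf; [case: hS|move=> _ [y _ ->]; exact: sqr_ge0].
    by have := mulr_ge0 (ltW e'0) m0; lra.
  have : (rnorm (x - l) - e') ^+ 2 <= rnorm (x - f n) ^+ 2.
    by rewrite ler_pXn2r // ?nnegrE ?rnorm_ge0 // subr_ge0 ltW.
  move: hn h2; move: (n.+1%:R^-1) => a hn h2 h5.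
  by have := sqr_ge0 e'; lra.
exists l => // k Kk.
(* Moving [l] along [k] cannot decrease the distance to [x]; this is the discriminant inequality
   with constant term 0. *)
have h := @discriminant_le R 0 (rnorm k ^+ 2) '[x - l, k] (sqr_ge0 _) _.
apply: mod_eq0; apply/eqP; rewrite -sqrf_eq0; apply/eqP/le_anti.
rewrite sqr_ge0 andbT; rewrite mul0r in h; apply: h => c.
have := dle _ (KD _ _ (KZ (- c^*) _ Kk) Kl).
rewrite opprD scaleNr opprK addrCA addrC rnorm_sqrD udotZr conjcK rnormZ modJ exprMn.
by have := le_trans ld; lra.
Qed.

Lemma riesz (f : H -> C) M : (forall c v w, f (c *: v + w) = c * f v + f w) ->
  (forall v, modulus (f v) <= M * rnorm v) -> exists w, forall v, f v = '[v, w].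
Proof.
move=> flin fM.
have f0 : f 0 = 0 by have := flin (-1) 0 0; rewrite scaler0 addr0 mulN1r addNr.
have [/existsNP[x fx]|] := pselect (~ forall x, f x = 0); last first.
  by move=> /contrapT h; exists 0 => v; rewrite h udot0r.
have fB v w : f (v - w) = f v - f w.
  by rewrite addrC -scaleN1r flin mulN1r addrC.
have fZ c v : f (c *: v) = c * f v by have := flin c v 0; rewrite !addr0 f0 addr0.
have sK : subspace [set v | f v = 0].
  split => //= [c v w fv fw|v hv]; first by rewrite flin fv fw mulr0 addr0.
  apply: mod_eq0; apply/eqP; rewrite eq_le mod_ge0 andbT.
  apply/ler_addgt0Pr => e e0; rewrite add0r.
  have M0 : 0 < `|M| + 1 by rewrite ltr_wpDl.
  have [w /= fw h] := hv _ (divr_gt0 e0 M0).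
  rewrite -[f v]subr0 -fw -fB; apply: le_trans (fM _) _.
  apply: (@le_trans _ _ ((`|M| + 1) * rnorm (v - w))).
    by rewrite ler_wpM2r ?rnorm_ge0 // (le_trans (ler_norm _)) // lerDl.
  by rewrite mulrC -ler_pdivlMr // ltW.
have [y /= fy hy] := orthogonal_projection x sK.
set z := x - y in hy; have fz : f z != 0 by rewrite fB fy subr0; apply/eqP.
have zz : '[z, z] != 0.
  rewrite rnorm_sqr; apply: contra fz => /eqP[/eqP]; rewrite sqrf_eq0 => /eqP h.
  by rewrite (rnorm_eq0 h) f0.
exists ((f z / '[z, z])^* *: z) => v; rewrite udotZr conjcK.
have := hy (v - (f v / f z) *: z); rewrite /= fB fZ divfK // subrr => /(_ erefl); rewrite udotC udotBl udotZl => /(congr1 conjc).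
rewrite conjcK conjc0 => /eqP; rewrite subr_eq0 => /eqP ->.
by field; rewrite zz fz.
Qed.

End UnitaryRepresentations.

(** * Matrix coefficients *)

Section Coefficients.
Variables (R : realType) (G : groupType) (U : unitary_rep R G).
Local Notation C := (R[i]).
Local Notation Re := complex.Re.
Local Notation H := (urep_space U).
Local Notation "''[' v , w ]" := (urep_dot U v w).
Implicit Types (v w x y : H) (c : C) (s : seq (C * G)).

Definition coef v w : G -> C := fun g => '[urep_act U g v, w].

(** The vector behind the kernel combination [s] when the kernel comes from [coef w w]: the kernel
    vector at x is the coefficient of the translate of [w] by x^-1. *)
Definition uvec s w : H := \sum_(p <- s) p.1 *: urep_act U (p.2^-1)%g w.

Lemma uactK g v : urep_act U g (urep_act U g^-1%g v) = v.
Proof. by rewrite -urep_actM mulgV urep_act1. Qed.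

Lemma udot_act g v w : '[urep_act U g v, w] = '[v, urep_act U g^-1%g w].
Proof. by rewrite -{1}(uactK g w) urep_unitary. Qed.

Lemma rnorm_act g v : rnorm (urep_act U g v) = rnorm v.
Proof.
by apply/eqP; rewrite -(eqrXn2 (n := 2)) ?rnorm_ge0 // !rnorm_sqrE urep_unitary.
Qed.

Lemma rtr_coef k v w : rtr k (coef v w) = coef (urep_act U k v) w.
Proof. by apply/funext => g; rewrite /rtr /coef urep_actM. Qed.

Lemma ltr_coef k v w : ltr k (coef v w) = coef v (urep_act U k^-1%g w).
Proof. by apply/funext => g; rewrite /ltr /coef urep_actM udot_act. Qed.

Lemma coef1 v w : coef v w 1%g = '[v, w].
Proof. by rewrite /coef urep_act1. Qed.

Lemma coef_linl c v v' w g : coef (c *: v + v') w g = c * coef v w g + coef v' w g.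
Proof. by rewrite /coef linearP udotDl udotZl. Qed.

Lemma coefBl v v' w g : coef (v - v') w g = coef v w g - coef v' w g.
Proof. by rewrite /coef linearB udotBl. Qed.

Lemma coefBr v w w' g : coef v (w - w') g = coef v w g - coef v w' g.
Proof. by rewrite /coef udotBr. Qed.

Lemma ev_coef v w s : ev (coef v w) s = '[v, uvec s w].
Proof.
rewrite /uvec udot_sumr; apply: eq_bigr => p _.
by rewrite udotZr /coef udot_act.
Qed.

Lemma coef_uvec v w s g : coef v (uvec s w) g = \sum_(p <- s) p.1^* * ltr p.2 (coef v w) g.
Proof.
rewrite /coef /uvec udot_sumr; apply: eq_bigr => p _.
by rewrite udotZr ltr_coef.
Qed.

Lemma coef_uvecl w s : coef (uvec s w) w = kvec (gk (coef w w)) s.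
Proof.
apply/funext => g; rewrite /coef /uvec linear_sum udot_suml.
apply: eq_bigr => p _; rewrite linearZ udotZl.
by rewrite /gk /coef urep_actM.
Qed.

Lemma kform_coef w s t : kform (gk (coef w w)) s t = '[uvec s w, uvec t w].
Proof. by rewrite /kform -coef_uvecl ev_coef. Qed.

Lemma pd_coef w : positive_definite (coef w w).
Proof.
by apply/pdP => s; rewrite kform_coef rnorm_sqr ler0c sqr_ge0.
Qed.

Lemma qf_coef w s : qf (gk (coef w w)) s = rnorm (uvec s w) ^+ 2.
Proof. by rewrite /qf kform_coef rnorm_sqr. Qed.

Lemma dom_coef v w : dom (gk (coef w w)) (rnorm v ^+ 2) (coef v w).
Proof.
move=> s; rewrite ev_coef qf_coef -exprMn.
by rewrite ler_pXn2r ?nnegrE ?mod_ge0 ?mulr_ge0 ?rnorm_ge0 // udot_CS.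
Qed.

Lemma ball_coef v w : ball_B (rnorm v * rnorm w) (coef v w).
Proof.
apply: (ball_dom (pd_coef w) _ _ (dom_coef v w)).
- exact: sqr_ge0.
- by rewrite mulr_ge0 ?rnorm_ge0.
- by rewrite coef1 rnorm_sqr /= exprMn.
Qed.

Lemma ball_coef_le r v w : rnorm v * rnorm w <= r -> ball_B r (coef v w).
Proof. by move=> h; apply: ball_le h _; exact: ball_coef. Qed.

End Coefficients.

(** * The GNS representation on the kernel space *)

Section GelfandNaimarkSegal.
Variables (R : realType) (G : groupType) (u : G -> R[i]).
Hypothesis pu : positive_definite u.
Local Notation C := (R[i]).
Local Notation Re := complex.Re.
Local Notation H := (hilb (pd_psd pu)).

Lemma inHb_rtr k (v : H) : inHb (pd_psd pu) (rtr k v).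
Proof.
have [a a0 d] := hilb_inH v; apply/asboolP; exists a => //.
exact: dom_rtr.
Qed.

Definition gns_act (k : G) (v : H) : H := Hilb (inHb_rtr k v).

Lemma gns_act_linear k : linear (gns_act k).
Proof. by move=> c v w; apply: hilb_eq. Qed.

HB.instance Definition _ k := GRing.isLinear.Build C H H _ (gns_act k)
  (gns_act_linear k).

Lemma nsq_rtr k phi : nsq (gk u) (rtr k phi) = nsq (gk u) phi.
Proof.
congr sup; apply/seteqP; split=> [x [s ->]|x [s ->]].
  exists (rshift k s); by rewrite ev_rtr /qf kform_rshift.
exists (rshift k^-1%g s); rewrite ev_rtr /qf kform_rshift.
congr (2 * Re (ev _ _) - _); rewrite /rshift -map_comp -[LHS]map_id.
by apply: eq_map => -[c g] /=; rewrite mulgVK.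
Qed.

Lemma gns_unitary k (v w : H) :
  hdot (gns_act k v) (gns_act k w) = hdot v w.
Proof.
rewrite /hdot /ip /nC.
have E c : nsq (gk u) (fun x => gns_act k v x + c * gns_act k w x) =
    nsq (gk u) (fun x => v x + c * w x).
  exact: (nsq_rtr k (fun x => v x + c * w x)).
by rewrite !E.
Qed.

(** Transparent, since [urep_space] must unfold to the kernel space for vectors to be read as
    functions. *)
Definition gns : unitary_rep R G.
Proof.
refine (@UnitaryRep R G H (@hdot R G (gk u) (pd_psd pu) : {dot H for (@Num.conj C)}) _ gns_act _ _ gns_unitary).
- exact: hdot_norm.
- by move=> v; apply: hilb_eq; apply/funext => g /=; rewrite /rtr mulg1.
- move=> k l v; apply: hilb_eq; apply/funext => g /=.
  by rewrite /rtr mulgA.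
Defined.

Lemma inHb_kvec s : inHb (pd_psd pu) (kvec (gk u) s).
Proof. by apply/asboolP/inH_kvec/pd_psd. Qed.

Definition gns_kvec s : urep_space gns := Hilb (inHb_kvec s).

Definition gns_fun (v : urep_space gns) : G -> C := hfun v.

Definition gns_vec phi (h : inH (gk u) phi) : urep_space gns :=
  Hilb (asboolT h : inHb (pd_psd pu) phi).

Definition gns_cyc : urep_space gns := gns_kvec [:: (1, 1%g)].

Lemma gns_fun_inj v w : gns_fun v = gns_fun w -> v = w.
Proof. exact: hilb_eq. Qed.

Lemma gns_fun_inH v : inH (gk u) (gns_fun v).
Proof. exact: hilb_inH. Qed.

Lemma gns_vecK phi (h : inH (gk u) phi) : gns_fun (gns_vec h) = phi.
Proof. by []. Qed.

Lemma gns_fun_act k v : gns_fun (urep_act gns k v) = rtr k (gns_fun v).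
Proof. by []. Qed.

Lemma gns_fun_cyc : gns_fun gns_cyc = u.
Proof. by apply/funext => g; rewrite /= kvec1 /gk invg1 mulg1. Qed.

Lemma gns_dot_kvec v s : urep_dot gns v (gns_kvec s) = ev (gns_fun v) s.
Proof. by rewrite /= /hdot ip_kvec //; [exact: pd_psd|exact: hilb_inH]. Qed.

(** The reproducing property at the identity, transported by translation. It allows functions and
    vectors to be interchanged from here on. *)
Lemma gns_coef v : coef v gns_cyc = gns_fun v.
Proof.
apply/funext => g; rewrite /coef gns_dot_kvec ev1 gns_fun_act.
by rewrite /rtr mul1g.
Qed.

Lemma gns_rnorm v : rnorm v = hnorm (gk u) (gns_fun v).
Proof. by []. Qed.

Lemma gns_rnorm_le a v : 0 <= a -> dom (gk u) a (gns_fun v) -> rnorm v ^+ 2 <= a.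
Proof.
move=> a0 d; rewrite gns_rnorm hnorm_sqr.
- exact: nsq_le (pd_psd pu) _ _ a0 d.
- exact: pd_psd.
- exact: gns_fun_inH.
Qed.

Lemma gns_dom v : dom (gk u) (rnorm v ^+ 2) (gns_fun v).
Proof. by rewrite gns_rnorm; apply: hnorm_dom; [exact: pd_psd|exact: gns_fun_inH]. Qed.

Lemma gns_dense v e : 0 < e -> exists s, rnorm (v - gns_kvec s) < e.
Proof.
move=> e0.
have [s hs] := kvec_dense (pd_psd pu) (gns_fun_inH v) (exprn_gt0 2 e0).
exists s; rewrite -(ltr_pXn2r (n := 2)) ?nnegrE ?rnorm_ge0 ?ltW //.
by rewrite gns_rnorm hnorm_sqr; [exact: hs|exact: pd_psd|exact: gns_fun_inH].
Qed.

Lemma rnorm_cyc : rnorm gns_cyc ^+ 2 = Re (u 1%g).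
Proof. by rewrite rnorm_sqrE gns_dot_kvec ev1 gns_fun_cyc. Qed.

Lemma gns_uvec s : uvec s gns_cyc = gns_kvec s.
Proof.
apply: gns_fun_inj; rewrite -gns_coef coef_uvecl; congr (kvec (gk _) s).
by rewrite gns_coef gns_fun_cyc.
Qed.

End GelfandNaimarkSegal.

(** * B(G) as the union of the kernel spaces *)

Section FourierStieltjesSpace.
Variables (R : realType) (G : groupType).
Local Notation C := (R[i]).
Local Notation Re := complex.Re.
Implicit Types (phi psi : G -> C).

Lemma BG_pd phi : positive_definite phi -> BG phi.
Proof.
move=> pu; exists 1%N, (fun=> 1), (fun=> phi); split => //.
by apply/funext => g; rewrite big_ord1 mul1r.
Qed.

Lemma BGZ (c : C) phi : BG phi -> BG (fun g => c * phi g).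
Proof.
move=> [n [d [u [pu ->]]]]; exists n, (fun i => c * d i), u; split => //.
by apply/funext => g; rewrite mulr_sumr; apply: eq_bigr => i _; rewrite mulrA.
Qed.

Lemma BGD phi psi : BG phi -> BG psi -> BG (fun g => phi g + psi g).
Proof.
move=> [n [c [u [pu ->]]]] [m [d [v [pv ->]]]].
exists (n + m)%N, (fun i : 'I_(n + m) => match fintype.split i with inl j => c j | inr j => d j end),
  (fun i : 'I_(n + m) => match fintype.split i with inl j => u j | inr j => v j end); split.
  by move=> i; case: (fintype.split i).
apply/funext => g; rewrite big_split_ord; congr (_ + _); apply: eq_bigr => i _.
  by have -> := unsplitK (inl i : 'I_n + 'I_m).
by have -> := unsplitK (inr i : 'I_n + 'I_m).
Qed.

Lemma BG_lin c phi psi : BG phi -> BG psi -> BG (fun g => c * phi g + psi g).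
Proof. by move=> h; apply: BGD; exact: BGZ. Qed.

(** Polarization: four positive definite coefficients, of the vectors [c *: w + v] with [c] a fourth
    root of unity. *)
Lemma BG_coef (U : unitary_rep R G) (v w : urep_space U) : BG (coef v w).
Proof.
have -> : coef v w = (fun g => 4%:R^-1 * (coef (1 *: w + v) (1 *: w + v) g +
   (-1 * coef ((-1) *: w + v) ((-1) *: w + v) g +
   ('i%C * coef ('i%C *: w + v) ('i%C *: w + v) g +
    (- 'i%C) * coef ((- 'i%C) *: w + v) ((- 'i%C) *: w + v) g)))).
  apply/funext => g; rewrite !coef_linl /coef !(udotDr, udotZr).
  rewrite !conjcN conjc1 conjci.
  have ii : ('i%C : C) * 'i%C = -1 by rewrite -expr2 sqr_i.
  move: (urep_dot U (urep_act U g w) w) (urep_dot U (urep_act U g w) v)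
    (urep_dot U (urep_act U g v) w) (urep_dot U (urep_act U g v) v) => a b c d.
  apply: (@mulfI _ (4%:R : C)); first by rewrite pnatr_eq0.
  rewrite mulrA mulfV ?pnatr_eq0 // mul1r.
  set X := (RHS); have -> : X = 2%:R * b + 2%:R * c +
    2%:R * ('i%C * 'i%C) * (b - c) by rewrite /X; ring.
  by rewrite ii; ring.
apply: BGZ; apply: BGD; first by apply: BG_pd; exact: pd_coef.
apply: BGD; first by apply: BGZ; apply: BG_pd; exact: pd_coef.
by apply: BGD; apply: BGZ; apply: BG_pd; exact: pd_coef.
Qed.

Lemma BG_inH u phi : positive_definite u -> inH (gk u) phi -> BG phi.
Proof.
by move=> pu h; rewrite -(gns_vecK pu h) -gns_coef; exact: BG_coef.
Qed.

Lemma ball_BG r phi : ball_B r phi -> BG phi.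
Proof.
move=> b; have r0 := ball_ge0 b; case: b => u [pu _ d].
by apply: (BG_inH pu); exists r.
Qed.

Lemma BG_inH_ex phi : BG phi -> exists2 u, positive_definite u & inH (gk u) phi.
Proof.
move=> /BG_ball[r b]; have r0 := ball_ge0 b; case: b => u [pu _ d].
by exists u => //; exists r.
Qed.

Lemma BG_rtr k phi : BG phi -> BG (rtr k phi).
Proof. by move=> /BG_ball[r b]; apply: (@ball_BG r); exact: ball_rtr. Qed.

Lemma BG_ltr k phi : BG phi -> BG (ltr k phi).
Proof. by move=> /BG_ball[r b]; apply: (@ball_BG r); exact: ball_ltr. Qed.

Lemma BGX phi n : BG phi -> BG (fun g => phi g ^+ n).
Proof.
by move=> /BG_ball[r b]; apply: (@ball_BG (r ^+ n)); exact: ballX.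
Qed.

End FourierStieltjesSpace.

(** * The dual norm and the balls [ball_B] *)

Section DualNorm.
Variables (R : realType) (G : groupType).
Local Notation C := (R[i]).
Local Notation Re := complex.Re.
Local Notation CG := {fsfun G -> C with 0}.
Implicit Types (phi psi : G -> C) (a : CG).

Lemma cstar_norm_has_sup a :
  has_sup [set r : R | exists (U : unitary_rep R G) (v : urep_space U),
         rnorm v <= 1 /\ r = rnorm (rep_ext a v)].
Proof.
split.
  exists (rnorm (rep_ext a (0 : urep_space (gns (@pd0 R G))))).
  by exists (gns (@pd0 R G)), 0; rewrite rnorm0.
exists (\sum_(g <- finsupp a) modulus (a g)) => _ [U [v [v1 ->]]].
rewrite /rep_ext; elim: (finsupp a : seq G) => [|g l IH].
  by rewrite !big_nil rnorm0.
rewrite !big_cons; apply: le_trans (rnormD _ _) _; apply: lerD => //.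
by rewrite rnormZ rnorm_act ler_piMr // mod_ge0.
Qed.

Lemma cstar_norm_upper a (U : unitary_rep R G) (v : urep_space U) : rnorm v <= 1 ->
  rnorm (rep_ext a v) <= cstar_norm a.
Proof.
by move=> v1; apply: sup_upper_bound (cstar_norm_has_sup a) _ _; exists U, v.
Qed.

Lemma cstar_norm_ge0 a : 0 <= cstar_norm a.
Proof.
apply: le_trans (cstar_norm_upper a (v := 0 : urep_space (gns (@pd0 R G))) _).
  exact: rnorm_ge0.
by rewrite rnorm0.
Qed.

Lemma rep_extZ a (U : unitary_rep R G) (v : urep_space U) c :
  rep_ext a (c *: v) = c *: rep_ext a v.
Proof.
rewrite /rep_ext scaler_sumr; apply: eq_bigr => g _.
by rewrite linearZ !scalerA mulrC.
Qed.

Lemma rep_ext_le a (U : unitary_rep R G) (v : urep_space U) :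
  rnorm (rep_ext a v) <= cstar_norm a * rnorm v.
Proof.
have [v0|v0] := eqVneq (rnorm v) 0.
  rewrite v0 mulr0 (rnorm_eq0 v0); have := rep_extZ a (0 : urep_space U) 0.
  by rewrite !scale0r => ->; rewrite rnorm0.
have vp : 0 < rnorm v by rewrite lt_def v0 rnorm_ge0.
have m : modulus ((rnorm v)^-1%:C) = (rnorm v)^-1 by rewrite mod_pos // invr_ge0 ltW.
have := @cstar_norm_upper a U ((rnorm v)^-1%:C *: v) _.
rewrite rep_extZ !rnormZ m mulVf // lexx => /(_ isT).
by rewrite mulrC ler_pdivrMr.
Qed.

Lemma pairing_coef a (U : unitary_rep R G) (v w : urep_space U) :
  pairing (coef v w) a = urep_dot U (rep_ext a v) w.
Proof.
rewrite /pairing /rep_ext udot_suml; apply: eq_bigr => g _.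
by rewrite udotZl mulrC.
Qed.

Lemma pairing_ball r phi a : ball_B r phi -> modulus (pairing phi a) <= r * cstar_norm a.
Proof.
move=> b; have r0 := ball_ge0 b; case: b => u [pu ur d].
have h : inH (gk u) phi by exists r.
rewrite -(gns_vecK pu h) -gns_coef pairing_coef.
apply: le_trans (udot_CS _ _) _.
apply: (@le_trans _ _ (cstar_norm a * rnorm (gns_vec pu h) * rnorm (gns_cyc pu))).
  by rewrite ler_wpM2r ?rnorm_ge0 // rep_ext_le.
rewrite -mulrA mulrC ler_wpM2r ?cstar_norm_ge0 //.
apply: (sqr_le_pos r0); rewrite exprMn expr2; apply: ler_pM; rewrite ?sqr_ge0 //.
  exact: gns_rnorm_le.
by rewrite rnorm_cyc.
Qed.

Lemma BG_norm_has_sup phi : BG phi ->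
  has_sup [set r : R | exists a : CG, cstar_norm a <= 1 /\ r = modulus (pairing phi a)].
Proof.
move=> /BG_ball[r b]; split.
  exists (modulus (pairing phi [fsfun])); exists [fsfun]; split => //.
  apply: ge_sup; first by case: (cstar_norm_has_sup [fsfun]).
  move=> _ [U [v [v1 ->]]]; rewrite /rep_ext finsupp0 big_nil.
  by rewrite rnorm0 ler01.
exists r => _ [a [a1 ->]]; apply: le_trans (pairing_ball a b) _.
by rewrite ler_piMr // (ball_ge0 b).
Qed.

Lemma BG_norm_le r phi : ball_B r phi -> BG_norm phi <= r.
Proof.
move=> b; have [ne _] := BG_norm_has_sup (ball_BG b); apply: ge_sup => //.
move=> _ [a [a1 ->]]; apply: le_trans (pairing_ball a b) _.
by rewrite ler_piMr // (ball_ge0 b).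
Qed.

Lemma pairing_BG_norm phi a : BG phi -> cstar_norm a <= 1 ->
  modulus (pairing phi a) <= BG_norm phi.
Proof.
by move=> /BG_norm_has_sup h a1; apply: sup_upper_bound => //; exists a.
Qed.

Lemma BG_norm_ge0 phi : BG phi -> 0 <= BG_norm phi.
Proof.
move=> h; have [[_ [a [a1 _]]] _] := BG_norm_has_sup h.
exact: le_trans (mod_ge0 _) (pairing_BG_norm h a1).
Qed.

Definition fs_of (F : {fset G}) (f : G -> C) : CG := [fsfun g in F => f g].

Lemma fs_ofE (V : nmodType) F f (h : G -> C -> V) : (forall g, h g 0 = 0) ->
  \sum_(g <- finsupp (fs_of F f)) h g (fs_of F f g) = \sum_(g <- F) h g (f g).
Proof.
move=> h0; rewrite (big_fset_incl _ (finsupp_sub _ _ _)) => [|g gF].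
  by rewrite big_seq [RHS]big_seq; apply: eq_bigr => g gF; rewrite fsfunE gF.
by rewrite memNfinsupp => /eqP ->.
Qed.

Lemma pairing_fs_of F f phi : pairing phi (fs_of F f) = \sum_(g <- F) phi g * f g.
Proof. by rewrite /pairing (fs_ofE F f (h := fun g x => phi g * x)) // => g; rewrite mulr0. Qed.

Lemma rep_ext_fs_of F f (U : unitary_rep R G) (v : urep_space U) :
  rep_ext (fs_of F f) v = \sum_(g <- F) f g *: urep_act U g v.
Proof.
by rewrite /rep_ext (fs_ofE F f (h := fun g x => x *: urep_act U g v)) // => g; rewrite scale0r.
Qed.

Lemma pairing_fs_ofZ F f c phi :
  pairing phi (fs_of F (fun g => c * f g)) = c * pairing phi (fs_of F f).
Proof.
rewrite !pairing_fs_of mulr_sumr; apply: eq_bigr => g _.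
by rewrite mulrCA.
Qed.

Lemma rep_ext_fs_ofZ F f c (U : unitary_rep R G) (v : urep_space U) :
  rep_ext (fs_of F (fun g => c * f g)) v = c *: rep_ext (fs_of F f) v.
Proof.
rewrite !rep_ext_fs_of scaler_sumr; apply: eq_bigr => g _.
by rewrite scalerA.
Qed.

(* The bipolar theorem for the pair (ball_B, cstar_norm): on a finite subset of
   G a point outside the closed convex set ball_B r is separated from it by the
   direction to an almost nearest point. *)
Lemma bipolar r phi : 0 < r ->
  (forall a, cstar_norm a <= 1 -> modulus (pairing phi a) <= r) -> ball_B r phi.
Proof.
move=> r0 H; apply: ball_pointwise_closure => l e e0; apply: contrapT => N.
pose F := [fset g in l]%fset.
pose sq (f : G -> C) : R := \sum_(g <- F) modulus (f g) ^+ 2.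
pose inn (f h : G -> C) : R := \sum_(g <- F) Re (h g * (f g)^*).
have sq0 f : 0 <= sq f by apply: sumr_ge0 => g _; exact: sqr_ge0.
have far psi : ball_B r psi -> e ^+ 2 <= sq (fun g => phi g - psi g).
  move=> b; rewrite leNgt; apply/negP => lt; apply: N; exists psi => // g gl.
  rewrite mod_dist -(ltr_pXn2r (n := 2)) ?nnegrE ?mod_ge0 ?ltW //.
  apply: le_lt_trans lt; rewrite /sq (big_fsetD1 g) ?inE //= lerDl.
  by apply: sumr_ge0 => x _; exact: sqr_ge0.
pose S := [set x | exists2 psi, ball_B r psi & x = sq (fun g => phi g - psi g)].
have b0 : ball_B r (fun _ : G => 0 : C) by apply: ball_fun0; exact: ltW.
have hS : has_inf S.
  split; first by exists (sq (fun g => phi g - 0)), (fun=> 0).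
  by exists 0 => _ [psi _ ->].
pose d := inf S.
have dlow psi : ball_B r psi -> d <= sq (fun g => phi g - psi g).
  by move=> b; apply: inf_lbound; [case: hS|exists psi].
have d0 : 0 < d.
  apply: lt_le_trans (exprn_gt0 2 e0) _.
  by apply: lb_le_inf; [case: hS|move=> _ [psi b ->]; exact: far].
pose B : R := \sum_(g <- F) (2 * r) ^+ 2 + 1.
have B1 : 1 <= B by rewrite lerDr sumr_ge0 // => g _; exact: sqr_ge0.
(* Functions of the ball are bounded by [r], so two of them differ on [F] by at most [B] in [sq]; a
   step of length [t] towards [psi] then has second order term at most [t * d / 4]. *)
pose t := Num.min 1 (d / (4 * B)).
have t0 : 0 < t by rewrite lt_min ltr01 divr_gt0 // mulr_gt0 //; lra.
have t1 : t <= 1 by rewrite ge_min lexx.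
have tB : t * B <= d / 4.
  have -> : d / 4 = d / (4 * B) * B by field; lra.
  by rewrite ler_wpM2r ?ge_min ?lexx ?orbT //; lra.
have eta0 : 0 < t * d / 4 by rewrite divr_gt0 // mulr_gt0.
have [_ [psi0 bpsi0 ->] near] := inf_adherent eta0 hS.
pose D g := phi g - psi0 g.
have sqD f h c : sq (fun g => f g - (c%:C) * h g) =
    sq f - 2 * c * inn f h + c ^+ 2 * sq h.
  rewrite /sq /inn !mulr_sumr -sumrB -big_split /=; apply: eq_bigr => g _.
  rewrite !mod_sqr !cReB !cImB !cReM !cImM !cReJ !cImJ /=; ring.
have sep psi : ball_B r psi -> inn D psi <= inn D phi - d / 4.
  move=> b.
  have conv : ball_B r (fun g => (1 - t)%:C * psi0 g + t%:C * psi g).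
    have := ballD (ballZ ((1 - t)%:C) bpsi0) (ballZ (t%:C) b).
    rewrite !mod_pos ?subr_ge0 //; last exact: ltW.
    by rewrite -mulrDl subrK mul1r.
  have := dlow _ conv.
  have -> : (fun g => phi g - ((1 - t)%:C * psi0 g + t%:C * psi g)) =
      (fun g => D g - t%:C * (psi g - psi0 g)).
    by apply/funext => g; rewrite /D rmorphB /=; ring.
  rewrite sqD; set E := fun g => psi g - psi0 g.
  have sE : sq E <= B.
    rewrite /sq /B -[X in X <= _]addr0; apply: lerD => //.
    rewrite big_seq [X in _ <= X]big_seq; apply: ler_sum => g _.
    rewrite ler_pXn2r ?nnegrE ?mod_ge0 //; last by rewrite mulr_ge0 // ltW.
    apply: le_trans (modD _ _) _; rewrite modN.
    by have := ball_pt g b; have := ball_pt g bpsi0; lra.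
  have iE : inn D E = inn D psi - inn D psi0.
    rewrite /inn -sumrB; apply: eq_bigr => g _.
    by rewrite -cReB mulrBl.
  have iD : sq D = inn D phi - inn D psi0.
    rewrite /inn -sumrB; apply: eq_bigr => g _.
    by rewrite -cReB -mulrBl -mod_sqrC.
  have near' : sq D < d + t * d / 4 by exact: near.
  have dD : d <= sq D := dlow _ bpsi0.
  move=> h.
  have h2 : 2 * inn D E <= d / 4 + t * sq E.
    rewrite -(ler_pM2l t0).
    have -> : t * (d / 4 + t * sq E) = t * d / 4 + t ^+ 2 * sq E by ring.
    by move: h; rewrite mulrA [t * 2]mulrC; lra.
  have h3 : t * sq E <= d / 4 by apply: le_trans tB; rewrite ler_wpM2l // ltW.
  by lra.
pose M := inn D phi - d / 4.
have M0 : 0 <= M.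
  apply: le_trans (sep _ b0); rewrite /inn big1 // => g _.
  by rewrite mul0r.
pose a := fs_of F (fun g => (D g)^*).
have pa psi : Re (pairing psi a) = inn D psi by rewrite pairing_fs_of cRe_sum.
(* The separation is tested on the coefficient of [v], rescaled by [c], against [w]: it lies in the
   ball, and its pairing with [a] is [r * rnorm w]. *)
have ca (U : unitary_rep R G) (v : urep_space U) : rnorm v <= 1 ->
    r * rnorm (rep_ext a v) <= M.
  move=> v1; set w := rep_ext a v.
  have [->|w0] := eqVneq (rnorm w) 0; first by rewrite mulr0.
  have wp : 0 < rnorm w by rewrite lt_def w0 rnorm_ge0.
  pose c : C := (r / rnorm w)%:C.
  have cm : modulus c = r / rnorm w by rewrite mod_pos // divr_ge0 // ltW.
  have b : ball_B r (coef (c *: v) w).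
    apply: ball_coef_le; rewrite rnormZ cm mulrAC divfK //.
    by rewrite ler_piMr // ltW.
  have := sep _ b; rewrite -pa pairing_coef rep_extZ udotZl cReZ -rnorm_sqrE.
  by rewrite expr2 mulrA divfK.
(* Strictly between [M] and [inn D phi], which is [M + d / 4], and positive even when [M = 0]. *)
pose M' := M + d / 8.
have M'0 : 0 < M' by rewrite /M'; lra.
pose k : C := (r / M')%:C.
have km : modulus k = r / M' by rewrite mod_pos // divr_ge0 // ltW.
have := H (fs_of F (fun g => k * (D g)^*)) _.
rewrite pairing_fs_ofZ -/a modM km => h.
suff : r < r / M' * modulus (pairing phi a).
  rewrite ltNge h //; apply: ge_sup; first by case: (cstar_norm_has_sup (fs_of F (fun g => k * (D g)^*))).
  move=> _ [U [v [v1 ->]]]; rewrite rep_ext_fs_ofZ rnormZ km mulrAC.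
  rewrite ler_pdivrMr // mul1r; apply: le_trans (ca U v v1) _.
  by rewrite /M'; lra.
rewrite mulrAC ltr_pdivlMr // ltr_pM2l //; apply: lt_le_trans (Re_le_mod _).
by rewrite pa /M' /M; lra.
Qed.

Lemma ball_BG_norm r phi : BG phi -> 0 < r -> BG_norm phi <= r -> ball_B r phi.
Proof.
move=> h r0 le; apply: bipolar => // a a1.
exact: le_trans (pairing_BG_norm h a1) le.
Qed.

End DualNorm.

(** * The action of W*(G) on B(G) *)

Section BidualAction.
Variables (R : realType) (G : groupType).
Local Notation C := (R[i]).
Local Notation Re := complex.Re.
Implicit Types (phi psi : G -> C) (x y z : (G -> C) -> C).

Lemma W_intro x M :
  (forall c phi psi, BG phi -> BG psi ->
     x (fun g => c * phi g + psi g) = c * x phi + x psi) ->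
  (forall r phi, ball_B r phi -> modulus (x phi) <= M * r) ->
  (forall phi, ~ BG phi -> x phi = 0) -> Wstar x.
Proof.
move=> xlin xM x0; split => //; exists `|M| => phi h.
have N0 := BG_norm_ge0 h.
apply/ler_addgt0Pr => e e0; have M1 : 0 < `|M| + 1 by rewrite ltr_wpDl.
have ee : 0 < e / (`|M| + 1) by rewrite divr_gt0.
have b : ball_B (BG_norm phi + e / (`|M| + 1)) phi.
  by apply: ball_BG_norm => //; [rewrite ltr_wpDl|rewrite lerDl ltW].
apply: le_trans (xM _ _ b) _.
apply: (@le_trans _ _ (`|M| * (BG_norm phi + e / (`|M| + 1)))).
  by apply: ler_wpM2r (ler_norm _); exact: ball_ge0 b.
rewrite mulrDr lerD2l mulrA ler_pdivrMr // mulrC ler_pM2l //.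
by rewrite lerDl.
Qed.

Section OneElement.
Variable x : (G -> C) -> C.
Hypothesis Wx : Wstar x.

Lemma W_lin c phi psi : BG phi -> BG psi ->
  x (fun g => c * phi g + psi g) = c * x phi + x psi.
Proof. by case: Wx => h _ _; exact: h. Qed.

Lemma W_bound : exists2 M, 0 <= M & forall r phi, ball_B r phi -> modulus (x phi) <= M * r.
Proof.
case: Wx => _ [M HM] _; exists `|M| => // r phi b.
have h := ball_BG b; apply: le_trans (HM _ h) _.
apply: (@le_trans _ _ (`|M| * BG_norm phi)).
  by apply: ler_wpM2r (ler_norm _); exact: BG_norm_ge0.
by apply: ler_wpM2l => //; exact: BG_norm_le.
Qed.

Lemma BG_fun0 : BG (fun _ : G => 0 : C).
Proof. by apply: BG_pd; exact: pd0. Qed.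

Lemma W_0 : x (fun=> 0) = 0.
Proof.
have h := W_lin (-1) BG_fun0 BG_fun0; rewrite [in RHS]mulN1r [in RHS]addNr in h.
apply: etrans h; by congr x; apply/funext => g; rewrite mulr0 addr0.
Qed.

Lemma W_B phi psi : BG phi -> BG psi ->
  x (fun g => phi g - psi g) = x phi - x psi.
Proof.
move=> h h'; have e := W_lin (-1) h' h; rewrite [in RHS]mulN1r [in RHS]addrC in e.
apply: etrans e; by congr x; apply/funext => g; rewrite mulN1r addrC.
Qed.

Lemma W_sum (I : Type) (l : seq I) (c : I -> C) (F : I -> G -> C) :
  (forall i, BG (F i)) ->
  x (fun g => \sum_(i <- l) c i * F i g) = \sum_(i <- l) c i * x (F i) /\
  BG (fun g => \sum_(i <- l) c i * F i g).
Proof.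
move=> H; elim: l => [|i l [IH1 IH2]].
  have -> : (fun g => \sum_(i <- [::]) c i * F i g) = (fun=> 0).
    by apply/funext => g; rewrite big_nil.
  by rewrite big_nil W_0; split => //; exact: BG_fun0.
have -> : (fun g => \sum_(j <- i :: l) c j * F j g) =
    (fun g => c i * F i g + \sum_(j <- l) c j * F j g).
  by apply/funext => g; rewrite big_cons.
by rewrite big_cons W_lin // IH1; split => //; exact: BG_lin.
Qed.

End OneElement.

Definition wact x phi : G -> C := fun g => x (ltr g phi).

Lemma wmulE x y phi : BG phi -> wmul x y phi = x (wact y phi).
Proof. by move=> h; rewrite /wmul asboolT. Qed.

Lemma ltr1 phi : ltr 1%g phi = phi.
Proof. by apply/funext => g; rewrite /ltr mul1g. Qed.

Lemma ltrM g h phi : ltr h (ltr g phi) = ltr (g * h)%g phi.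
Proof. by apply/funext => k; rewrite /ltr mulgA. Qed.

Lemma ltr_rtr g h phi : ltr g (rtr h phi) = rtr h (ltr g phi).
Proof. by apply/funext => k; rewrite /rtr /ltr mulgA. Qed.

Lemma wact1 x phi : wact x phi 1%g = x phi.
Proof. by rewrite /wact ltr1. Qed.

Lemma ltr_wact x g phi : ltr g (wact x phi) = wact x (ltr g phi).
Proof. by apply/funext => h; rewrite /ltr /wact ltrM. Qed.

Definition wev (k : G) : (G -> C) -> C := fun phi =>
  if `[< BG phi >] then phi k else 0.

Lemma wevE k phi : BG phi -> wev k phi = phi k.
Proof. by move=> h; rewrite /wev asboolT. Qed.

Lemma Wstar_ev k : Wstar (wev k).
Proof.
apply: (@W_intro _ 1).
- by move=> c phi psi h h'; rewrite !wevE //; exact: BG_lin.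
- move=> r phi b; rewrite mul1r wevE; [exact: ball_pt|exact: ball_BG b].
- by move=> phi h; rewrite /wev asboolF.
Qed.

Lemma wact_ev k phi : BG phi -> wact (wev k) phi = rtr k phi.
Proof.
by move=> h; apply/funext => g; rewrite /wact wevE //; exact: BG_ltr.
Qed.

Lemma wone_ev : @wone R G = wev 1%g. Proof. by []. Qed.

Section OnHilbert.
Variables (x : (G -> C) -> C) (u : G -> C).
Hypotheses (Wx : Wstar x) (pu : positive_definite u).
Local Notation H := (urep_space (gns pu)).

Lemma W_coef_uvec (v : H) s :
  ev (wact x (gns_fun v)) s = x (coef v (gns_kvec pu s)).
Proof.
rewrite -gns_uvec.
have -> : coef v (uvec s (gns_cyc pu)) =
    (fun g => \sum_(p <- s) p.1^* * ltr p.2 (gns_fun v) g).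
  by apply/funext => g; rewrite coef_uvec gns_coef.
have [|-> _] := W_sum Wx s (fun p => p.1^*) (F := fun p => ltr p.2 (gns_fun v)).
  by move=> p; apply: BG_ltr; apply: BG_inH (gns_fun_inH v).
by [].
Qed.

(** Paired with a kernel combination k, the function [wact x phi] gives the value of [x] at the
    coefficient of [phi] against k, which lies in the ball of radius ||phi|| ||k||. *)
Lemma wact_inH phi : inH (gk u) phi -> inH (gk u) (wact x phi).
Proof.
move=> h; have [M M0 HM] := W_bound Wx; pose v := gns_vec pu h.
exists ((M * rnorm v) ^+ 2); first exact: sqr_ge0.
move=> s; rewrite -(gns_vecK pu h) W_coef_uvec.
have -> : qf (gk u) s = rnorm (gns_kvec pu s) ^+ 2.
  by rewrite rnorm_sqrE gns_dot_kvec.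
rewrite -exprMn ler_pXn2r ?nnegrE ?mod_ge0 ?mulr_ge0 ?rnorm_ge0 // -mulrA.
by apply: HM; exact: ball_coef.
Qed.

Definition wvec (v : H) : H := gns_vec pu (wact_inH (gns_fun_inH v)).

Lemma wvec_dot (v w : H) : urep_dot (gns pu) (wvec v) w = x (coef v w).
Proof.
have [M M0 HM] := W_bound Wx.
apply/eqP; rewrite -subr_eq0; apply/eqP; apply: mod_eq0; apply/eqP.
rewrite eq_le mod_ge0 andbT; apply/ler_addgt0Pr => e e0; rewrite add0r.
pose B := rnorm (wvec v) + M * rnorm v + 1.
have B0 : 0 < B by rewrite ltr_wpDl // addr_ge0 ?mulr_ge0 ?rnorm_ge0.
have [s hs] := gns_dense w (divr_gt0 e0 B0).
pose k := gns_kvec pu s.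
have hk : urep_dot (gns pu) (wvec v) k = x (coef v k) by rewrite gns_dot_kvec W_coef_uvec.
have -> : urep_dot (gns pu) (wvec v) w - x (coef v w) =
    urep_dot (gns pu) (wvec v) (w - k) - x (coef v (w - k)).
  have -> : coef v (w - k) = (fun g => coef v w g - coef v k g).
    by apply/funext => g; exact: coefBr.
  rewrite W_B //; try exact: BG_coef.
  by rewrite udotBr hk; ring.
apply: le_trans (modD _ _) _; rewrite modN.
have h1 := udot_CS (wvec v) (w - k); have h2 := HM _ _ (ball_coef v (w - k)).
apply: (@le_trans _ _ (B * rnorm (w - k))).
  by have := rnorm_ge0 (w - k); rewrite /B; nra.
by rewrite mulrC -ler_pdivlMr // ltW.
Qed.

End OnHilbert.

Lemma W_BG_wact x phi : Wstar x -> BG phi -> BG (wact x phi).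
Proof.
move=> Wx /BG_inH_ex[u pu h]; apply: (BG_inH pu); exact: wact_inH.
Qed.

Definition closed_subspace (S : set (G -> C)) : Prop :=
  [/\ forall phi, S phi -> BG phi, S (fun=> 0),
      forall c phi psi, S phi -> S psi -> S (fun g => c * phi g + psi g)
    & forall phi, BG phi ->
        (forall e, 0 < e -> exists2 psi, S psi & ball_B e (fun g => phi g - psi g)) ->
        S phi].

Definition rinvariant (S : set (G -> C)) : Prop :=
  forall k phi, S phi -> S (rtr k phi).
Definition linvariant (S : set (G -> C)) : Prop :=
  forall k phi, S phi -> S (ltr k phi).

Section Subspaces.
Variables (S : set (G -> C)) (cS : closed_subspace S).

Lemma cs_sum (I : Type) (l : seq I) (c : I -> C) (F : I -> G -> C) :
  (forall i, S (F i)) -> S (fun g => \sum_(i <- l) c i * F i g).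
Proof.
case: cS => _ S0 Slin _ H; elim: l => [|i l IH].
  have -> : (fun g => \sum_(i <- [::]) c i * F i g) = (fun=> 0).
    by apply/funext => g; rewrite big_nil.
  exact: S0.
have -> : (fun g => \sum_(j <- i :: l) c j * F j g) =
    (fun g => c i * F i g + \sum_(j <- l) c j * F j g).
  by apply/funext => g; rewrite big_cons.
exact: Slin.
Qed.

Lemma cs_BG phi : S phi -> BG phi. Proof. by case: cS => h _ _ _; exact: h. Qed.

Lemma cs_B phi psi : S phi -> S psi -> S (fun g => phi g - psi g).
Proof.
case: cS => _ _ Slin _ h h'; have := Slin (-1) _ _ h' h; congr S.
by apply/funext => g; rewrite mulN1r addrC.
Qed.

Lemma cs_subspace u (pu : positive_definite u) :
  subspace [set v : urep_space (gns pu) | S (gns_fun v)].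
Proof.
case: cS => SBG S0 Slin Scl; split => //=; first by move=> c v w h h'; exact: Slin.
move=> v H; apply: Scl; first exact: BG_inH (gns_fun_inH v).
move=> e e0; have c0 := rnorm_ge0 (gns_cyc pu).
have c1 : 0 < rnorm (gns_cyc pu) + 1 by rewrite ltr_wpDl.
have [w Sw hw] := H _ (divr_gt0 e0 c1); exists (gns_fun w) => //.
have -> : (fun g => gns_fun v g - gns_fun w g) = coef (U := gns pu) (v - w) (gns_cyc pu).
  by rewrite gns_coef.
apply: ball_coef_le; move: hw; rewrite ltr_pdivlMr // => /ltW; apply: le_trans.
by rewrite ler_wpM2l ?rnorm_ge0 // lerDl.
Qed.

(** In the spirit of the bicommutant theorem. Let [y1] be the projection of y = x.phi on the part of
    [S] in the kernel space. By right invariance the coefficient of [phi] against y - y1 vanishes,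
    and <y, y - y1> is the value of [x] at it; hence y = y1. *)
Lemma cs_wact x phi : rinvariant S -> Wstar x -> S phi -> S (wact x phi).
Proof.
move=> rS Wx Sphi; have [u pu h] := BG_inH_ex (cs_BG Sphi).
pose v := gns_vec pu h; pose y := wvec Wx v.
have [y1 Sy1 hy1] := orthogonal_projection y (cs_subspace pu).
have e0 : urep_dot (gns pu) (y - y1) (y - y1) = 0.
  rewrite udotBr (hy1 _ Sy1) subr0 udotC udotBr wvec_dot.
  have z : coef v y = coef v y1.
    apply/funext => g; apply/eqP; rewrite -subr_eq0 -coefBr.
    by rewrite /coef udotC hy1 ?conjc0 //; exact: rS.
  by rewrite z -wvec_dot subrr conjc0.
have : y - y1 = 0.
  by apply: rnorm_eq0; apply/eqP; rewrite -sqrf_eq0 rnorm_sqrE e0.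
by move/eqP; rewrite subr_eq0 => /eqP yy; have := Sy1; rewrite -yy.
Qed.

(** Approximating [w] by kernel combinations approximates the coefficient by combinations of left
    translates of [v]. *)
Lemma cs_coef u (pu : positive_definite u) (v w : urep_space (gns pu)) :
  linvariant S -> S (gns_fun v) -> S (coef v w).
Proof.
case: (cS) => _ _ _ Scl lS Sv; apply: Scl; first exact: BG_coef.
move=> e e0; have c0 := rnorm_ge0 v.
have c1 : 0 < rnorm v + 1 by rewrite ltr_wpDl.
have [s hs] := gns_dense w (divr_gt0 e0 c1).
exists (coef v (gns_kvec pu s)).
  have -> : coef v (gns_kvec pu s) =
      (fun g => \sum_(p <- s) p.1^* * ltr p.2 (gns_fun v) g).
    by apply/funext => g; rewrite -gns_uvec coef_uvec gns_coef.
  by apply: cs_sum => p; exact: lS.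
have -> : (fun g => coef v w g - coef v (gns_kvec pu s) g) =
    coef (U := gns pu) v (w - gns_kvec pu s).
  by apply/funext => g; rewrite coefBr.
apply: ball_coef_le; move: hs; rewrite ltr_pdivlMr // mulrC => /ltW; apply: le_trans.
by rewrite ler_wpM2r ?rnorm_ge0 // lerDl.
Qed.

End Subspaces.

End BidualAction.

(** * Decomposition of B(G) along a closed bi-invariant subspace *)

Section LebesgueDecomposition.
Variables (R : realType) (G : groupType).
Local Notation C := (R[i]).
Local Notation Re := complex.Re.
Implicit Types (phi psi u w : G -> C) (x y z : (G -> C) -> C) (k : G).

Section Inclusion.
Variables (u w : G -> C).
Hypotheses (pu : positive_definite u) (pw : positive_definite w).
Hypothesis uw : forall s, qf (gk u) s <= qf (gk w) s.
Local Notation Hu := (urep_space (gns pu)).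
Local Notation Hw := (urep_space (gns pw)).

Lemma dom_mono a phi : 0 <= a -> dom (gk u) a phi -> dom (gk w) a phi.
Proof. by move=> a0 d s; apply: le_trans (d s) _; rewrite ler_wpM2l. Qed.

Lemma inH_mono phi : inH (gk u) phi -> inH (gk w) phi.
Proof. by move=> [a a0 d]; exists a => //; exact: dom_mono. Qed.

Definition incl (v : Hu) : Hw := gns_vec pw (inH_mono (gns_fun_inH v)).

Lemma incl_fun v : gns_fun (incl v) = gns_fun v. Proof. by []. Qed.

Lemma inclB v v' : incl (v - v') = incl v - incl v'.
Proof. exact: gns_fun_inj. Qed.

Lemma rnorm_incl v : rnorm (incl v) <= rnorm v.
Proof.
rewrite -(ler_pXn2r (n := 2)) ?nnegrE ?rnorm_ge0 //.
apply: gns_rnorm_le; first exact: sqr_ge0.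
by apply: dom_mono; [exact: sqr_ge0|exact: gns_dom].
Qed.

Lemma incl_kvec s : incl (gns_kvec pu s) = uvec s (incl (gns_cyc pu)).
Proof.
apply: gns_fun_inj; rewrite incl_fun; apply/funext => g.
rewrite -[gns_fun (uvec _ _)]gns_coef /coef /uvec linear_sum udot_suml.
apply: eq_bigr => p _; rewrite linearZ udotZl; congr (_ * _).
rewrite -urep_actM [RHS](congr1 (fun f => f (g * p.2^-1)%g) (gns_coef (incl (gns_cyc pu)))).
by rewrite incl_fun gns_fun_cyc.
Qed.

(** The adjoint of the inclusion J at [b]: by the reproducing property its value at g is <g b, J c>,
    with c the cyclic vector of the smaller space. *)
Definition incl_adj_fun (b : Hw) : G -> C := coef b (incl (gns_cyc pu)).

Lemma incl_adj_inH b : inH (gk u) (incl_adj_fun b).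
Proof.
exists (rnorm b ^+ 2); first exact: sqr_ge0.
move=> s; rewrite ev_coef -incl_kvec.
have -> : qf (gk u) s = rnorm (gns_kvec pu s) ^+ 2.
  by rewrite rnorm_sqrE gns_dot_kvec.
rewrite -exprMn ler_pXn2r ?nnegrE ?mod_ge0 ?mulr_ge0 ?rnorm_ge0 //.
by apply: le_trans (udot_CS _ _) _; rewrite ler_wpM2l ?rnorm_ge0 ?rnorm_incl.
Qed.

Definition incl_adj b : Hu := gns_vec pu (incl_adj_inH b).

Lemma incl_adjP v b :
  urep_dot (gns pw) (incl v) b = urep_dot (gns pu) v (incl_adj b).
Proof.
apply/eqP; rewrite -subr_eq0; apply/eqP; apply: mod_eq0; apply/eqP.
rewrite eq_le mod_ge0 andbT; apply/ler_addgt0Pr => e e0; rewrite add0r.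
pose B := rnorm b + rnorm (incl_adj b) + 1.
have B0 : 0 < B by rewrite ltr_wpDl // addr_ge0 ?rnorm_ge0.
have [s hs] := gns_dense v (divr_gt0 e0 B0).
pose k : Hu := gns_kvec pu s.
have hk : urep_dot (gns pw) (incl k) b = urep_dot (gns pu) k (incl_adj b).
  by rewrite udotC [RHS]udotC gns_dot_kvec ev_coef incl_kvec.
have -> : urep_dot (gns pw) (incl v) b - urep_dot (gns pu) v (incl_adj b) =
    urep_dot (gns pw) (incl (v - k)) b - urep_dot (gns pu) (v - k) (incl_adj b).
  by rewrite inclB !udotBl hk; ring.
apply: le_trans (modD _ _) _; rewrite modN.
have h1 := udot_CS (incl (v - k)) b; have h2 := udot_CS (v - k : Hu) (incl_adj b).
have h3 := rnorm_incl (v - k).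
apply: (@le_trans _ _ (B * rnorm (v - k : Hu))).
  have := rnorm_ge0 b; have := rnorm_ge0 (incl_adj b); rewrite /B.
  have := rnorm_ge0 (v - k : Hu).
  move: h1 h2 h3; move: (rnorm (incl (v - k))) (rnorm (v - k : Hu)) => p q h1 h2 h3 q0 b0 a0.
  have : p * rnorm b <= q * rnorm b by rewrite ler_wpM2r.
  by lra.
by rewrite mulrC -ler_pdivlMr // ltW.
Qed.

End Inclusion.

Variable (S : set (G -> C)).
Hypotheses (cS : closed_subspace S) (rS : rinvariant S) (lS : linvariant S).

(* This does not depend on the kernel space in which phi is viewed: see
   disjoint_mono for the passage to a larger one. *)
Definition disjoint_from phi : Prop :=
  exists u (pu : positive_definite u) (v : urep_space (gns pu)),
    gns_fun v = phi /\ forall b : urep_space (gns pu), S (gns_fun b) ->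
      urep_dot (gns pu) v b = 0.

(** The adjoint of the inclusion sends [b] to a coefficient of [b], which stays in [S] by left
    invariance. *)
Lemma disjoint_mono u w (pu : positive_definite u) (pw : positive_definite w)
    (uw : forall s, qf (gk u) s <= qf (gk w) s) (v : urep_space (gns pu)) :
  (forall b : urep_space (gns pu), S (gns_fun b) -> urep_dot (gns pu) v b = 0) ->
  forall b : urep_space (gns pw), S (gns_fun b) ->
    urep_dot (gns pw) (incl pw uw v) b = 0.
Proof.
by move=> h b Sb; rewrite incl_adjP; apply: h; exact: cs_coef.
Qed.

Lemma disjoint_BG phi : disjoint_from phi -> BG phi.
Proof. by move=> [u [pu [v [<- _]]]]; exact: BG_inH (gns_fun_inH v). Qed.

Lemma disjoint_lin c phi psi : disjoint_from phi -> disjoint_from psi ->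
  disjoint_from (fun g => c * phi g + psi g).
Proof.
move=> [u [pu [v [<- hv]]]] [w [pw [v' [<- hv']]]].
(* The kernel space of the sum contains both spaces, so the two functions can be compared there. *)
pose t g := u g + w g; have pt : positive_definite t by exact: pdD.
have ut s : qf (gk u) s <= qf (gk t) s.
  by rewrite qf_gkD lerDl; exact/qf_ge0/pd_psd.
have wt s : qf (gk w) s <= qf (gk t) s.
  by rewrite qf_gkD lerDr; exact/qf_ge0/pd_psd.
exists t, pt, (c *: incl pt ut v + incl pt wt v'); split => // b Sb.
by rewrite udotDl udotZl !disjoint_mono // mulr0 addr0.
Qed.

Lemma disjoint_eq0 phi : S phi -> disjoint_from phi -> phi = (fun=> 0).
Proof.
move=> Sphi [u [pu [v [e hv]]]]; have := hv v; rewrite e => /(_ Sphi).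
rewrite rnorm_sqr => -[] /eqP; rewrite sqrf_eq0 => /eqP v0.
by rewrite -e (rnorm_eq0 (U := gns pu) v0).
Qed.

Lemma nsq_ltr k u phi : nsq (gk (conjpd k u)) (ltr k phi) = nsq (gk u) phi.
Proof.
congr sup; apply/seteqP; split=> [r [s ->]|r [s ->]].
  by exists (lshift k s); rewrite ev_ltr /qf kform_lshift.
exists (lshift k^-1%g s); rewrite ev_ltr /qf -kform_lshift.
have -> : lshift k (lshift k^-1%g s) = s.
  rewrite /lshift -map_comp -[RHS]map_id.
  by apply: eq_map => -[c g] /=; rewrite mulVKg.
by [].
Qed.

Lemma ltrK k phi : ltr k (ltr k^-1%g phi) = phi.
Proof. by apply/funext => g; rewrite /ltr mulKg. Qed.

Lemma conjpdK k u : conjpd k^-1%g (conjpd k u) = u.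
Proof.
apply/funext => g; rewrite /conjpd invgK; congr u.
by rewrite !mulgA mulgV mul1g -mulgA mulgV mulg1.
Qed.

(** Left translation by [k] carries the kernel space of [u] isometrically to that of [conjpd k u],
    and preserves [S]. *)
Lemma disjoint_ltr k phi : disjoint_from phi -> disjoint_from (ltr k phi).
Proof.
move=> [u [pu [v [<- hv]]]]; pose w := conjpd k u; have pw := pd_conj k pu.
have hk : inH (gk w) (ltr k (gns_fun v)).
  by have [a a0 d] := gns_fun_inH v; exists a => //; exact: dom_ltr.
exists w, pw, (gns_vec pw hk); split => // b Sb.
have hb : inH (gk u) (ltr k^-1%g (gns_fun b)).
  have [a a0 d] := gns_fun_inH b; exists a => //; rewrite -(conjpdK k u).
  exact: dom_ltr.
have <- : urep_dot (gns pu) v (gns_vec pu hb) = urep_dot (gns pw) (gns_vec pw hk) b.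
  change (ip (gk u) (gns_fun v) (ltr k^-1%g (gns_fun b)) =
    ip (gk w) (ltr k (gns_fun v)) (gns_fun b)).
  rewrite -{2}(ltrK k (gns_fun b)) /ip /nC.
  have E c : nsq (gk w) (fun h => ltr k (gns_fun v) h +
      c * ltr k (ltr k^-1%g (gns_fun b)) h) =
      nsq (gk u) (fun h => gns_fun v h + c * ltr k^-1%g (gns_fun b) h).
    exact: (nsq_ltr k u (fun h => gns_fun v h + c * ltr k^-1%g (gns_fun b) h)).
  by rewrite !E.
by apply: hv; exact: lS.
Qed.

Lemma disjoint_wact x phi : Wstar x -> disjoint_from phi -> disjoint_from (wact x phi).
Proof.
move=> Wx [u [pu [v [<- hv]]]]; exists u, pu, (wvec Wx v); split => // b Sb.
rewrite wvec_dot; have -> : coef v b = (fun=> 0); last exact: W_0.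
by apply/funext => g; rewrite /coef udot_act; apply: hv; exact: rS.
Qed.

Lemma disjoint_sum (I : Type) (l : seq I) (c : I -> C) (F : I -> G -> C) :
  (forall i, disjoint_from (F i)) -> disjoint_from (fun g => \sum_(i <- l) c i * F i g).
Proof.
move=> H; elim: l => [|i l IH].
  have -> : (fun g => \sum_(i <- [::]) c i * F i g) = (fun=> 0).
    by apply/funext => g; rewrite big_nil.
  exists (fun=> 0), (@pd0 R G), 0; split => // b _.
  exact: udot0l.
have -> : (fun g => \sum_(j <- i :: l) c j * F j g) =
    (fun g => c i * F i g + \sum_(j <- l) c j * F j g).
  by apply/funext => g; rewrite big_cons.
exact: disjoint_lin.
Qed.

Definition splits phi phi1 : Prop :=
  S phi1 /\ disjoint_from (fun g => phi g - phi1 g).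

Lemma splits_ex u (pu : positive_definite u) phi : inH (gk u) phi ->
  exists2 phi1, splits phi phi1 & forall a, 0 <= a -> dom (gk u) a phi -> dom (gk u) a phi1.
Proof.
move=> h; pose v := gns_vec pu h.
have [v1 Sv1 hv1] := orthogonal_projection v (cs_subspace cS pu).
exists (gns_fun v1); first by split => //; exists u, pu, (v - v1).
move=> a a0 d; apply: dom_le (pd_psd pu) _ (gns_dom v1).
apply: le_trans (gns_rnorm_le (v := v) a0 d).
have -> : v = v1 + (v - v1) by rewrite addrC subrK.
rewrite rnorm_sqrD udotC hv1 // conjc0 mulr0 addr0 lerDl; exact: sqr_ge0.
Qed.

Lemma splits_BG phi phi1 : splits phi phi1 -> BG phi.
Proof.
move=> [/(cs_BG cS) h /disjoint_BG h']; have := BGD h' h.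
by under eq_fun do rewrite subrK.
Qed.

Lemma splits_unique phi phi1 phi2 : splits phi phi1 -> splits phi phi2 -> phi1 = phi2.
Proof.
move=> [S1 d1] [S2 d2].
have e : (fun g => phi1 g - phi2 g) = (fun=> 0).
  apply: disjoint_eq0; first exact: cs_B.
  have := disjoint_lin (-1) d1 d2; congr disjoint_from; apply/funext => g; ring.
apply/funext => g; apply/eqP; rewrite -subr_eq0.
by have /= -> := congr1 (fun f => f g) e.
Qed.

Lemma splits_lin c phi psi phi1 psi1 : splits phi phi1 -> splits psi psi1 ->
  splits (fun g => c * phi g + psi g) (fun g => c * phi1 g + psi1 g).
Proof.
move=> [S1 d1] [S2 d2]; split; first by case: cS => _ _ + _; apply.
have := disjoint_lin c d1 d2; congr disjoint_from; apply/funext => g; ring.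
Qed.

Lemma splits_ltr k phi phi1 : splits phi phi1 -> splits (ltr k phi) (ltr k phi1).
Proof. by move=> [S1 d1]; split; [exact: lS|exact: (disjoint_ltr k d1)]. Qed.

Lemma splits_wact x phi phi1 : Wstar x -> splits phi phi1 ->
  splits (wact x phi) (wact x phi1).
Proof.
move=> Wx sp; have [S1 d1] := sp; split; first exact: cs_wact.
have := disjoint_wact Wx d1; congr disjoint_from; apply/funext => g.
rewrite /wact -W_B //; apply: BG_ltr; [exact: splits_BG sp|exact: cs_BG S1].
Qed.

Lemma splits_self phi : S phi -> splits phi phi.
Proof.
move=> Sp; split => //; exists (fun=> 0), (@pd0 R G), 0; split => [|b _].
  by apply/funext => g; rewrite subrr.
exact: udot0l.
Qed.

(** By uniqueness the component can be computed in the very space that witnesses the ball, where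
    projecting does not increase the norm. *)
Lemma splits_ball r phi phi1 : ball_B r phi -> splits phi phi1 -> ball_B r phi1.
Proof.
move=> b sp; have r0 := ball_ge0 b; case: b => u [pu ur d].
have [|phi2 sp2 h] := splits_ex pu (phi := phi); first by exists r.
by rewrite (splits_unique sp sp2); exists u; split => //; exact: h.
Qed.

(** [phi] and [phi - psi] have the same component in [S], and components obey the same norm bound as
    the function, so this one is arbitrarily small. *)
Lemma disjoint_closed phi : BG phi ->
  (forall e, 0 < e -> exists2 psi, disjoint_from psi & ball_B e (fun g => phi g - psi g)) ->
  disjoint_from phi.
Proof.
move=> h H; have [u pu hu] := BG_inH_ex h; have [phi1 sp _] := splits_ex pu hu.
have -> : phi = (fun g => phi g - phi1 g); last by case: sp.
apply/funext => g; suff -> : phi1 g = 0 by rewrite subr0.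
apply: mod_eq0; apply/eqP; rewrite eq_le mod_ge0 andbT.
apply/ler_addgt0Pr => e e0; rewrite add0r; have [psi dpsi b] := H e e0.
apply: (@ball_pt _ _ e phi1 g); apply: splits_ball b _; split; first by case: sp.
case: sp => _ d; have := disjoint_lin (-1) dpsi d; congr disjoint_from.
by apply/funext => k; ring.
Qed.

Lemma disjoint_coef u (pu : positive_definite u) (v w : urep_space (gns pu)) :
  disjoint_from (gns_fun v) -> disjoint_from (coef v w).
Proof.
move=> dv; apply: disjoint_closed; first exact: BG_coef.
move=> e e0; have c0 := rnorm_ge0 v.
have c1 : 0 < rnorm v + 1 by rewrite ltr_wpDl.
have [s hs] := gns_dense w (divr_gt0 e0 c1).
exists (coef v (gns_kvec pu s)).
  have -> : coef v (gns_kvec pu s) =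
      (fun g => \sum_(p <- s) p.1^* * ltr p.2 (gns_fun v) g).
    by apply/funext => g; rewrite -gns_uvec coef_uvec gns_coef.
  by apply: disjoint_sum => p; exact: disjoint_ltr.
have -> : (fun g => coef v w g - coef v (gns_kvec pu s) g) =
    coef (U := gns pu) v (w - gns_kvec pu s).
  by apply/funext => g; rewrite coefBr.
apply: ball_coef_le; move: hs; rewrite ltr_pdivlMr // mulrC => /ltW; apply: le_trans.
by rewrite ler_wpM2r ?rnorm_ge0 // lerDl.
Qed.

(* The central projection p of W*(G) such that p phi is the S-component of
   phi. *)
Definition cproj : (G -> C) -> C := fun phi =>
  if `[< BG phi >] then xget (fun=> 0) [set phi1 | splits phi phi1] 1%g else 0.

Lemma cprojE phi phi1 : splits phi phi1 -> cproj phi = phi1 1%g.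
Proof.
move=> sp; rewrite /cproj asboolT; last exact: splits_BG sp.
case: xgetP => [psi _ /= sp'|/(_ phi1) //].
by rewrite (splits_unique sp sp').
Qed.

Lemma splits_exists phi : BG phi -> exists phi1, splits phi phi1.
Proof.
by move=> /BG_inH_ex[u pu h]; have [phi1 sp _] := splits_ex pu h; exists phi1.
Qed.

Lemma wact_cproj phi phi1 : splits phi phi1 -> wact cproj phi = phi1.
Proof.
move=> sp; apply/funext => g; rewrite /wact (cprojE (splits_ltr g sp)).
by rewrite /ltr mulg1.
Qed.

Lemma Wstar_cproj : Wstar cproj.
Proof.
apply: (@W_intro _ _ _ 1).
- move=> c phi psi /splits_exists[phi1 s1] /splits_exists[psi1 s2].
  by rewrite (cprojE s1) (cprojE s2) (cprojE (splits_lin c s1 s2)).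
- move=> r phi b; have [phi1 sp] := splits_exists (ball_BG b).
  by rewrite (cprojE sp) mul1r; apply: ball_pt; exact: splits_ball b sp.
- by move=> phi h; rewrite /cproj asboolF.
Qed.

Definition star phi : G -> C := fun g => (phi g^-1%g)^*.

Lemma star_coef (U : unitary_rep R G) (v w : urep_space U) :
  star (coef v w) = coef w v.
Proof.
by apply/funext => g; rewrite /star /coef -udotC udot_act.
Qed.

Lemma starK phi : star (star phi) = phi.
Proof. by apply/funext => g; rewrite /star invgK conjcK. Qed.

Lemma BG_star phi : BG phi -> BG (star phi).
Proof.
move=> /BG_inH_ex[u pu h].
by rewrite -(gns_vecK pu h) -gns_coef star_coef; exact: BG_coef.
Qed.

(** If [phi] is the coefficient of [v] against the cyclic vector [c], then [star phi] is that of [c]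
    against [v]; their components come from projecting [v] and [c]. The claim is thus the
    self-adjointness of an orthogonal projection. *)
Lemma wadj_cproj : wadj cproj = cproj.
Proof.
apply/funext => phi; change ((cproj (star phi))^* = cproj phi).
have [h|h] := pselect (BG phi); last first.
  rewrite /cproj !asboolF ?conjc0 // => /BG_star; rewrite starK.
  exact: h.
have [u pu hu] := BG_inH_ex h; pose v := gns_vec pu hu; pose c := gns_cyc pu.
have [v1 Sv1 hv1] := orthogonal_projection v (cs_subspace cS pu).
have [c1 Sc1 hc1] := orthogonal_projection c (cs_subspace cS pu).
have sp : splits phi (gns_fun v1) by split => //; exists u, pu, (v - v1).
have sp' : splits (star phi) (coef c1 v).
  rewrite -(gns_vecK pu hu) -gns_coef star_coef; split; first exact: cs_coef.
  have -> : (fun g => coef c v g - coef c1 v g) = coef (U := gns pu) (c - c1) v.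
    by apply/funext => g; rewrite coefBl.
  by apply: disjoint_coef; exists u, pu, (c - c1).
rewrite (cprojE sp) (cprojE sp') coef1 -gns_coef coef1 -udotC.
have e1 : urep_dot (gns pu) v c1 = urep_dot (gns pu) v1 c1.
  by apply/eqP; rewrite -subr_eq0 -udotBl hv1.
have e2 : urep_dot (gns pu) v1 c = urep_dot (gns pu) v1 c1.
  by apply/eqP; rewrite -subr_eq0 -udotBr udotC hc1 ?conjc0.
by rewrite e1 e2.
Qed.

Lemma central_cproj : central_projection cproj.
Proof.
split; [exact: Wstar_cproj|exact: wadj_cproj| |].
  apply/funext => phi; have [h|h] := pselect (BG phi); last first.
    by rewrite /wmul /cproj !asboolF.
  have [phi1 sp] := splits_exists h.
  have [S1 _] := sp.
  by rewrite wmulE // (wact_cproj sp) (cprojE (splits_self S1)) (cprojE sp).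
move=> x Wx; apply/funext => phi; have [h|h] := pselect (BG phi); last first.
  by rewrite /wmul !asboolF.
have [phi1 sp] := splits_exists h.
by rewrite !wmulE // (cprojE (splits_wact Wx sp)) wact1 (wact_cproj sp).
Qed.

Lemma carries_cproj phi : S phi -> carries cproj phi.
Proof.
move=> Sp x Wx; have h := cs_BG cS Sp.
rewrite wmulE // /wsub wone_ev wevE; last exact: W_BG_wact.
by rewrite (cprojE (splits_self (cs_wact cS rS Wx Sp))) subrr.
Qed.

End LebesgueDecomposition.

(** * The radical of c_00(G) *)

Section CauchyIntegral.
Variable R : realType.
Local Notation C := (R[i]).

Lemma complex_prim_root_exists n : (0 < n)%N -> exists z : C, n.-primitive_root z.
Proof.
pose p : {poly C} := 'X^n - 1; have [r Dp] := closed_field_poly_normal p.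
move=> n_gt0; rewrite (monicP _) ?monicXnsubC // scale1r in Dp.
have rn1 : all n.-unity_root r by apply/allP=> z; rewrite -root_prod_XsubC -Dp.
have sz_r : (n < (size r).+1)%N.
  by rewrite -(size_prod_XsubC r id) -Dp size_XnsubC.
have [|z] := hasP (has_prim_root n_gt0 rn1 _ sz_r); last by exists z.
by rewrite -separable_prod_XsubC -Dp separable_Xn_sub_1 // pnatr_eq0 -lt0n.
Qed.

Lemma sum_prim_root_exp n (w : C) m : n.-primitive_root w ->
  \sum_(k < n) (w ^+ k) ^+ m = if (n %| m)%N then n%:R else 0.
Proof.
move=> pw; have -> : \sum_(k < n) (w ^+ k) ^+ m = \sum_(k < n) (w ^+ m) ^+ k.
  by apply: eq_bigr => k _; rewrite -!exprM mulnC.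
rewrite (prim_order_dvd pw); have [->|wm] := eqVneq (w ^+ m) 1.
  by under eq_bigr do rewrite expr1n; rewrite sumr_const card_ord.
have := subrX1 (w ^+ m) n; rewrite -exprM mulnC exprM (prim_expr_order pw) expr1n.
by rewrite subrr => /esym/eqP; rewrite mulf_eq0 subr_eq0 (negbTE wm) => /eqP.
Qed.

(* The discretized Cauchy integral of t -> t^n over the circle of radius r. *)
Lemma discrete_cauchy n N (w r t : C) : (n < N)%N -> N.-primitive_root w ->
  r != 0 -> t ^+ N != r ^+ N ->
  N%:R^-1 * \sum_(k < N) (r * w ^+ k) ^+ n.+1 * (r * w ^+ k - t)^-1 =
  t ^+ n * (r ^+ N / (r ^+ N - t ^+ N)).
Proof.
move=> nN pw r0 tr; have N0 : (0 < N)%N by apply: leq_trans nN.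
have NC : (N%:R : C) != 0 by rewrite pnatr_eq0 -lt0n.
have d0 : r ^+ N - t ^+ N != 0 by rewrite subr_eq0 eq_sym.
have wN k : (r * w ^+ k) ^+ N = r ^+ N.
  by rewrite exprMn -exprM mulnC exprM (prim_expr_order pw) expr1n mulr1.
have inv k : (r * w ^+ k - t)^-1 =
    (\sum_(j < N) (r * w ^+ k) ^+ (N.-1 - j) * t ^+ j) / (r ^+ N - t ^+ N).
  have e := subrXX (r * w ^+ k) t N; rewrite wN in e.
  rewrite e; set S := \sum_(i < N) _; rewrite -/S in e.
  have b0 : r * w ^+ k - t != 0 by apply: contraNneq d0; rewrite e => ->; rewrite mul0r.
  have S0 : S != 0 by apply: contraNneq d0; rewrite e => ->; rewrite mulr0.
  by field; rewrite b0 S0.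
have -> : \sum_(k < N) (r * w ^+ k) ^+ n.+1 * (r * w ^+ k - t)^-1 =
   (r ^+ N - t ^+ N)^-1 * \sum_(j < N) t ^+ j * r ^+ (n.+1 + (N.-1 - j)) *
     \sum_(k < N) (w ^+ k) ^+ (n.+1 + (N.-1 - j)).
  transitivity ((r ^+ N - t ^+ N)^-1 * \sum_(k < N) \sum_(j < N)
     t ^+ j * r ^+ (n.+1 + (N.-1 - j)) * (w ^+ k) ^+ (n.+1 + (N.-1 - j))).
    rewrite mulr_sumr; apply: eq_bigr => k _.
    rewrite inv mulrA mulrC; congr (_ * _); rewrite mulr_sumr.
    by apply: eq_bigr => j _; rewrite mulrA -exprD exprMn; ring.
  congr (_ * _); rewrite exchange_big; apply: eq_bigr => j _.
  by rewrite mulr_sumr.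
(* The exponent is [N + n - j], which lies between [n + 1] and [N + n]; as [n < N], its only
   possible multiple of [N] is [N] itself. *)
have jn (j : 'I_N) : (N %| n.+1 + (N.-1 - j))%N = (val j == n).
  have jN := ltn_ord j; have -> : (n.+1 + (N.-1 - j) = N + n - j)%N by lia.
  have [jn|jn] := leqP j n.
    rewrite -addnBA // dvdn_addr // /dvdn modn_small; last by lia.
    by rewrite subn_eq0 eqn_leq jn.
  rewrite [RHS]gtn_eqF // /dvdn modn_small; last by lia.
  by apply: gtn_eqF; lia.
have z (j : 'I_N) : j != Ordinal nN -> t ^+ j * r ^+ (n.+1 + (N.-1 - j)) *
    (\sum_(k < N) (w ^+ k) ^+ (n.+1 + (N.-1 - j))) = 0.
  rewrite (sum_prim_root_exp _ pw) jn -(inj_eq val_inj) /= => /negbTE ->.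
  by rewrite mulr0.
rewrite (bigD1 (Ordinal nN)) //= (big1 _ _ _ z) addr0.
rewrite (sum_prim_root_exp _ pw) (jn (Ordinal nN)) eqxx.
have -> : (n.+1 + (N.-1 - n) = N)%N by lia.
by field; rewrite NC d0.
Qed.

Lemma geometric_small (q e : R) : 0 <= q < 1 -> 0 < e ->
  exists N0, forall N, (N0 <= N)%N -> q ^+ N < e.
Proof.
move=> /andP[q0 q1] e0.
have : `|q| < 1 by rewrite ger0_norm.
move=> /cvg_expr /cvgrPdist_lt /(_ e e0)[N0 _ H]; exists N0 => N /H /=.
by rewrite sub0r normrN ger0_norm // exprn_ge0.
Qed.

End CauchyIntegral.

(** * Spectral radius modulo finitely supported functions *)

Section Radical.
Variables (R : realType) (G : groupType).
Local Notation C := (R[i]).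
Local Notation Re := complex.Re.
Implicit Types (phi psi k f : G -> C) (e d r : R).

Definition fsupp k : Prop := finite_set [set g | k g != 0].

Lemma fsupp0 : fsupp (fun=> 0).
Proof.
rewrite /fsupp; have -> : [set g : G | (0 : C) != 0] = set0.
  by apply/seteqP; split => // g /=; rewrite eqxx.
exact: finite_set0.
Qed.

Lemma fsuppD k k' : fsupp k -> fsupp k' -> fsupp (fun g => k g + k' g).
Proof.
move=> h h'; have hu : finite_set ([set g | k g != 0] `|` [set g | k' g != 0]).
  by rewrite finite_setU.
apply: sub_finite_set hu => g /=.
have [->|k0 _] := eqVneq (k g) 0; last by left.
by rewrite add0r; right.
Qed.

Lemma fsuppM f k : fsupp k -> fsupp (fun g => f g * k g).
Proof.
apply: sub_finite_set => g /=; apply: contraNneq => ->.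
by rewrite mulr0.
Qed.

Lemma fsupp_sum (I : Type) (l : seq I) (F : I -> G -> C) :
  (forall i, fsupp (F i)) -> fsupp (fun g => \sum_(i <- l) F i g).
Proof.
move=> H; elim: l => [|i l IH].
  have -> : (fun g => \sum_(i <- [::]) F i g) = (fun=> 0).
    by apply/funext => g; rewrite big_nil.
  exact: fsupp0.
have -> : (fun g => \sum_(j <- i :: l) F j g) = (fun g => F i g + \sum_(j <- l) F j g).
  by apply/funext => g; rewrite big_cons.
exact: fsuppD.
Qed.

Lemma fsupp_rtr x k : fsupp k -> fsupp (rtr x k).
Proof.
move=> h; apply: sub_finite_set (finite_image (fun g => g * x^-1)%g h) => g /= hg.
by exists (g * x)%g => //; rewrite mulgK.
Qed.

Lemma fsupp_ltr x k : fsupp k -> fsupp (ltr x k).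
Proof.
move=> h; apply: sub_finite_set (finite_image (fun g => x^-1 * g)%g h) => g /= hg.
by exists (x * g)%g => //; rewrite mulKg.
Qed.

(* The spectral radius of phi modulo the finitely supported functions is at
   most e. *)
Definition srad_le e phi : Prop :=
  exists2 M, 0 < M & forall n, exists2 k, fsupp k &
    ball_B (M * e ^+ n) (fun g => phi g ^+ n - k g).

Lemma srad_le_mono e e' phi : 0 <= e -> e <= e' -> srad_le e phi -> srad_le e' phi.
Proof.
move=> e0 ee [M M0 H]; exists M => // n; have [k fk b] := H n; exists k => //.
apply: ball_le b; rewrite ler_pM2l //; apply: lerXn2r => //; rewrite nnegrE //.
exact: le_trans ee.
Qed.

Lemma srad_le_ball e phi : ball_B e phi -> srad_le e phi.
Proof.
move=> b; exists 1 => // n; exists (fun=> 0); first exact: fsupp0.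
rewrite mul1r; have := ballX n b; congr ball_B; apply/funext => g.
by rewrite subr0.
Qed.

Lemma srad_leZ c e phi : srad_le e phi -> srad_le (modulus c * e) (fun g => c * phi g).
Proof.
move=> [M M0 H]; exists M => // n; have [k fk b] := H n.
exists (fun g => c ^+ n * k g); first exact: fsuppM.
have -> : (fun g => (c * phi g) ^+ n - c ^+ n * k g) =
    (fun g => c ^+ n * (phi g ^+ n - k g)).
  by apply/funext => g; rewrite exprMn mulrBr.
have -> : M * (modulus c * e) ^+ n = modulus (c ^+ n) * (M * e ^+ n).
  by rewrite modX exprMn; ring.
exact: ballZ.
Qed.

(** Subadditivity of the spectral radius in a commutative algebra: the estimates multiply in each
    binomial term, and the binomial theorem reassembles [(e + d) ^+ n]. *)
Lemma srad_leD e d phi psi : srad_le e phi -> srad_le d psi ->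
  srad_le (e + d) (fun g => phi g + psi g).
Proof.
move=> [M M0 H] [M' M'0 H']; exists (M * M'); first exact: mulr_gt0.
have /choice[k Hk] n : exists k, fsupp k /\ ball_B (M * e ^+ n) (fun g => phi g ^+ n - k g).
  by have [k] := H n; exists k.
have /choice[k' Hk'] n : exists k, fsupp k /\ ball_B (M' * d ^+ n) (fun g => psi g ^+ n - k g).
  by have [k0] := H' n; exists k0.
move=> n; pose c (i : 'I_n.+1) : C := 'C(n, i)%:R.
(* Chosen so that phi^(n-i) psi^i - K_i factors as (phi^(n-i) - k_(n-i)) (psi^i - k'_i), while K_i
   has finite support. *)
pose K (i : 'I_n.+1) g := phi g ^+ (n - i) * k' i g + (psi g ^+ i - k' i g) * k (n - i)%N g.
exists (fun g => \sum_(i < n.+1) c i * K i g).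
  apply: fsupp_sum => i; apply: fsuppM; apply: fsuppD; apply: fsuppM.
    by case: (Hk' i).
  by case: (Hk (n - i)%N).
have -> : (fun g => (phi g + psi g) ^+ n - \sum_(i < n.+1) c i * K i g) =
    (fun g => \sum_(i < n.+1) c i *
       ((phi g ^+ (n - i) - k (n - i)%N g) * (psi g ^+ i - k' i g))).
  apply/funext => g; rewrite exprDn -sumrB; apply: eq_bigr => i _.
  by rewrite -mulr_natl /K /c; ring.
have -> : M * M' * (e + d) ^+ n = \sum_(i < n.+1) modulus (c i) *
    ((M * e ^+ (n - i)) * (M' * d ^+ i)).
  rewrite exprDn mulr_sumr; apply: eq_bigr => i _.
  have -> : modulus (c i) = 'C(n, i)%:R.
    by rewrite /c -(rmorph_nat (real_complex R)) mod_pos // ler0n.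
  by rewrite -mulr_natl; ring.
apply: ball_sum => i; apply: ballZ; apply: ballM.
  by case: (Hk (n - i)%N).
by case: (Hk' i).
Qed.

Definition rad phi : Prop := BG phi /\ forall e, 0 < e -> srad_le e phi.

(** Sums and limits both reduce to [srad_leD], since the spectral radius is at most the norm. *)
Lemma rad_closed : closed_subspace rad.
Proof.
have Dl c phi psi : rad phi -> rad psi -> rad (fun g => c * phi g + psi g).
  move=> [h H] [h' H']; split; first exact: BG_lin.
  move=> e e0; have m0 := mod_ge0 c.
  have m1 : 0 < modulus c + 1 by rewrite ltr_wpDl.
  have e1 : 0 < e / (modulus c + 1) / 2 by rewrite !divr_gt0.
  have e2 : 0 < e / 2 by rewrite divr_gt0.
  apply: srad_le_mono (srad_leD (srad_leZ c (H _ e1)) (H' _ e2)).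
    by apply: addr_ge0; [apply: mulr_ge0 => //; exact: ltW|exact: ltW].
  rewrite [leRHS]splitr lerD2r !mulrA ler_pM2r ?invr_gt0 // ler_pdivrMr //.
  by rewrite mulrC ler_pM2l // lerDl.
split; [by move=> phi []| |exact: Dl|].
  split; first exact: BG_fun0.
  move=> e e0; apply: srad_le_ball; apply: ball_fun0; exact: ltW.
move=> phi h H; split => // e e0; have e2 : 0 < e / 2 by rewrite divr_gt0.
have [psi [_ Hp] b] := H _ e2; have := srad_leD (Hp _ e2) (srad_le_ball b).
rewrite -splitr; congr srad_le; apply/funext => g; ring.
Qed.

Lemma rad_rtr : rinvariant rad.
Proof.
move=> x phi [h H]; split; first exact: BG_rtr.
move=> e /H[M M0 H']; exists M => // n; have [k fk b] := H' n.
by exists (rtr x k); [exact: fsupp_rtr|exact: (ball_rtr x b)].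
Qed.

Lemma rad_ltr : linvariant rad.
Proof.
move=> x phi [h H]; split; first exact: BG_ltr.
move=> e /H[M M0 H']; exists M => // n; have [k fk b] := H' n.
by exists (ltr x k); [exact: fsupp_ltr|exact: (ball_ltr x b)].
Qed.

Lemma avoid_finite (l : seq R) a b : a < b ->
  exists a' b', [/\ a <= a', a' < b', b' <= b & forall y, y \in l -> ~~ (a' < y < b')].
Proof.
move=> ab; elim: l => [|h l [a' [b' [h1 h2 h3 h4]]]].
  by exists a, b; split.
pose m := (a' + b') / 2.
have am : a' < m by rewrite /m; lra.
have mb : m < b' by rewrite /m; lra.
have [hm|hm] := leP h m.
  exists m, b'; split => //; first by apply: le_trans h1 _; exact: ltW.
  move=> y; rewrite inE => /orP[/eqP ->|yl]; first by rewrite ltNge hm.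
  apply: contra (h4 y yl) => /andP[k1 k2]; apply/andP; split => //.
  exact: lt_trans k1.
exists a', m; split => //; first by apply: le_trans h3; exact: ltW.
move=> y; rewrite inE => /orP[/eqP ->|yl].
  by rewrite negb_and -!leNgt (ltW hm) orbT.
apply: contra (h4 y yl) => /andP[k1 k2]; apply/andP; split => //.
exact: lt_trans mb.
Qed.

Definition resolvent f (l : C) : G -> C := fun x => (f x - l)^-1.

Section Circle.
Variables (f : G -> C) (r d : R).
Hypotheses (r0 : 0 < r) (d0 : 0 < d).
Hypothesis gap : forall x, d <= `|modulus (f x) - r|.
Hypothesis res : forall l, modulus l = r -> BG (resolvent f l).

Lemma circle_dist l x : modulus l = r -> d <= modulus (f x - l).
Proof.
move=> lr; apply: le_trans (gap x) _; rewrite -lr ler_norml.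
have h1 := modD (f x - l) l; have h2 := modD (l - f x) (f x).
rewrite !subrK (mod_dist l) in h1 h2.
by apply/andP; split; lra.
Qed.

Lemma resolvent_neq0 l x : modulus l = r -> f x - l != 0.
Proof.
move=> lr; apply: contraTneq (circle_dist x lr) => ->.
by rewrite mod0 -ltNge.
Qed.

(** The resolvent identity R_l = R_l0 + (l - l0) R_l0 R_l turns a bound 2c + X for R_l into 2c +
    X/2. Iterating it from any a priori bound c' leaves an excess below c, whence the factor 3. *)
Lemma resolvent_local l0 c : 0 < c -> modulus l0 = r -> ball_B c (resolvent f l0) ->
  forall l, modulus l = r -> modulus (l - l0) <= (2 * c)^-1 ->
  ball_B (3 * c) (resolvent f l).
Proof.
move=> c0 l0r b l lr ll; have [c' b'] := BG_ball (res lr).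
have iter n : ball_B (2 * c + c' / 2 ^+ n) (resolvent f l).
  elim: n => [|n IH].
    by rewrite expr0 divr1; apply: ball_le b'; rewrite lerDr mulr_ge0 // ltW.
  have := ballD b (ballZ (l - l0) (ballM b IH)).
  have -> : (fun g => resolvent f l0 g + (l - l0) * (resolvent f l0 g * resolvent f l g)) =
      resolvent f l.
    apply/funext => x; rewrite /resolvent.
    by field; rewrite !resolvent_neq0.
  apply: ball_le; have c'0 := ball_ge0 b'.
  have p0 : 0 <= 2 * c + c' / 2 ^+ n.
    by rewrite addr_ge0 ?mulr_ge0 ?invr_ge0 ?exprn_ge0 // ltW.
  apply: (@le_trans _ _ (c + (2 * c)^-1 * (c * (2 * c + c' / 2 ^+ n)))).
    by rewrite lerD2l ler_wpM2r // mulr_ge0 // ltW.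
  have E X : c + (2 * c)^-1 * (c * (2 * c + X)) = 2 * c + X / 2.
    by field; rewrite gt_eqF.
  rewrite E.
  by rewrite exprSr invfM mulrA.
have c'0 := ball_ge0 b'; have c1 : 0 < c' + 1 by rewrite ltr_wpDl.
have half : 0 <= (2^-1 : R) < 1 by apply/andP; split; lra.
have [N0 HN] := geometric_small half (divr_gt0 c0 c1).
apply: ball_le (iter N0); have := HN N0 (leqnn _); rewrite exprVn => h.
have -> : 3 * c = 2 * c + c by ring.
rewrite lerD2l; apply: (@le_trans _ _ (c' * (c / (c' + 1)))).
  by rewrite ler_wpM2l // ltW.
rewrite mulrCA ler_piMr ?ltW // ltr_pdivrMr //; lra.
Qed.

(** Compactness of the circle: points whose resolvents have unbounded norms would accumulate at some
    [l0], against the local bound there. *)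
Lemma resolvent_bounded : exists2 M, 0 < M & forall l, modulus l = r -> ball_B M (resolvent f l).
Proof.
apply: contrapT => N.
have /choice[l Hl] (n : nat) : exists l, modulus l = r /\ ~ ball_B n.+1%:R (resolvent f l).
  apply: contrapT => N'; apply: N; exists n.+1%:R => // l lr.
  by apply: contrapT => b; apply: N'; exists l.
have [U [UF oU]] := ultraFilterLemma (F := \oo) _.
have PU : ProperFilter U by exact: ultra_proper.
have [l0 ll0] : exists l0, fcvg U l l0.
  by apply: (@ultra_limit _ _ _ _ r) => n; case: (Hl n) => ->.
have l0r : modulus l0 = r.
  have h : fcvg U (fun i => l i * (l i)^*) (l0 * l0^*).
    by apply: fcvgM => //; exact: fcvgJ.
  have h' : fcvg U (fun i => l i * (l i)^*) (r ^+ 2)%:C.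
    have -> : (fun i => l i * (l i)^*) = (fun=> (r ^+ 2)%:C).
      by apply/funext => i; rewrite -mod_sqrC; case: (Hl i) => ->.
    exact: fcvg_cst.
  have h2 : (modulus l0 ^+ 2)%:C = (r ^+ 2)%:C.
    by rewrite mod_sqrC; exact: (fcvg_unique h h').
  have /eqP := complexI h2.
  by rewrite eqrXn2 ?mod_ge0 ?ltW // => /eqP.
have [c b] := BG_ball (res l0r); have c0 := ball_ge0 b.
have c1 : 0 < c + 1 by rewrite ltr_wpDl.
have b1 : ball_B (c + 1) (resolvent f l0) by apply: ball_le b; rewrite lerDl.
have p0 : 0 < (2 * (c + 1))^-1 by rewrite invr_gt0 mulr_gt0.
have q0 : 0 < (3 * (c + 1))^-1 by rewrite invr_gt0 mulr_gt0.
have [n /= [h1 h2]] := filter_ex (filterI (ll0 _ p0) (oU _ (inv_small q0))).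
have [lr] := Hl n; apply; apply: ball_le (resolvent_local c1 l0r b1 lr (ltW h1)).
by move: h2; rewrite ltf_pV2 ?posrE ?mulr_gt0 // => /ltW.
Qed.

(** The Riemann sums of the Cauchy integral stay in one ball and converge pointwise, and balls are
    closed under pointwise limits. *)
Lemma fsupp_circle : finite_set [set x | r < modulus (f x)] -> srad_le r f.
Proof.
move=> fin; have [M M0 HM] := resolvent_bounded.
(* The extra factor [r] comes from the exponent [n + 1] in the discretized integral. *)
exists (M * r); first exact: mulr_gt0.
move=> n; exists (fun x => if r < modulus (f x) then f x ^+ n else 0).
  by apply: sub_finite_set fin => x /=; case: ifP => //; rewrite eqxx.
have rC : (r%:C : C) != 0 by rewrite (inj_eq (@complexI R)) gt_eqF.
pose lim x := f x ^+ n - (if r < modulus (f x) then f x ^+ n else 0).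
have /choice[w Hw] (j : nat) : exists w : C, (j + n).+1.-primitive_root w.
  exact: complex_prim_root_exists.
(* The sign is there because [resolvent f l] inverts [f - l] and not [l - f]; [(j + n).+1] nodes
   ensure that [n] is below their number. *)
pose F j x := \sum_(k < (j + n).+1) ((j + n).+1%:R^-1 * - (r%:C * w j ^+ k) ^+ n.+1) *
   resolvent f (r%:C * w j ^+ k) x.
have wr j (k : nat) : modulus (r%:C * w j ^+ k) = r.
  rewrite modM mod_pos ?ltW // modX.
  have -> : modulus (w j) = 1.
    apply/eqP; rewrite -(@pexpr_eq1 _ _ (j + n).+1) ?mod_ge0 //.
    by rewrite -modX (prim_expr_order (Hw j)) mod1.
  by rewrite expr1n mulr1.
apply: (@ball_pointwise_limit _ _ _ lim F) => [j|x].
  have -> : M * r * r ^+ n = \sum_(k < (j + n).+1)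
      modulus ((j + n).+1%:R^-1 * - (r%:C * w j ^+ k) ^+ n.+1) * M.
    under eq_bigr do rewrite modM modN modX wr modV.
    rewrite sumr_const card_ord -(rmorph_nat (real_complex R)) mod_pos ?ler0n //.
    by rewrite -[RHS]mulr_natl !mulrA mulfV ?pnatr_eq0 // mul1r exprS; ring.
  by apply: ball_sum => k; apply: ballZ; exact: HM.
pose t := f x; pose N j := (j + n).+1.
have mt : modulus t != r.
  by apply: contraTneq (gap x) => e; rewrite -/t e subrr normr0 -ltNge.
have tN j : t ^+ N j != r%:C ^+ N j.
  apply: contra mt => /eqP /(congr1 (@modulus R)); rewrite !modX mod_pos ?ltW // => /eqP.
  by rewrite eqrXn2 ?mod_ge0 ?ltW.
have FE j : F j x = t ^+ n * (r%:C ^+ N j / (r%:C ^+ N j - t ^+ N j)).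
  rewrite -(discrete_cauchy (n := n) _ (Hw j) rC (tN j)) /F; last by rewrite ltnS leq_addl.
  rewrite mulr_sumr; apply: eq_bigr => k _; rewrite -mulrA; congr (_ * _).
  by rewrite mulNr -mulrN /resolvent -invrN opprB.
have m0 := mod_ge0 t.
(* q < 1 is the ratio of the smaller to the larger of |t| and r. *)
have key (q : R) : 0 <= q < 1 ->
    (forall j, modulus (F j x - lim x) <= modulus t ^+ n * (q ^+ N j / (1 - q))) ->
    fcvg \oo (F ^~ x) (lim x).
  move=> q01 H e e0; have [q0 q1] := andP q01.
  have c0 : 0 < modulus t ^+ n + 1 by rewrite ltr_wpDl // exprn_ge0.
  have e1 : 0 < e / (modulus t ^+ n + 1) * (1 - q) by rewrite mulr_gt0 ?divr_gt0 // subr_gt0.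
  have [N0 HN] := geometric_small q01 e1.
  exists N0 => // j /= Nj; apply: le_lt_trans (H j) _.
  have h : q ^+ N j < e / (modulus t ^+ n + 1) * (1 - q).
    by apply: HN; rewrite /N; lia.
  rewrite -ltr_pdivrMr ?subr_gt0 // in h.
  apply: (@le_lt_trans _ _ ((modulus t ^+ n + 1) * (q ^+ N j / (1 - q)))).
    by rewrite ler_wpM2r ?lerDl // divr_ge0 ?exprn_ge0 // subr_ge0 ltW.
  by rewrite mulrC -ltr_pdivlMr.
have low (q : C) j : modulus q < 1 -> 1 - modulus q <= modulus (1 - q ^+ N j).
  move=> q1; apply: (@le_trans _ _ (1 - modulus (q ^+ N j))).
    rewrite lerD2l lerN2 modX /N exprS ler_piMr ?mod_ge0 //.
    by rewrite exprn_ile1 ?mod_ge0 // ltW.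
  by have := modD (1 - q ^+ N j) (q ^+ N j); rewrite subrK mod1; lra.
have [rt|tr] := ltP r (modulus t).
  have t0 : t != 0 by apply: contraTneq rt => ->; rewrite mod0 -leNgt ltW.
  have tp : 0 < modulus t by exact: mod_gt0.
  have qm : modulus (r%:C / t) = r / modulus t by rewrite modM modV mod_pos // ltW.
  have q1 : modulus (r%:C / t) < 1 by rewrite qm ltr_pdivrMr // mul1r.
  apply: (key (modulus (r%:C / t))); first by rewrite mod_ge0.
  move=> j; rewrite FE /lim -/t rt subrr subr0 modM modX ler_wpM2l ?exprn_ge0 //.
  have -> : r%:C ^+ N j / (r%:C ^+ N j - t ^+ N j) =
      - ((r%:C / t) ^+ N j / (1 - (r%:C / t) ^+ N j)).
    rewrite exprMn exprVn; have tn : t ^+ N j != 0 by rewrite expf_neq0.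
    have dn : r%:C ^+ N j - t ^+ N j != 0 by rewrite subr_eq0 eq_sym.
    have dn' : t ^+ N j - r%:C ^+ N j != 0 by rewrite subr_eq0.
    by field; rewrite dn tn dn'.
  rewrite modN [modulus (_ ^+ N j / _)]modM modX modV ler_wpM2l ?exprn_ge0 ?mod_ge0 //.
  rewrite lef_pV2 ?posrE; [exact: low|by apply: lt_le_trans (low _ j q1); rewrite subr_gt0|].
  by rewrite subr_gt0.
have {}tr : modulus t < r by rewrite lt_neqAle mt.
have qm : modulus (t / r%:C) = modulus t / r by rewrite modM modV mod_pos // ltW.
have q1 : modulus (t / r%:C) < 1 by rewrite qm ltr_pdivrMr // mul1r.
apply: (key (modulus (t / r%:C))); first by rewrite mod_ge0.
move=> j; rewrite FE /lim -/t ltNge (ltW tr) /= subr0.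
rewrite -{2}[t ^+ n]mulr1 -mulrBr [modulus (t ^+ n * _)]modM modX ler_wpM2l ?exprn_ge0 //.
have -> : r%:C ^+ N j / (r%:C ^+ N j - t ^+ N j) - 1 =
    (t / r%:C) ^+ N j / (1 - (t / r%:C) ^+ N j).
  rewrite exprMn exprVn; have rn : r%:C ^+ N j != 0 by rewrite expf_neq0.
  have dn : r%:C ^+ N j - t ^+ N j != 0 by rewrite subr_eq0 eq_sym.
  by field; rewrite dn rn.
rewrite [modulus (_ ^+ N j / _)]modM modX modV ler_wpM2l ?exprn_ge0 ?mod_ge0 //.
rewrite lef_pV2 ?posrE; [exact: low|by apply: lt_le_trans (low _ j q1); rewrite subr_gt0|].
by rewrite subr_gt0.
Qed.

End Circle.

Lemma rad_B0_NS f : (@B0G R G `&` @NSG R G) f -> rad f.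
Proof.
move=> [[hf c0] [_ sp]]; split => // e e0.
have e2 : 0 < e / 2 by rewrite divr_gt0.
have fin := c0 _ e2.
have [l hl] := (finite_seqP _).1 (finite_image (fun x => modulus (f x)) fin).
(* Only finitely many values of |f| are at least e/2, so some annulus between radii e/2 and e avoids
   them all; the circle is put in its middle. *)
have [|a [b [h1 h2 h3 h4]]] := @avoid_finite l (e / 2) e; first by lra.
pose r := (a + b) / 2; pose d := (b - a) / 2.
have r0 : 0 < r by rewrite /r; lra.
have d0 : 0 < d by rewrite /d; lra.
have gap x : d <= `|modulus (f x) - r|.
  have [big|small] := leP (e / 2) (modulus (f x)).
    have hx : modulus (f x) \in l.
      have : [set` l] (modulus (f x)) by rewrite -hl /=; exists x.
      by [].
    have := h4 _ hx; rewrite negb_and -!leNgt => /orP[k|k].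
      by rewrite distrC; apply: le_trans (ler_norm _); rewrite /r /d; lra.
    by apply: le_trans (ler_norm _); rewrite /r /d; lra.
  by rewrite distrC; apply: le_trans (ler_norm _); rewrite /r /d; lra.
apply: (@srad_le_mono r); [exact: ltW|by rewrite /r; lra|].
apply: (fsupp_circle r0 d0 gap); last first.
  by apply: sub_finite_set fin => x /= hx; apply: le_trans (ltW hx); rewrite /r; lra.
move=> l1 lr.
(* A point of the circle is at distance at least [d] from f(G), hence outside its closure, which is
   the spectrum by hypothesis. *)
have nsp : ~ spectrum f l1.
  rewrite sp => cl; have dc : 0 < d%:C :> C by rewrite ltcR.
  have [_ /= [[x _ <-]]] := cl _ (nbhsx_ballx (l1 : R[i]^o) _ dc).
  rewrite -ball_normE /= modC ltcR mod_dist => hx.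
  have := circle_dist gap x lr.
  by rewrite leNgt hx.
have [h hB hh] : exists2 h, BG h & forall g, (f g - l1) * h g = 1.
  by apply: contrapT.
have -> : resolvent f l1 = h; last by [].
apply/funext => x; rewrite /resolvent.
by apply: (mulfI (resolvent_neq0 d0 gap x lr)); rewrite hh mulfV // (resolvent_neq0 d0 gap x lr).
Qed.

End Radical.

(** * Central supports and faithful states *)

Section CentralSupports.
Variables (R : realType) (G : groupType).
Local Notation C := (R[i]).
Local Notation Re := complex.Re.
Implicit Types (phi psi u : G -> C) (z w : (G -> C) -> C) (k : G).

Section OneProjection.
Variable z : (G -> C) -> C.
Hypothesis cz : central_projection z.

Lemma central_Wstar : Wstar z. Proof. by case: cz. Qed.

(** Centrality tested on the evaluation at [k], which acts by right translation. *)
Lemma central_tr k phi : BG phi -> z (rtr k phi) = z (ltr k phi).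
Proof.
case: cz => Wz _ _ comm h; have := congr1 (fun y => y phi) (comm _ (@Wstar_ev R G k)).
by rewrite /= !wmulE // wact_ev // wevE //; exact: W_BG_wact.
Qed.

(** The range of the action of [z], that is [wact z phi = phi]. *)
Definition fixed phi : Prop := BG phi /\ forall k, z (ltr k phi) = phi k.

Lemma fixed_closed : closed_subspace fixed.
Proof.
have Wz := central_Wstar; split; first by move=> phi [].
- by split; [exact: BG_fun0|move=> k; exact: W_0].
- move=> c phi psi [h H] [h' H']; split; first exact: BG_lin.
  by move=> k; rewrite -H -H' -W_lin //; exact: BG_ltr.
move=> phi h H; split => // k.
have [M M0 HM] := W_bound Wz.
apply/eqP; rewrite -subr_eq0; apply/eqP; apply: mod_eq0; apply/eqP.
rewrite eq_le mod_ge0 andbT; apply/ler_addgt0Pr => e e0; rewrite add0r.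
have M1 : 0 < M + 1 by rewrite ltr_wpDl.
have [psi [hp Hp] b] := H _ (divr_gt0 e0 M1).
have -> : z (ltr k phi) - phi k = z (ltr k (fun g => phi g - psi g)) - (phi k - psi k).
  have -> : z (ltr k (fun g => phi g - psi g)) = z (ltr k phi) - z (ltr k psi).
    by rewrite -W_B //; exact: BG_ltr.
  by rewrite Hp; ring.
apply: le_trans (modD _ _) _; rewrite modN.
have h1 := HM _ _ (ball_ltr k b); have h2 := ball_pt k b.
have -> : e = M * (e / (M + 1)) + e / (M + 1) by field; rewrite gt_eqF.
by rewrite lerD.
Qed.

Lemma fixed_linv : linvariant fixed.
Proof.
move=> m phi [h H]; split; first exact: BG_ltr.
by move=> k; rewrite ltrM H.
Qed.

Lemma fixed_rinv : rinvariant fixed.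
Proof.
move=> m phi [h H]; split; first exact: BG_rtr.
by move=> k; rewrite ltr_rtr central_tr ?ltrM ?H //; exact: BG_ltr.
Qed.

Lemma fixed_carries phi : BG phi -> carries z phi -> fixed phi.
Proof.
move=> h cr; split => // k; have := cr _ (@Wstar_ev R G k).
rewrite wmulE // wact_ev // /wsub wone_ev wevE; last exact: BG_rtr.
by rewrite central_tr // /rtr mul1g => /eqP; rewrite subr_eq0 => /eqP.
Qed.

Lemma fixed_wact phi : fixed phi -> wact z phi = phi.
Proof. by move=> [_ H]; apply/funext => k; exact: H. Qed.

Lemma fixed_1 phi : fixed phi -> z phi = phi 1%g.
Proof. by move=> [_ /(_ 1%g)]; rewrite ltr1. Qed.

Lemma central_idem phi : BG phi -> wact z (wact z phi) = wact z phi.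
Proof.
move=> h; case: cz => Wz _ idem _; apply/funext => k.
change (z (ltr k (wact z phi)) = z (ltr k phi)).
by rewrite ltr_wact -wmulE ?idem //; exact: BG_ltr.
Qed.

Lemma central_star phi : z (star phi) = (z phi)^*.
Proof.
case: cz => _ adj _ _; have := congr1 (fun y => y phi) adj.
by rewrite /wadj /= => <-; rewrite conjcK.
Qed.

(** On each kernel space [z] acts as a self-adjoint idempotent, hence as a contraction. The constant
    1 is what makes later estimates uniform over varying projections. *)
Lemma central_contraction r phi : ball_B r phi -> modulus (z phi) <= r.
Proof.
move=> b; have r0 := ball_ge0 b; case: b => u [pu ur d].
have h : inH (gk u) phi by exists r.
have Wz := central_Wstar; pose v := gns_vec pu h; pose zv := wvec Wz v.
have zz : wvec Wz zv = zv.
  by apply: gns_fun_inj; apply: central_idem; exact: BG_inH (gns_fun_inH v).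
have adj : urep_dot (gns pu) zv zv = urep_dot (gns pu) zv v.
  have e1 : urep_dot (gns pu) zv v = z (coef zv v) by rewrite -{1}zz wvec_dot.
  have e2 : urep_dot (gns pu) zv zv = z (coef v zv) by exact: wvec_dot.
  by rewrite e1 -(star_coef v zv) central_star -e2 -udotC.
have le : rnorm zv <= rnorm v.
  have [e|e] := eqVneq (rnorm zv) 0; first by rewrite e rnorm_ge0.
  have p : 0 < rnorm zv by rewrite lt_def e rnorm_ge0.
  rewrite -(ler_pM2l p) -expr2 rnorm_sqrE adj.
  exact: le_trans (Re_le_mod _) (udot_CS _ _).
have -> : z phi = urep_dot (gns pu) zv (gns_cyc pu).
  by rewrite wvec_dot gns_coef.
apply: le_trans (udot_CS _ _) _; apply: (sqr_le_pos r0).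
rewrite exprMn rnorm_cyc [r ^+ 2]expr2; apply: ler_pM; rewrite ?sqr_ge0 //.
  exact: pd1_Re.
apply: le_trans (gns_rnorm_le (v := v) r0 d).
by rewrite ler_pXn2r ?nnegrE ?rnorm_ge0.
Qed.

End OneProjection.

(** Kernel combinations are sums of right translates of [u], and they are dense in the kernel
    space. *)
Lemma cs_inH S u phi (pu : positive_definite u) : closed_subspace S -> rinvariant S ->
  S u -> inH (gk u) phi -> S phi.
Proof.
move=> cS rS Su h; case: (cS) => _ _ _ Scl; apply: Scl; first exact: BG_inH h.
pose v := gns_vec pu h.
move=> e e0; have c0 := rnorm_ge0 (gns_cyc pu).
have c1 : 0 < rnorm (gns_cyc pu) + 1 by rewrite ltr_wpDl.
have [s hs] := gns_dense v (divr_gt0 e0 c1).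
exists (gns_fun (gns_kvec pu s)).
  have -> : gns_fun (gns_kvec pu s) =
      (fun g => \sum_(p <- s) p.1 * rtr (p.2^-1)%g u g) by [].
  by apply: (cs_sum cS) => p; exact: rS.
have -> : (fun g => phi g - gns_fun (gns_kvec pu s) g) =
    coef (U := gns pu) (v - gns_kvec pu s) (gns_cyc pu).
  by rewrite gns_coef.
apply: ball_coef_le; move: hs; rewrite ltr_pdivlMr // => /ltW; apply: le_trans.
by rewrite ler_wpM2l ?rnorm_ge0 // lerDl.
Qed.

Lemma BG_closed : closed_subspace (@BG R G).
Proof. by split => //; [exact: BG_fun0|exact: BG_lin]. Qed.

Definition bispan (g : G -> C) : set (G -> C) := [set phi | forall S, closed_subspace S ->
  rinvariant S -> linvariant S -> S g -> S phi].

Lemma bispan_self (g : G -> C) : bispan g g. Proof. by []. Qed.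

Lemma bispan_closed (g : G -> C) : BG g -> closed_subspace (bispan g).
Proof.
move=> h; split.
- by move=> phi; apply; [exact: BG_closed|exact: BG_rtr|exact: BG_ltr|].
- by move=> S [_ S0 _ _].
- move=> c phi psi H H' S cS rS lS Sg; have [_ _ Slin _] := cS.
  by apply: Slin; [exact: (H S)|exact: (H' S)].
move=> phi hp H S cS rS lS Sg; have [_ _ _ Scl] := cS; apply: Scl => // e e0.
by have [psi Hpsi b] := H e e0; exists psi => //; exact: (Hpsi S).
Qed.

Lemma bispan_rinv (g : G -> C) : rinvariant (bispan g).
Proof. by move=> k phi H S cS rS lS Sg; exact: (rS _ _ (H S cS rS lS Sg)). Qed.

Lemma bispan_linv (g : G -> C) : linvariant (bispan g).
Proof. by move=> k phi H S cS rS lS Sg; exact: (lS _ _ (H S cS rS lS Sg)). Qed.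

(** Minimality: if a central projection [w] carries [g], the functions it fixes form a closed
    bi-invariant subspace containing [g], hence containing [bispan g]. *)
Lemma central_support_bispan (g : G -> C) : BG g -> is_central_support g (cproj (bispan g)).
Proof.
move=> h; have cS := bispan_closed h.
have rS := @bispan_rinv g; have lS := @bispan_linv g.
split; [exact: central_cproj|by apply: carries_cproj => //; exact: bispan_self|].
move=> w cw carw; have Ww := central_Wstar cw.
apply/funext => phi; have [hp|hp] := pselect (BG phi); last first.
  by rewrite /wmul /cproj !asboolF.
have [phi1 sp] := splits_exists cS hp.
rewrite wmulE // (cprojE cS lS (splits_wact cS rS Ww sp)) (cprojE cS lS sp) wact1.
have [S1 _] := sp; apply: (fixed_1 (z := w)).
apply: S1; [exact: fixed_closed|exact: fixed_rinv|exact: fixed_linv|].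
exact: fixed_carries.
Qed.

Lemma fsupp_sumE (K : G -> C) : fsupp K ->
  exists l : seq G, K = (fun g => \sum_(x <- l) K x * rtr x^-1%g (@delta_e R G) g).
Proof.
move=> /finite_seqP[l hl]; exists (undup l); apply/funext => g.
have e (x : G) : rtr x^-1%g (@delta_e R G) g = (g == x)%:R.
  by rewrite /rtr /delta_e divg_eq1.
under eq_bigr do rewrite e.
have [gl|gl] := boolP (g \in l).
  rewrite (bigD1_seq g) ?undup_uniq ?mem_undup //= eqxx mulr1 big1 ?addr0 // => x xg.
  by rewrite eq_sym (negbTE xg) mulr0.
have -> : K g = 0.
  apply/eqP; apply: contraNT gl => Kg.
  have : [set` l] g by rewrite -hl.
  by [].
rewrite big_seq big1 // => x; rewrite mem_undup => xl.
by rewrite (negbTE (_ : g != x)) ?mulr0 //; apply: contraNneq gl => ->.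
Qed.

(** [w] fixes [delta_e], so it fixes the span of its translates, to which [K] belongs; therefore
    z(K) = (z w)(K) = 0. *)
Lemma singular_fsupp z w K : central_projection z -> central_projection w ->
  carries w (@delta_e R G) -> wmul z w = (fun=> 0) -> fsupp K -> BG K /\ z K = 0.
Proof.
move=> cz cw cr zw fK.
have fd : fixed w (@delta_e R G) by apply: fixed_carries => //; apply: BG_pd; exact: pd_delta.
have fw : fixed w K.
  have [l ->] := fsupp_sumE fK; apply: (cs_sum (fixed_closed cw)) => x.
  exact: fixed_rinv.
have hK : BG K by case: fw.
split => //; have := congr1 (fun y => y K) zw.
by rewrite /= wmulE // fixed_wact.
Qed.

End CentralSupports.

(** * Faithful vectors and the commutant *)

Section Faithful.
Variables (R : realType) (G : groupType) (U : unitary_rep R G) (xi : urep_space U).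
Local Notation C := (R[i]).
Local Notation Re := complex.Re.
Local Notation H := (urep_space U).
Local Notation "''[' v , w ]" := (urep_dot U v w).
Local Notation M' := (commutant (range (fun a : {fsfun G -> C with 0} => rep_ext (U := U) a))).

Lemma linear_funB (T : H -> H) v w : linear T -> T (v - w) = T v - T w.
Proof. by move=> Tl; rewrite addrC -scaleN1r Tl scaleN1r addrC. Qed.

Lemma linear_fun0 (T : H -> H) : linear T -> T 0 = 0.
Proof. by move=> Tl; rewrite -(subrr 0) linear_funB // !subrr. Qed.

Lemma operator_bounded (T : H -> H) : bounded_operator T ->
  exists2 M, 0 <= M & forall v, rnorm (T v) <= M * rnorm v.
Proof.
move=> [Tl Tc].
have T0 := linear_fun0 Tl.
have TZ c v : T (c *: v) = c *: T v by have := Tl c v 0; rewrite !addr0 T0 addr0.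
have [d d0 hd] : exists2 d, 0 < d & forall v, rnorm v < d -> rnorm (T v) < 1.
  have /cvgrPdist_lt /(_ 1 ltr01) /nbhs_ballP[d /= d0 hd] := Tc 0.
  rewrite T0 in hd.
  have rd : 0 < Re d by have := d0; rewrite ltcE => /andP[].
  exists (Re d) => // v hv; have := hd v.
  rewrite /= -ball_normE /= !sub0r !normrN !rnormC (ge0_Re (ltW d0)) !ltcR.
  by apply.
exists (2 / d); first by rewrite divr_ge0 // ltW.
move=> v; have [e|e] := eqVneq (rnorm v) 0.
  by rewrite (rnorm_eq0 e) T0 rnorm0 mulr0.
have p : 0 < rnorm v by rewrite lt_def e rnorm_ge0.
have q : 0 < d / 2 / rnorm v by rewrite !divr_gt0.
have := hd ((d / 2 / rnorm v)%:C *: v).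
rewrite TZ !rnormZ mod_pos ?(ltW q) // divfK // => h.
have {}h : d / 2 / rnorm v * rnorm (T v) < 1 by apply: h; lra.
have -> : 2 / d * rnorm v = (d / 2 / rnorm v)^-1 by field; rewrite !gt_eqF.
by rewrite -[leRHS]mul1r ler_pdivlMr // mulrC ltW.
Qed.

Lemma bounded_continuous (T : H -> H) M : linear T ->
  (forall v, rnorm (T v) <= M * rnorm v) -> bounded_operator T.
Proof.
move=> Tl TM; split => // x; apply/cvgrPdist_lt => e e0.
have re : 0 < Re e by have := e0; rewrite ltcE => /andP[].
have M1 : 0 < `|M| + 1 by rewrite ltr_wpDl.
have d0 : 0 < (Re e / (`|M| + 1))%:C :> C by rewrite ltcR divr_gt0.
apply/nbhs_ballP; exists (Re e / (`|M| + 1))%:C => //= y; rewrite -ball_normE /= rnormC ltcR => h.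
rewrite -linear_funB // rnormC (ge0_Re (ltW e0)) ltcR; apply: le_lt_trans (TM _) _.
apply: (@le_lt_trans _ _ ((`|M| + 1) * rnorm (x - y))).
  by rewrite ler_wpM2r ?rnorm_ge0 // (le_trans (ler_norm _)) // lerDl.
by rewrite mulrC -ltr_pdivlMr.
Qed.

Lemma commutant_act (T : H -> H) g v : M' T ->
  T (urep_act U g v) = urep_act U g (T v).
Proof.
move=> [_ cT].
have e w : rep_ext (fs_of [fset g]%fset (fun=> 1)) w = urep_act U g w.
  by rewrite rep_ext_fs_of big_seq_fset1 scale1r.
have := cT (rep_ext (U := U) (fs_of [fset g]%fset (fun=> 1))).
have r : range (fun a : {fsfun G -> C with 0} => rep_ext (U := U) a)
   (rep_ext (U := U) (fs_of [fset g]%fset (fun=> 1))) by exists (fs_of [fset g]%fset (fun=> 1)).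
by move=> /(_ r) /(congr1 (fun f => f v)); rewrite /= !e.
Qed.

Lemma commutant_intro (T : H -> H) : bounded_operator T ->
  (forall g v, T (urep_act U g v) = urep_act U g (T v)) -> M' T.
Proof.
move=> bT cT; split => // _ [a _ <-]; apply/funext => v /=.
case: bT => Tl _.
have T0 := linear_fun0 Tl.
rewrite /rep_ext; elim: (finsupp a : seq G) => [|g l IH]; first by rewrite !big_nil.
by rewrite !big_cons Tl IH cT.
Qed.

Lemma commutant_adjoint (T : H -> H) : M' T ->
  exists2 T', M' T' & forall v w, '[T v, w] = '[v, T' w].
Proof.
move=> MT; have [bT _] := MT; have [M M0 HM] := operator_bounded bT; have [Tl _] := bT.
have /choice[T' HT'] w : exists w', forall v, '[T v, w] = '[v, w'].
  apply: (@riesz _ _ U (fun v => '[T v, w]) (M * rnorm w)).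
    by move=> c v v'; rewrite Tl udotDl udotZl.
  move=> v; apply: le_trans (udot_CS _ _) _.
  by rewrite mulrAC ler_wpM2r ?rnorm_ge0.
have uniq (a b : H) : (forall v, '[v, a] = '[v, b]) -> a = b.
  move=> e; apply/eqP; rewrite -subr_eq0; apply/eqP; apply: rnorm_eq0; apply/eqP.
  by rewrite -sqrf_eq0 rnorm_sqrE udotBr e subrr.
exists T' => //; apply: commutant_intro; last first.
  move=> g v; apply: uniq => x; rewrite -HT'.
  by rewrite -[in RHS](invgK g) -udot_act -HT' commutant_act // udot_act invgK.
apply: (@bounded_continuous _ M).
  by move=> c a b; apply: uniq => x; rewrite -HT' !udotDr !udotZr !HT'.
move=> w; have [e|e] := eqVneq (rnorm (T' w)) 0.
  by rewrite e mulr_ge0 ?rnorm_ge0.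
have p : 0 < rnorm (T' w) by rewrite lt_def e rnorm_ge0.
rewrite -(ler_pM2l p) -expr2 rnorm_sqrE -HT'; apply: le_trans (Re_le_mod _) _.
apply: le_trans (udot_CS _ _) _.
by rewrite mulrA [_ * M]mulrC ler_wpM2r ?rnorm_ge0.
Qed.

Lemma commutant_lin c (S T : H -> H) : M' S -> M' T -> M' (fun v => c *: S v + T v).
Proof.
move=> MS MT; have [bS _] := MS; have [bT _] := MT.
have [A A0 HA] := operator_bounded bS; have [B B0 HB] := operator_bounded bT.
have [Sl _] := bS; have [Tl _] := bT.
apply: commutant_intro; last first.
  by move=> g v; rewrite (commutant_act _ _ MS) (commutant_act _ _ MT) [RHS]linearP.
apply: (@bounded_continuous _ (modulus c * A + B)).
  move=> d v w; rewrite Sl Tl !scalerDr !scalerA [c * d]mulrC -!addrA; congr (_ + _).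
  by rewrite addrCA.
move=> v; apply: le_trans (rnormD _ _) _; rewrite rnormZ mulrDl; apply: lerD => //.
by rewrite -mulrA ler_wpM2l ?mod_ge0.
Qed.

Lemma commutant_comp (S T : H -> H) : M' S -> M' T -> M' (fun v => S (T v)).
Proof.
move=> MS MT; have [bS _] := MS; have [bT _] := MT.
have [A A0 HA] := operator_bounded bS; have [B B0 HB] := operator_bounded bT.
have [Sl _] := bS; have [Tl _] := bT.
apply: commutant_intro; last first.
  by move=> g v; rewrite (commutant_act _ _ MT) (commutant_act _ _ MS).
apply: (@bounded_continuous _ (A * B)); first by move=> d v w; rewrite Tl Sl.
move=> v; apply: le_trans (HA _) _; rewrite -mulrA; exact: ler_wpM2l.
Qed.

Lemma commutant_id : M' idfun.
Proof.
apply: commutant_intro => //; apply: (@bounded_continuous _ 1) => // v.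
by rewrite mul1r.
Qed.

(* The projection onto the closure of M' xi lies in the double commutant, and
   its complement annihilates xi. *)
Lemma separating_cyclic :
  (forall T, @rep_vN R G U T -> positive_operator T -> '[T xi, xi] = 0 -> T = (fun=> 0)) ->
  forall v e, 0 < e -> exists2 T, M' T & rnorm (v - T xi) < e.
Proof.
move=> faithful.
pose K : set H := [set v | forall e, 0 < e -> exists2 T, M' T & rnorm (v - T xi) < e].
have sK : subspace K.
  split.
  - move=> e e0; exists (fun v => (-1) *: v + v).
      exact: commutant_lin commutant_id commutant_id.
    by rewrite scaleN1r addNr subr0 rnorm0.
  - move=> c v w Kv Kw e e0; have c1 : 0 < modulus c + 1 by rewrite ltr_wpDl ?mod_ge0.
    have e1 : 0 < e / 2 / (modulus c + 1) by rewrite !divr_gt0.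
    have e2 : 0 < e / 2 by rewrite divr_gt0.
    have [S MS hS] := Kv _ e1; have [T MT hT] := Kw _ e2.
    exists (fun v => c *: S v + T v); first exact: commutant_lin.
    rewrite opprD addrACA -scalerBr; apply: le_lt_trans (rnormD _ _) _.
    rewrite rnormZ [e]splitr; apply: ler_ltD hT.
    rewrite ltr_pdivlMr // mulrC in hS; apply: le_trans (ltW hS).
    by rewrite ler_wpM2r ?rnorm_ge0 // lerDl.
  - move=> v Hv e e0; have e2 : 0 < e / 2 by rewrite divr_gt0.
    have [w Kw hw] := Hv _ e2; have [T MT hT] := Kw _ e2; exists T => //.
    apply: le_lt_trans (rnorm_triangle w _ _) _.
    by rewrite [e]splitr ltrD.
have [K0 Klin _] := sK.
have KZ c v : K v -> K (c *: v) by move=> Kv; rewrite -[_ *: _]addr0; exact: Klin.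
have KD v w : K v -> K w -> K (v + w).
  by move=> Kv Kw; rewrite -[v]scale1r; exact: Klin.
have /choice[P HP] x : exists y, K y /\ forall k, K k -> '[x - y, k] = 0.
  by have [y Ky hy] := orthogonal_projection x sK; exists y.
have Kxi : K xi by move=> e e0; exists idfun; [exact: commutant_id|rewrite subrr rnorm0].
have Punique x y : K y -> (forall k, K k -> '[x - y, k] = 0) -> P x = y.
  move=> Ky hy; have [KP hP] := HP x; apply/eqP; rewrite -subr_eq0; apply/eqP.
  apply: rnorm_eq0; apply/eqP; rewrite -sqrf_eq0 rnorm_sqrE.
  have Kd : K (P x - y) by rewrite -scaleN1r addrC; exact: Klin.
  have -> : '[P x - y, P x - y] = '[x - y, P x - y] - '[x - P x, P x - y].
    rewrite -udotBl; congr (urep_dot U _ _).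
    by rewrite opprB [RHS]addrC addrA subrK.
  by rewrite hy // hP // subrr.
pose Q x := x - P x.
have Plin : linear P.
  move=> c v w; have [Kv hv] := HP v; have [Kw hw] := HP w.
  apply: Punique; first exact: Klin.
  move=> k Kk; rewrite opprD addrACA -scalerBr udotDl udotZl hv // hw //.
  by rewrite mulr0 addr0.
have Qlin : linear Q.
  by move=> c v w; rewrite /Q Plin opprD addrACA -scalerBr.
have QQ v : '[Q v, v] = '[Q v, Q v].
  have [Kv hv] := HP v; rewrite /Q [in RHS]udotBr [X in _ = _ - X]hv //.
  by rewrite subr0.
have bQ : bounded_operator Q.
  apply: (@bounded_continuous _ 1) => // v; rewrite mul1r.
  have [e|e] := eqVneq (rnorm (Q v)) 0; first by rewrite e rnorm_ge0.
  have p : 0 < rnorm (Q v) by rewrite lt_def e rnorm_ge0.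
  rewrite -(ler_pM2l p) -expr2 rnorm_sqrE -QQ.
  exact: le_trans (Re_le_mod _) (udot_CS _ _).
have KT T v : M' T -> K v -> K (T v).
  move=> MT Kv e e0; have [bT _] := MT; have [A A0 HA] := operator_bounded bT.
  have A1 : 0 < A + 1 by rewrite ltr_wpDl.
  have [S MS hS] := Kv _ (divr_gt0 e0 A1).
  exists (fun v => T (S v)); first exact: commutant_comp.
  have [Tl _] := bT.
  rewrite -linear_funB //.
  apply: le_lt_trans (HA _) _; rewrite ltr_pdivlMr // mulrC in hS.
  by apply: le_lt_trans hS; rewrite ler_wpM2r ?rnorm_ge0 // lerDl.
(* [K] is stable under the commutant, which is closed under adjoints; so the orthogonal complement
   of [K] is stable too, and [Q] commutes with the commutant. *)
have vQ : @rep_vN R G U Q.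
  split => // T MT; apply/funext => v /=; have [Kv hv] := HP v.
  have [T' MT' hT'] := commutant_adjoint MT; have [[Tl _] _] := MT.
  rewrite /Q linear_funB //; congr (_ - _); apply: Punique; first exact: KT.
  by move=> k Kk; rewrite -linear_funB // hT' hv //; exact: KT.
have Q0 : Q = (fun=> 0).
  apply: faithful => //; first by move=> v; rewrite QQ rnorm_sqr ler0c sqr_ge0.
  have -> : Q xi = 0; last exact: udot0l.
  rewrite /Q (@Punique xi xi) ?subrr // => k _; exact: udot0l.
move=> v; have [Kv _] := HP v; suff -> : v = P v by exact: Kv.
by apply/eqP; rewrite -subr_eq0; apply/eqP; have := congr1 (fun f => f v) Q0.
Qed.

(** The norm closure in B(G) of the kernel space of [coef xi xi]. *)
Definition coef_closure : set (G -> C) := [set phi | BG phi /\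
  forall e, 0 < e -> exists v : H, ball_B e (fun g => phi g - coef v xi g)].

Lemma coef_closure_coef v : coef_closure (coef v xi).
Proof.
split; first exact: BG_coef.
move=> e e0; exists v; under eq_fun do rewrite subrr.
by apply: ball_fun0; exact: ltW.
Qed.

Lemma coef_closure_closed : closed_subspace coef_closure.
Proof.
split; first by move=> phi [].
- have -> : (fun _ : G => 0 : C) = coef (0 : H) xi.
    by apply/funext => g; rewrite /coef linear0 udot0l.
  exact: coef_closure_coef.
- move=> c phi psi [h Hp] [h' Hp']; split; first exact: BG_lin.
  move=> e e0; have c1 : 0 < modulus c + 1 by rewrite ltr_wpDl ?mod_ge0.
  have e1 : 0 < e / 2 / (modulus c + 1) by rewrite !divr_gt0.
  have e2 : 0 < e / 2 by rewrite divr_gt0.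
  have [v bv] := Hp _ e1; have [w bw] := Hp' _ e2; exists (c *: v + w).
  have := ballD (ballZ c bv) bw.
  have -> : (fun g => c * (phi g - coef v xi g) + (psi g - coef w xi g)) =
      (fun g => c * phi g + psi g - coef (c *: v + w) xi g).
    by apply/funext => g; rewrite coef_linl; ring.
  apply: ball_le; rewrite [leRHS]splitr lerD2r mulrCA ler_piMr ?(ltW e2) //.
  by rewrite ler_pdivrMr // mul1r lerDl.
move=> phi h Hp; split => // e e0; have e2 : 0 < e / 2 by rewrite divr_gt0.
have [psi [hp Hpsi] b] := Hp _ e2; have [v bv] := Hpsi _ e2; exists v.
have := ballD b bv; rewrite -splitr; congr ball_B; apply/funext => g; ring.
Qed.

Lemma coef_closure_rinv : rinvariant coef_closure.
Proof.
move=> k phi [h Hp]; split; first exact: BG_rtr.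
move=> e /Hp[v b]; exists (urep_act U k v); rewrite -rtr_coef; exact: (ball_rtr k b).
Qed.

Hypothesis xi_cyclic : forall v e, 0 < e -> exists2 T, M' T & rnorm (v - T xi) < e.

(** For [T] in the commutant, with adjoint [T'], the coefficient of [v] against [T xi] is that of
    [T' v] against [xi]. By density every coefficient lies in the closure, in particular those
    against translates of [xi], which are the left translates. *)
Lemma coef_closure_linv : linvariant coef_closure.
Proof.
have cf (v w : H) : coef_closure (coef v w).
  have [_ _ _ Scl] := coef_closure_closed; apply: Scl; first exact: BG_coef.
  move=> e e0; have v1 : 0 < rnorm v + 1 by rewrite ltr_wpDl ?rnorm_ge0.
  have [T MT hT] := xi_cyclic w (divr_gt0 e0 v1).
  have [T' MT' hT'] := commutant_adjoint MT.
  have e1 : coef v (T xi) = coef (T' v) xi.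
    apply/funext => g; rewrite /coef -(commutant_act g v MT').
    by rewrite udotC hT' -udotC.
  exists (coef v (T xi)); first by rewrite e1; exact: coef_closure_coef.
  have -> : (fun g => coef v w g - coef v (T xi) g) = coef v (w - T xi).
    by apply/funext => g; rewrite coefBr.
  apply: ball_coef_le; move: hT; rewrite ltr_pdivlMr // mulrC => /ltW.
  by apply: le_trans; rewrite ler_wpM2r ?rnorm_ge0 // lerDl.
move=> k phi [h Hp]; have [_ _ _ Scl] := coef_closure_closed.
apply: Scl; first exact: BG_ltr.
move=> e /Hp[v b]; exists (coef v (urep_act U k^-1%g xi)); first exact: cf.
by rewrite -ltr_coef; exact: (ball_ltr k b).
Qed.

End Faithful.

(** * Powers of functions in the kernel space of a faithful function *)

Section PowersOfFaithful.
Variables (R : realType) (G : groupType).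
Local Notation C := (R[i]).
Local Notation Re := complex.Re.
Implicit Types (phi psi h u : G -> C).

Lemma inHX u phi n : positive_definite u -> inH (gk u) phi ->
  inH (gk (fun x => u x ^+ n)) (fun x => phi x ^+ n).
Proof.
move=> pu [a a0 d]; exists (a ^+ n); first exact: exprn_ge0.
elim: n => [|n IH].
  move=> s; have := dom_self (@pd_cst1 R G) s.
  by congr (modulus (ev _ s) ^+ 2 <= _ * qf (gk _) s); apply/funext.
have := domM (pd_psd pu) (pd_psd (pdX n pu)) d IH a0 (exprn_ge0 n a0).
rewrite -exprS => H s; have := H s.
by congr (modulus (ev _ s) ^+ 2 <= _ * qf _ s);
  [apply/funext => x|apply/funext => x; apply/funext => y]; rewrite /gk exprS.
Qed.

(** Induction on h^(n+1) - phi^(n+1) = h (h^n - phi^n) + (h - phi) phi^n, where [e <= 1] keeps [phi]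
    in a fixed ball. *)
Lemma ball_pow_dist r h n : ball_B r h -> exists2 M, 0 < M &
  forall e phi, e <= 1 -> ball_B e (fun x => h x - phi x) ->
    ball_B (M * e) (fun x => h x ^+ n - phi x ^+ n).
Proof.
move=> bh; have r0 := ball_ge0 bh; elim: n => [|n [M M0 IH]].
  exists 1 => // e phi e1 b.
  have -> : (fun x => h x ^+ 0 - phi x ^+ 0) = (fun=> 0).
    by apply/funext => x; rewrite !expr0 subrr.
  by apply: ball_fun0; rewrite mul1r; exact: ball_ge0 b.
exists (r * M + (r + 1) ^+ n + 1).
  by rewrite ltr_wpDl // addr_ge0 ?mulr_ge0 ?exprn_ge0 ?addr_ge0 // ltW.
move=> e phi e1 b; have e0 := ball_ge0 b.
have bphi : ball_B (r + 1) phi.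
  have := ballB bh b; have -> : (fun x => h x - (h x - phi x)) = phi.
    by apply/funext => x; rewrite subKr.
  by apply: ball_le; rewrite lerD2l.
have := ballD (ballM bh (IH e phi e1 b)) (ballM b (ballX n bphi)).
have -> : (fun x => h x * (h x ^+ n - phi x ^+ n) + (h x - phi x) * phi x ^+ n) =
    (fun x => h x ^+ n.+1 - phi x ^+ n.+1).
  by apply/funext => x; rewrite !exprS; ring.
apply: ball_le; rewrite mulrA [e * _]mulrC -mulrDl.
by rewrite ler_wpM2r // lerDl.
Qed.

(** For [phi] in the kernel space of [f], the power phi^n lies in that of f^n and is fixed by [z].
    This passes to [h], since powers are locally Lipschitz and [z] is a contraction. *)
Lemma fixed_pow (f : G -> C) z n h : positive_definite f ->
  central_projection z -> fixed z (fun x => f x ^+ n) ->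
  (forall e, 0 < e -> exists2 phi, inH (gk f) phi & ball_B e (fun x => h x - phi x)) ->
  BG h -> z (fun x => h x ^+ n) = h 1%g ^+ n.
Proof.
move=> pf cz fz H hh; have [r bh] := BG_ball hh.
have [M M0 HM] := ball_pow_dist n bh; have Wz := central_Wstar cz.
apply/eqP; rewrite -subr_eq0; apply/eqP; apply: mod_eq0; apply/eqP.
rewrite eq_le mod_ge0 andbT; apply/ler_addgt0Pr => e e0; rewrite add0r.
pose d := Num.min 1 (e / (2 * M)).
have d0 : 0 < d by rewrite lt_min ltr01 divr_gt0 // mulr_gt0.
have d1 : d <= 1 by rewrite ge_min lexx.
have dM : 2 * (M * d) <= e.
  by rewrite mulrA mulrC -ler_pdivlMr ?mulr_gt0 // ge_min lexx orbT.
have [phi hphi b] := H d d0; have bn := HM d phi d1 b.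
have fphi : fixed z (fun x => phi x ^+ n).
  apply: (cs_inH (pdX n pf)) (inHX n pf hphi); [exact: fixed_closed|exact: fixed_rinv|].
  exact: fz.
have hB : BG phi := BG_inH pf hphi.
have -> : z (fun x => h x ^+ n) - h 1%g ^+ n =
    z (fun x => h x ^+ n - phi x ^+ n) - (h 1%g ^+ n - phi 1%g ^+ n).
  rewrite W_B //; [|exact: BGX|exact: BGX].
  by rewrite (fixed_1 fphi); ring.
apply: le_trans (modD _ _) _; rewrite modN; apply: le_trans dM.
have := central_contraction cz bn; have := ball_pt 1%g bn.
by lra.
Qed.

Lemma pow_bounded_eq0 (c : R) : 0 <= c ->
  (forall e, 0 < e -> exists M, forall n, (1 <= n)%N -> c ^+ n <= M * e ^+ n) -> c = 0.
Proof.
move=> c0 H; apply/eqP; rewrite eq_le c0 andbT leNgt; apply/negP => cp.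
(* With [e = c / 2] the hypothesis reads 1 <= M / 2^n for every n >= 1. *)
have c2 : 0 < c / 2 by rewrite divr_gt0.
have [M HM] := H _ c2.
have half : 0 <= (2^-1 : R) < 1 by apply/andP; split; lra.
have M1 : 0 < `|M| + 1 by rewrite ltr_wpDl.
have [N HN] := geometric_small half (divr_gt0 ltr01 M1).
have := HN N.+1 (leqnSn _); have := HM N.+1 isT.
rewrite expr_div_n -exprVn => h1 h2.
have cn : 0 < c ^+ N.+1 by exact: exprn_gt0.
have h3 : 1 <= M * 2^-1 ^+ N.+1.
  by rewrite -(ler_pM2l cn) mulr1 mulrCA.
have : `|M| * 2^-1 ^+ N.+1 < 1.
  rewrite ltr_pdivlMr // in h2; apply: le_lt_trans h2.
  by rewrite mulrC ler_wpM2l ?lerDl // exprn_ge0 // invr_ge0.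
rewrite ltNge => /negP; apply; apply: le_trans h3 _.
by rewrite ler_wpM2r ?ler_norm // exprn_ge0 // invr_ge0.
Qed.

Section Key.
Variable f : G -> C.
Hypotheses (pf : positive_definite f) (Ff : GNS_faithful f).
Hypothesis sing : forall n : nat, (1 <= n)%N -> singular (fun x => f x ^+ n).

Lemma support_kills_rad z : is_central_support f z -> forall psi, rad psi -> z psi = 0.
Proof.
move=> [cz carz minz] psi rpsi; have Wz := central_Wstar cz.
have [U [xi [[fE _] faith]]] := Ff.
have fc : f = coef xi xi by apply/funext.
have cyc := separating_cyclic faith.
pose L := coef_closure xi.
have cL : closed_subspace L := coef_closure_closed xi.
have rL : rinvariant L := @coef_closure_rinv _ _ _ xi.
have lL : linvariant L := coef_closure_linv cyc.
have fL : L f by rewrite fc; exact: coef_closure_coef.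
have cp := central_cproj cL rL lL.
(* The projection of [L] carries [f], so [z] lies below it; hence only the component of [psi] in [L]
   contributes to [h]. *)
have zp := minz _ cp (carries_cproj cL rL lL fL).
have hpsi : BG psi by case: rpsi.
have [psi1 sp] := splits_exists cL hpsi.
pose h := wact z psi.
have hrad : rad h by apply: cs_wact rpsi => //; [exact: rad_closed|exact: rad_rtr].
have hL : L h.
  have -> : h = wact z psi1.
    apply/funext => k; rewrite /h /wact -{1}zp wmulE; last exact: BG_ltr.
    by rewrite (wact_cproj cL lL (splits_ltr lL k sp)).
  by apply: cs_wact => //; case: sp.
have Hclos e : 0 < e -> exists2 phi, inH (gk f) phi & ball_B e (fun x => h x - phi x).
  move=> e0; case: hL => _ /(_ e e0)[v b]; exists (coef v xi) => //.
  exists (rnorm v ^+ 2); first exact: sqr_ge0.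
  by rewrite fc; exact: dom_coef.
have hB : BG h by case: hrad.
rewrite -(wact1 z psi) -/h; apply: mod_eq0; apply: pow_bounded_eq0.
  exact: mod_ge0.
move=> e e0; have [M M0 HM] := (proj2 hrad) e e0; exists M => n n1.
have [K fK b] := HM n.
(* The projection [zn] depends on [n], whereas [M] does not. *)
have [zn [w [[czn carzn _] [cw carw _] znw]]] := sing n1.
have fzn : fixed zn (fun x => f x ^+ n).
  by apply: fixed_carries => //; apply: BG_pd; exact: pdX.
have e1 := fixed_pow pf czn fzn Hclos hB.
have [hK zK] := singular_fsupp czn cw carw znw fK.
rewrite -modX -e1.
have -> : zn (fun x => h x ^+ n) = zn (fun x => h x ^+ n - K x).
  rewrite W_B ?zK ?subr0 //; first exact: central_Wstar.
  exact: BGX.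
exact: (central_contraction czn b).
Qed.

End Key.

End PowersOfFaithful.

Theorem proposition4p27 (R : realType) (G : groupType) (f : G -> R[i]) :
  BG f -> positive_definite f -> GNS_faithful f ->
  (forall n : nat, (1 <= n)%N -> singular (fun g => f g ^+ n)) ->
  forall g : G -> R[i], (@B0G R G `&` @NSG R G) g -> orthogonal_BG f g.
Proof.
move=> _ pf Ff sing g gB.
have rg := rad_B0_NS gB; have hg : BG g by case: rg.
(* The case n = 1 provides the central support of [f], because [f g ^+ 1] is convertible to
   [f g]. *)
have [z [w [sz _ _]]] := sing 1%N isT.
have {}sz : is_central_support f z by [].
exists z, (cproj (bispan g)); split => //; first exact: central_support_bispan.
apply/funext => phi; have [h|h] := pselect (BG phi); last first.
  by rewrite /wmul asboolF.
have cS := bispan_closed hg; have [phi1 sp] := splits_exists cS h.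
rewrite wmulE // (wact_cproj cS (@bispan_linv _ _ g) sp).
(* [phi1] lies in every closed bi-invariant subspace containing [g], and the radical functions form
   one. *)
apply: (support_kills_rad pf Ff sing sz); have [S1 _] := sp.
by apply: S1; [exact: rad_closed|exact: rad_rtr|exact: rad_ltr|].
Qed.
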